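(* We have $$\frac{\partial}{\partial z}\Big|_{z=1}\big(A_\phi(z;q)+B_\phi(-z^{-1};q)\big)=F_1(q)-F_2(q).$$ Moreover, $$\frac{\partial}{\partial z}\Big|_{z=1}\big(A_\phi(z;q)+B_\phi(-z^{-1};q)\big)\succeq 0,$$ that is, when expanded as a power series in $q$, all of its coefficients are non-negative.
   Context: Assume $|q|<1$, and let $(a;q)_n=\prod_{j=0}^{n-1}(1-aq^j)$ for $n\in\mathbb N_0\cup\{\infty\}$. Define $$A_\phi(z;q)=q\sum_{n=0}^\infty zq^n(-zq^{n+1};q)_n(-zq^{2n+1};q^2)_\infty,\qquad B_\phi(z;q)=1+\sum_{n=0}^\infty z^nq^{2n+1}(q;q^2)_n,$$ and $$F_2(q)=(-q;q^2)_\infty\sum_{m=1}^\infty\frac{q^{2m-1}}{1+q^{2m-1}},\qquad F_3(q)=(-q;q^2)_\infty\sum_{m=1}^\infty\frac{q^{2m}}{1+q^{2m}},$$ $$F_1(q)=F_3(q)\Big(1+2\sum_{n=1}^\infty q^{n^2}\Big)+2(-q;q^2)_\infty\sum_{n=1}^\infty q^{n^2}.$$ The notation $G(q)\succeq 0$ means that all coefficients of the $q$-series expansion of $G(q)$ are non-negative. *)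

(* Defs.v *)
(* Classical reals of Stdlib, complex numbers of Coquelicot. *)
From Stdlib Require Import Reals.
From Coquelicot Require Import Coquelicot.
Local Open Scope C_scope.

(* As for Coquelicot's RInt, the operators below are total: they return the
   limit when it exists and an unspecified value otherwise. *)
Definition Clim_seq (u : nat -> C) : C :=
  iota (fun l : C_CompleteNormedModule =>
          filterlim u eventually (locally (T := C_UniformSpace) l)).

Definition Cseries (a : nat -> C) : C :=
  iota (fun l : C_CompleteNormedModule =>
          is_series (K := C_AbsRing) (V := C_NormedModule) a l).

Fixpoint qpoch (a q : C) (n : nat) : C :=
  match n with
  | O => 1
  | S m => qpoch a q m * (1 - a * q ^ m)
  end.

Definition qpoch_inf (a q : C) : C := Clim_seq (qpoch a q).

Definition A_phi (z q : C) : C :=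
  q * Cseries (fun n =>
        z * q ^ n * qpoch (- (z * q ^ (n + 1))) q n
          * qpoch_inf (- (z * q ^ (2 * n + 1))) (q ^ 2)).

Definition B_phi (z q : C) : C :=
  1 + Cseries (fun n => z ^ n * q ^ (2 * n + 1) * qpoch q (q ^ 2) n).

(* Sums over an index starting at 1 are shifted: m = S k, so that
   2m - 1 = 2k + 1. *)
Definition F2 (q : C) : C :=
  qpoch_inf (- q) (q ^ 2)
    * Cseries (fun k => q ^ (2 * k + 1) / (1 + q ^ (2 * k + 1))).

Definition F3 (q : C) : C :=
  qpoch_inf (- q) (q ^ 2)
    * Cseries (fun k => q ^ (2 * S k) / (1 + q ^ (2 * S k))).

Definition F1 (q : C) : C :=
  F3 q * (1 + 2 * Cseries (fun k => q ^ (S k * S k)))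
    + 2 * qpoch_inf (- q) (q ^ 2) * Cseries (fun k => q ^ (S k * S k)).

(* G has a power series expansion, valid on the whole open unit disc (and
   therefore unique), with non-negative real coefficients. *)
Definition coef_nonneg (G : C -> C) : Prop :=
  exists a : nat -> R,
    (forall n, (0 <= a n)%R) /\
    (forall q : C, (Cmod q < 1)%R ->
       is_pseries (K := C_AbsRing) (V := C_NormedModule)
         (fun n => RtoC (a n)) q (G q)).

(* Main.v *)
Require Import Defs.
From Stdlib Require Import Reals ZArith Lia Lra Psatz.
From Coquelicot Require Import Coquelicot.
Local Open Scope C_scope.

(** The left-hand side has a closed form near z = 1, and its derivative can
be read off from it. Write P(z) for the infinite product (-zq;q^2).

First, A(z) + z P(z) and the power series L(z), the sum over j >= 1 of
z^j q^{(j-1)^2} / (q;q^2)_j, satisfy the same functional equation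
q M(z) = (1 + z) M(z q^2) + q z (A_functional, L_functional), which has only
one solution of order z at 0 (functional_unique), so they agree
(A_plus_product). Next, B(-1/z) - 1 consists of exactly the terms with j <= 0
of the same sum, if (q;q^2)_j is read as a quotient of infinite products
(L_plus_B). Multiplying the bilateral sum by 1 + q^2/z, 1 + q^4/z, ... replaces
the denominators (q;q^2)_j successively by (q;q^2)_{j+1}, (q;q^2)_{j+2}, ... ;
in the limit all of them become (q;q^2) and a theta function remains
(bilateral_product). Hence
   A(z) + B(-1/z) = 1 + z theta(z) / ((q;q^2) (-q^2/z;q^2)) - z P(z),
where theta(z) is the sum of z^n q^{n^2} over all integers n. As theta is
symmetric under z -> 1/z, its derivative at 1 vanishes, and logarithmic
derivatives of the two products together with Euler's identity
(-q;q^2) (q;q^2) (-q^2;q^2) = 1 give F1 - F2 (derivative_at_1).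

For the signs, let P = P(1), let S_even and S_odd be the sums of
q^m / (1 + q^m) over even and odd m >= 1, and let X = S_even - S_odd
+ 2 (q + q^4 + q^9 + ...). Then F3 = P S_even and
F1 - F2 = P X + 2 (q + q^4 + q^9 + ...) F3. The coefficients of P do not
decrease from q^2 on; precisely, (1 - q) P = 1 - q^2 + q^3 + q^8 + a series with
non-negative coefficients (product_times_1_minus_q). So, by summation by parts,
what matters are the partial sums of the coefficients of S_even and X. Those
of X count pairs (m,k) with m k <= N with the sign (-1)^{m+k-1}, up to the
squares, and are non-negative by symmetry in m and k (psum_x_coef_nonneg);
those of S_even grow at least like N/4 (psum_s_even_lower). The only negative
term, -q^2, is absorbed by these gains (t_coef_nonneg, f3_coef_nonneg). *)

(** * Limits and series of complex numbers *)

(** Convergence measured with the modulus: the uniform structure of C is a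
product, and its balls are awkward for estimates of products and inverses.
The filter is arbitrary, so that sequences and limits at z = 1 share one
calculus. *)
Definition tends {T : Type} (F : (T -> Prop) -> Prop) (f : T -> C) (l : C) :=
  forall eps : R, (0 < eps)%R -> F (fun x => (Cmod (f x - l) < eps)%R).

Lemma tends_filterlim {T : Type} (F : (T -> Prop) -> Prop) {FF : Filter F}
  (f : T -> C) (l : C) :
  tends F f l <-> filterlim f F (locally (T := C_UniformSpace) l).
Proof.
split.
- intros H; apply filterlim_locally; intros eps.
  generalize (H eps (cond_pos eps)); apply filter_imp; intros x Hx.
  now apply C_NormedModule_mixin_compat1.
- intros H eps Heps.
  assert (Hs : (0 < sqrt 2)%R) by (apply sqrt_lt_R0; lra).
  assert (He : (0 < eps / sqrt 2)%R) by (apply Rdiv_lt_0_compat; lra).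
  generalize (proj1 (filterlim_locally f l) H (mkposreal _ He)).
  apply filter_imp; intros x Hx.
  apply C_NormedModule_mixin_compat2 in Hx; simpl in Hx.
  replace eps with (sqrt 2 * (eps / sqrt 2))%R by (field; lra).
  exact Hx.
Qed.

Section Limits.
Context {T : Type} (F : (T -> Prop) -> Prop) {FF : Filter F}.

Lemma tends_ext_loc (f g : T -> C) (l : C) :
  F (fun x => f x = g x) -> tends F f l -> tends F g l.
Proof.
intros E H eps Heps; generalize (filter_and _ _ E (H eps Heps)).
apply filter_imp; intros x [e Hx]; now rewrite <- e.
Qed.

Lemma tends_ext (f g : T -> C) (l : C) :
  (forall x, f x = g x) -> tends F f l -> tends F g l.
Proof. intros E; apply tends_ext_loc; now apply filter_forall. Qed.

Lemma tends_val (f : T -> C) (l m : C) : l = m -> tends F f l -> tends F f m.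
Proof. now intros ->. Qed.

Lemma tends_const (c : C) : tends F (fun _ => c) c.
Proof.
intros eps Heps; apply filter_forall; intros _.
replace (c - c) with (RtoC 0) by ring; now rewrite Cmod_0.
Qed.

Lemma tends_bound (f : T -> C) (l : C) :
  tends F f l -> F (fun x => (Cmod (f x) <= Cmod l + 1)%R).
Proof.
intros H; generalize (H 1%R Rlt_0_1); apply filter_imp; intros x Hx.
replace (f x) with (l + (f x - l)) by ring.
eapply Rle_trans; [apply Cmod_triangle|]; lra.
Qed.

Lemma tends_squeeze (f : T -> C) (l : C) (g : T -> C) (M : R) :
  F (fun x => (Cmod (f x - l) <= M * Cmod (g x))%R) -> tends F g 0 -> tends F f l.
Proof.
intros H Hg eps Heps.
assert (HM : (0 < Rabs M + 1)%R) by (generalize (Rabs_pos M); lra).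
assert (He : (0 < eps / (Rabs M + 1))%R) by (now apply Rdiv_lt_0_compat).
generalize (filter_and _ _ H (Hg _ He)); apply filter_imp; intros x [H1 H2].
replace (g x - 0) with (g x) in H2 by ring.
eapply Rle_lt_trans; [exact H1|].
apply Rle_lt_trans with ((Rabs M + 1) * Cmod (g x))%R.
- apply Rmult_le_compat_r; [apply Cmod_ge_0|]; generalize (Rle_abs M); lra.
- apply Rlt_le_trans with ((Rabs M + 1) * (eps / (Rabs M + 1)))%R.
  + now apply Rmult_lt_compat_l.
  + right; field; lra.
Qed.

Lemma tends_plus (f g : T -> C) (l m : C) :
  tends F f l -> tends F g m -> tends F (fun x => f x + g x) (l + m).
Proof.
intros Hf Hg eps Heps.
assert (He : (0 < eps / 2)%R) by lra.
generalize (filter_and _ _ (Hf _ He) (Hg _ He)).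
apply filter_imp; intros x [H1 H2].
replace (f x + g x - (l + m)) with ((f x - l) + (g x - m)) by ring.
eapply Rle_lt_trans; [apply Cmod_triangle|]; lra.
Qed.

Lemma tends_mult (f g : T -> C) (l m : C) :
  tends F f l -> tends F g m -> tends F (fun x => f x * g x) (l * m).
Proof.
intros Hf Hg eps Heps.
set (K := (Cmod l + Cmod m + 2)%R).
assert (HK : (0 < K)%R) by (unfold K; generalize (Cmod_ge_0 l) (Cmod_ge_0 m); lra).
assert (He : (0 < eps / K)%R) by (now apply Rdiv_lt_0_compat).
generalize (filter_and _ _ (tends_bound _ _ Hg)
             (filter_and _ _ (Hf _ He) (Hg _ He))).
apply filter_imp; intros x [Hb [H1 H2]].
replace (f x * g x - l * m) with ((f x - l) * g x + l * (g x - m)) by ring.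
eapply Rle_lt_trans; [apply Cmod_triangle|]; rewrite !Cmod_mult.
apply Rle_lt_trans with (eps / K * (Cmod m + 1) + Cmod l * (eps / K))%R.
- apply Rplus_le_compat.
  + apply Rmult_le_compat; try apply Cmod_ge_0; [now left|exact Hb].
  + apply Rmult_le_compat_l; [apply Cmod_ge_0|lra].
- assert (E : (eps / K * K = eps)%R) by (field; lra).
  assert (E2 : (eps / K * (Cmod m + 1) + Cmod l * (eps / K) = eps / K * (K - 1))%R)
    by (unfold K; ring).
  rewrite E2; lra.
Qed.

Lemma tends_opp (f : T -> C) (l : C) :
  tends F f l -> tends F (fun x => - f x) (- l).
Proof.
intros H eps Heps; generalize (H eps Heps); apply filter_imp; intros x Hx.
replace (- f x - - l) with (- (f x - l)) by ring; now rewrite Cmod_opp.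
Qed.

Lemma tends_minus (f g : T -> C) (l m : C) :
  tends F f l -> tends F g m -> tends F (fun x => f x - g x) (l - m).
Proof. intros Hf Hg; apply tends_plus; [exact Hf|now apply tends_opp]. Qed.

Lemma tends_inv (f : T -> C) (l : C) :
  l <> 0 -> tends F f l -> tends F (fun x => / f x) (/ l).
Proof.
intros Hl H.
assert (Hp : (0 < Cmod l)%R) by now apply Cmod_gt_0.
apply tends_squeeze with (g := fun x => f x - l) (M := (2 / (Cmod l * Cmod l))%R).
- assert (Hh : (0 < Cmod l / 2)%R) by lra.
  generalize (H _ Hh); apply filter_imp; intros x Hx.
  assert (Hlow : (Cmod l / 2 <= Cmod (f x))%R).
  { generalize (Cmod_triangle (f x) (- (f x - l))).
    replace (f x + - (f x - l)) with l by ring; rewrite Cmod_opp; lra. }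
  assert (Hfx : f x <> 0) by (intros E; rewrite E, Cmod_0 in Hlow; lra).
  replace (/ f x - / l) with (- (f x - l) * (/ f x * / l)) by (field; now split).
  rewrite !Cmod_mult, Cmod_opp, !Cmod_inv by assumption.
  rewrite Rmult_comm; apply Rmult_le_compat_r; [apply Cmod_ge_0|].
  replace (2 / (Cmod l * Cmod l))%R with (/ (Cmod l / 2) * / Cmod l)%R by (field; lra).
  apply Rmult_le_compat_r; [left; now apply Rinv_0_lt_compat|].
  apply Rinv_le_contravar; lra.
- replace (RtoC 0) with (l - l) by ring.
  apply tends_minus; [exact H|apply tends_const].
Qed.

Lemma tends_le {PF : ProperFilter' F} (f : T -> C) (l : C) (M : R) :
  tends F f l -> F (fun x => (Cmod (f x) <= M)%R) -> (Cmod l <= M)%R.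
Proof.
intros H HM; apply Rnot_lt_le; intros Hlt.
apply (filter_not_empty (F := F)).
assert (Hd : (0 < Cmod l - M)%R) by lra.
generalize (filter_and _ _ (H _ Hd) HM).
apply filter_imp; intros x [H1 H2].
generalize (Cmod_triangle (f x) (- (f x - l))).
replace (f x + - (f x - l)) with l by ring; rewrite Cmod_opp; lra.
Qed.

Lemma tends_unique {PF : ProperFilter' F} (f : T -> C) (l m : C) :
  tends F f l -> tends F f m -> l = m.
Proof.
intros H1 H2.
assert (H : tends F (fun x => f x - f x) (l - m)) by now apply tends_minus.
assert (E : (Cmod (l - m) <= 0)%R).
{ apply (tends_le _ _ _ H), filter_forall; intros x.
  replace (f x - f x) with (RtoC 0) by ring; rewrite Cmod_0; lra. }
assert (E0 : l - m = 0) by (apply Cmod_eq_0; generalize (Cmod_ge_0 (l - m)); lra).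
replace l with (l - m + m) by ring; rewrite E0; ring.
Qed.
End Limits.

Lemma tends_incr (u : nat -> C) (l : C) :
  tends eventually u l -> tends eventually (fun n => u (S n)) l.
Proof.
intros H eps Heps; destruct (H eps Heps) as [N HN].
exists N; intros n Hn; apply HN; lia.
Qed.

Lemma tends_decr (u : nat -> C) (l : C) :
  tends eventually (fun n => u (S n)) l -> tends eventually u l.
Proof.
intros H eps Heps; destruct (H eps Heps) as [N HN].
exists (S N); intros [|n] Hn; [lia|apply HN; lia].
Qed.

Lemma tends_pow (q : C) : (Cmod q < 1)%R -> tends eventually (fun n => q ^ n) 0.
Proof.
intros Hq eps Heps.
assert (H : Rabs (Cmod q) < 1) by (rewrite Rabs_pos_eq; [exact Hq|apply Cmod_ge_0]).
destruct (pow_lt_1_zero _ H eps Heps) as [N HN].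
exists N; intros n Hn.
replace (q ^ n - 0) with (q ^ n) by ring.
rewrite Cmod_pow; eapply Rle_lt_trans; [apply Rle_abs|now apply HN].
Qed.

Lemma Clim_seq_eq (u : nat -> C) (l : C) : tends eventually u l -> Clim_seq u = l.
Proof.
intros H; unfold Clim_seq.
apply (iota_filterlim_locally (K := C_AbsRing) (V := C_CompleteNormedModule)
         (F := eventually) u l).
now apply (tends_filterlim eventually).
Qed.

Notation Cis_series := (is_series (K := C_AbsRing) (V := C_NormedModule)).

Lemma sum_C_S (a : nat -> C) (n : nat) :
  sum_n (G := C_AbelianMonoid) a (S n) = sum_n (G := C_AbelianMonoid) a n + a (S n).
Proof. exact (sum_Sn a n). Qed.

Lemma series_tends (a : nat -> C) (l : C) :
  Cis_series a l <-> tends eventually (sum_n (G := C_AbelianMonoid) a) l.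
Proof. symmetry; apply (tends_filterlim eventually). Qed.

Lemma series_unique (a : nat -> C) (l m : C) :
  Cis_series a l -> Cis_series a m -> l = m.
Proof.
intros H1 H2; apply series_tends in H1; apply series_tends in H2.
exact (tends_unique eventually (sum_n (G := C_AbelianMonoid) a) l m H1 H2).
Qed.

Lemma Cseries_eq (a : nat -> C) (l : C) : Cis_series a l -> Cseries a = l.
Proof.
intros H; unfold Cseries.
apply (iota_unique (K := C_AbsRing) (V := C_CompleteNormedModule)); [|exact H].
intros y Hy; now apply (series_unique a).
Qed.

Lemma series_ext (a b : nat -> C) (l : C) :
  (forall n, a n = b n) -> Cis_series a l -> Cis_series b l.
Proof. intros E; now apply is_series_ext. Qed.

Lemma series_plus (a b : nat -> C) (l m : C) :
  Cis_series a l -> Cis_series b m -> Cis_series (fun n => a n + b n) (l + m).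
Proof. intros H1 H2; exact (is_series_plus _ _ _ _ H1 H2). Qed.

Lemma series_scal (c : C) (a : nat -> C) (l : C) :
  Cis_series a l -> Cis_series (fun n => c * a n) (c * l).
Proof. intros H; exact (is_series_scal c _ _ H). Qed.

Lemma series_minus (a b : nat -> C) (l m : C) :
  Cis_series a l -> Cis_series b m -> Cis_series (fun n => a n - b n) (l - m).
Proof.
intros H1 H2; apply (series_ext (fun n => a n + (-(1)) * b n)).
- intros n; ring.
- replace (l - m) with (l + (-(1)) * m) by ring.
  apply series_plus; [exact H1|now apply series_scal].
Qed.

(** Peeling off the first term: the step behind every shift of index below. *)
Lemma series_cons (a : nat -> C) (l : C) :
  Cis_series (fun n => a (S n)) l <-> Cis_series a (a O + l).
Proof.
assert (E : a O + l + - a O = l) by ring.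
split; intros H.
- apply is_series_decr_1; change (Cis_series (fun n => a (S n)) (a O + l + - a O)).
  now rewrite E.
- apply (is_series_incr_1 a l).
  replace (a O + l) with (l + a O) in H by ring; exact H.
Qed.

Lemma series_telescope (u : nat -> C) (l : C) :
  tends eventually u l -> Cis_series (fun n => u (S n) - u n) (l - u O).
Proof.
intros H; apply series_tends.
apply (tends_ext eventually (fun n => u (S n) - u O)).
- intros n; induction n as [|n IH].
  + now rewrite sum_O.
  + rewrite sum_Sn, <- IH.
    change (u (S (S n)) - u O = (u (S n) - u O) + (u (S (S n)) - u (S n))); ring.
- apply tends_minus; [apply eventually_filter|now apply tends_incr|].
  apply (tends_const eventually).
Qed.

Lemma series_le (a : nat -> C) (b : nat -> R) :
  (forall n, (Cmod (a n) <= b n)%R) -> ex_series b -> Cis_series a (Cseries a).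
Proof.
intros H Hb.
destruct (ex_series_le (K := C_AbsRing) (V := C_CompleteNormedModule) a b) as [l Hl].
- intros n; exact (H n).
- exact Hb.
- change (Cis_series a l) in Hl; now rewrite (Cseries_eq _ _ Hl).
Qed.

Lemma sum_le (a : nat -> C) (b : nat -> R) (n : nat) :
  (forall n, (Cmod (a n) <= b n)%R) ->
  (Cmod (sum_n (G := C_AbelianMonoid) a n) <= sum_n b n)%R.
Proof.
intros H; induction n as [|n IH].
- rewrite !sum_O; apply H.
- rewrite !sum_Sn; eapply Rle_trans; [apply Cmod_triangle|].
  now apply Rplus_le_compat.
Qed.

Lemma sum_le_series (b : nat -> R) (s : R) (n : nat) :
  (forall n, (0 <= b n)%R) -> is_series b s -> (sum_n b n <= s)%R.
Proof.
intros H Hs.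
apply (is_lim_seq_incr_compare (sum_n b) s); [exact Hs|].
intros k; rewrite sum_Sn; change (sum_n b k <= sum_n b k + b (S k))%R.
generalize (H (S k)); lra.
Qed.

Lemma series_norm (a : nat -> C) (b : nat -> R) (l : C) (s : R) :
  (forall n, (Cmod (a n) <= b n)%R) -> Cis_series a l -> is_series b s ->
  (Cmod l <= s)%R.
Proof.
intros H Ha Hb; apply series_tends in Ha.
apply (tends_le eventually _ _ _ Ha), filter_forall; intros n.
eapply Rle_trans; [now apply sum_le|apply sum_le_series; [|exact Hb]].
intros k; eapply Rle_trans; [apply Cmod_ge_0|apply H].
Qed.

Lemma series_remainder (a : nat -> C) (b : nat -> R) (l : C) (s : R) (n : nat) :
  (forall n, (Cmod (a n) <= b n)%R) -> Cis_series a l -> is_series b s ->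
  (Cmod (l - sum_n (G := C_AbelianMonoid) a n) <= s - sum_n b n)%R.
Proof.
intros H Ha Hb.
apply (series_norm (fun k => a (S n + k)%nat) (fun k => b (S n + k)%nat)).
- intros k; apply H.
- apply (is_series_incr_n a (S n)); [lia|].
  replace l with (l - sum_n (G := C_AbelianMonoid) a n
                  + sum_n (G := C_AbelianMonoid) a n) in Ha by ring.
  exact Ha.
- apply (is_series_incr_n b (S n)); [lia|].
  replace s with (s - sum_n b n + sum_n b n)%R in Hb by ring; exact Hb.
Qed.

(** Dominated convergence for series: up to a common tail the sums are finite
sums, whose limit is taken term by term. *)
Lemma tannery {T : Type} (F : (T -> Prop) -> Prop) {FF : Filter F}
  (u : T -> nat -> C) (v : nat -> C) (b : nat -> R) (S : T -> C) (L : C) :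
  F (fun t => Cis_series (u t) (S t) /\ forall k, (Cmod (u t k) <= b k)%R) ->
  (forall k, (Cmod (v k) <= b k)%R) -> ex_series b ->
  (forall k, tends F (fun t => u t k) (v k)) -> Cis_series v L -> tends F S L.
Proof.
intros HS Hv [s Hb] Hlim HL eps Heps.
assert (Hb' : is_lim_seq (sum_n b) s) by exact Hb.
apply is_lim_seq_spec in Hb'.
assert (He : (0 < eps / 4)%R) by lra.
destruct (Hb' (mkposreal _ He)) as [N HN]; simpl in HN.
specialize (HN N (le_n N)).
assert (Hfin : tends F (fun t => sum_n (G := C_AbelianMonoid) (u t) N)
                 (sum_n (G := C_AbelianMonoid) v N)).
{ clear HN; induction N as [|N IH].
  - apply (tends_ext F (fun t => u t O)).
    + intros t; now rewrite sum_O.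
    + rewrite sum_O; apply Hlim.
  - apply (tends_ext F (fun t => sum_n (G := C_AbelianMonoid) (u t) N + u t (Datatypes.S N))).
    + intros t; now rewrite sum_Sn.
    + rewrite sum_Sn; apply (tends_plus F); [exact IH|apply Hlim]. }
generalize (filter_and _ _ HS (Hfin (eps / 4)%R He)); apply filter_imp.
intros t [[Ht1 Ht2] Ht3].
assert (R1 := series_remainder _ _ _ _ N Ht2 Ht1 Hb).
assert (R2 := series_remainder _ _ _ _ N Hv HL Hb).
apply Rabs_def2 in HN.
set (A := sum_n (G := C_AbelianMonoid) (u t) N) in *.
set (B := sum_n (G := C_AbelianMonoid) v N) in *.
replace (S t - L) with ((S t - A) + (A - B) + - (L - B)) by ring.
eapply Rle_lt_trans; [apply Cmod_triangle|].
eapply Rle_lt_trans; [apply Rplus_le_compat_r, Cmod_triangle|].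
rewrite Cmod_opp; lra.
Qed.

Lemma ex_series_geom_scal (M r : R) :
  (0 <= r < 1)%R -> ex_series (fun n => M * r ^ n)%R.
Proof.
intros Hr; apply (ex_series_scal_l (K := R_AbsRing) (V := R_NormedModule)).
apply ex_series_geom; rewrite Rabs_pos_eq; lra.
Qed.

Lemma is_series_geom_scal (M r : R) :
  (0 <= r < 1)%R -> is_series (fun n => M * r ^ n)%R (M * / (1 - r))%R.
Proof.
intros Hr; apply (is_series_scal (K := R_AbsRing) (V := R_NormedModule)).
apply is_series_geom; rewrite Rabs_pos_eq; lra.
Qed.

Lemma series_geom_le (a : nat -> C) (M r : R) :
  (0 <= r < 1)%R -> (forall n, (Cmod (a n) <= M * r ^ n)%R) ->
  Cis_series a (Cseries a) /\ (Cmod (Cseries a) <= M / (1 - r))%R.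
Proof.
intros Hr H.
assert (Ha := series_le a _ H (ex_series_geom_scal M r Hr)).
split; [exact Ha|].
exact (series_norm _ _ _ _ H Ha (is_series_geom_scal M r Hr)).
Qed.

(** * Finite and infinite q-Pochhammer symbols *)

(** A bound for all partial products of (a;q)_n that depends only on the moduli
x = |a| and r = |q|, from 1 + t <= exp t. *)
Definition qbound (x r : R) : R := exp (x / (1 - r)).

Lemma qbound_pos (x r : R) : (0 < qbound x r)%R.
Proof. apply exp_pos. Qed.

Lemma qbound_mono (x y r : R) : (r < 1)%R -> (x <= y)%R -> (qbound x r <= qbound y r)%R.
Proof.
intros Hr H; unfold qbound; destruct H as [H| ->]; [|lra].
left; apply exp_increasing, Rmult_lt_compat_r; [apply Rinv_0_lt_compat; lra|exact H].
Qed.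

Lemma qpoch_bound (a q : C) (n : nat) :
  (Cmod q < 1)%R -> (Cmod (qpoch a q n) <= qbound (Cmod a) (Cmod q))%R.
Proof.
intros Hq; set (r := Cmod q) in *.
assert (Hr : (0 <= r)%R) by apply Cmod_ge_0.
assert (H : forall m, (Cmod (qpoch a q m)
              <= exp (Cmod a * ((1 - r ^ m) / (1 - r))))%R).
{ induction m as [|m IH]; simpl qpoch.
  - rewrite Cmod_1; simpl.
    replace (Cmod a * ((1 - 1) / (1 - r)))%R with 0%R by (field; lra).
    rewrite exp_0; lra.
  - rewrite Cmod_mult.
    replace (Cmod a * ((1 - r ^ S m) / (1 - r)))%R
      with (Cmod a * ((1 - r ^ m) / (1 - r)) + Cmod a * r ^ m)%R by (simpl; field; lra).
    rewrite exp_plus.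
    apply Rmult_le_compat; try apply Cmod_ge_0; [exact IH|].
    eapply Rle_trans; [apply Cmod_triangle|].
    rewrite Cmod_opp, Cmod_1, Cmod_mult, Cmod_pow; fold r.
    destruct (Req_dec (Cmod a * r ^ m) 0) as [-> |Hn]; [rewrite exp_0; lra|].
    left; now apply exp_ineq1. }
eapply Rle_trans; [apply H|].
assert (Hp : (0 <= r ^ n)%R) by now apply pow_le.
assert (Hle : (Cmod a * ((1 - r ^ n) / (1 - r)) <= Cmod a / (1 - r))%R).
{ apply Rmult_le_compat_l; [apply Cmod_ge_0|].
  unfold Rdiv; rewrite <- (Rmult_1_l (/ (1 - r))) at 2.
  apply Rmult_le_compat_r; [left; apply Rinv_0_lt_compat|]; lra. }
destruct Hle as [Hle|Hle]; [left; now apply exp_increasing|right; unfold qbound; now rewrite Hle].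
Qed.

Lemma qpoch_step_bound (a q : C) (n : nat) :
  (Cmod q < 1)%R ->
  (Cmod (qpoch a q (S n) - qpoch a q n)
     <= qbound (Cmod a) (Cmod q) * Cmod a * Cmod q ^ n)%R.
Proof.
intros Hq; simpl qpoch.
replace (qpoch a q n * (1 - a * q ^ n) - qpoch a q n)
  with (qpoch a q n * - (a * q ^ n)) by ring.
rewrite Cmod_mult, Cmod_opp, Cmod_mult, Cmod_pow, Rmult_assoc.
apply Rmult_le_compat_r; [|now apply qpoch_bound].
apply Rmult_le_pos; [apply Cmod_ge_0|apply pow_le, Cmod_ge_0].
Qed.

(** The increments of the partial products are dominated by a geometric
sequence. *)
Lemma qpoch_inf_tends (a q : C) :
  (Cmod q < 1)%R -> tends eventually (qpoch a q) (qpoch_inf a q).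
Proof.
intros Hq; set (r := Cmod q) in *.
assert (Hr : (0 <= r < 1)%R) by (split; [apply Cmod_ge_0|exact Hq]).
destruct (series_geom_le (fun n => qpoch a q (S n) - qpoch a q n) _ r Hr
            (fun n => qpoch_step_bound a q n Hq)) as [H _].
set (l := Cseries _) in H.
assert (Hl : tends eventually (qpoch a q) (1 + l)).
{ apply tends_decr, (tends_ext eventually
     (fun n => 1 + sum_n (G := C_AbelianMonoid)
                     (fun n => qpoch a q (S n) - qpoch a q n) n)).
  - intros n; induction n as [|n IH].
    + rewrite sum_O; simpl; ring.
    + rewrite sum_C_S, Cplus_assoc, IH; ring.
  - apply (tends_plus eventually); [apply (tends_const eventually)|].
    now apply series_tends. }
unfold qpoch_inf; now rewrite (Clim_seq_eq _ _ Hl).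
Qed.

Lemma qpoch_inf_eq (a q l : C) :
  tends eventually (qpoch a q) l -> qpoch_inf a q = l.
Proof. apply Clim_seq_eq. Qed.

Lemma qpoch_inf_bound (a q : C) :
  (Cmod q < 1)%R -> (Cmod (qpoch_inf a q) <= qbound (Cmod a) (Cmod q))%R.
Proof.
intros Hq; apply (tends_le eventually _ _ _ (qpoch_inf_tends a q Hq)).
apply filter_forall; intros n; now apply qpoch_bound.
Qed.

(** Here and for the infinite product, (a;q) = 1 + O(a) uniformly in the number
of factors, so all tails of a convergent product tend to 1. *)
Lemma qpoch_near_1 (a q : C) (n : nat) :
  (Cmod q < 1)%R ->
  (Cmod (qpoch a q n - 1)
     <= qbound (Cmod a) (Cmod q) / (1 - Cmod q) * Cmod a)%R.
Proof.
intros Hq; set (r := Cmod q) in *.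
assert (Hr : (0 <= r < 1)%R) by (split; [apply Cmod_ge_0|exact Hq]).
set (K := (qbound (Cmod a) r * Cmod a)%R).
assert (HK : (0 <= K)%R)
  by (apply Rmult_le_pos; [left; apply qbound_pos|apply Cmod_ge_0]).
apply Rle_trans with (K * ((1 - r ^ n) / (1 - r)))%R.
- induction n as [|n IH].
  + simpl qpoch; replace (1 - 1) with (RtoC 0) by ring; rewrite Cmod_0; simpl.
    right; field; lra.
  + replace (qpoch a q (S n) - 1)
      with ((qpoch a q (S n) - qpoch a q n) + (qpoch a q n - 1)) by ring.
    eapply Rle_trans; [apply Cmod_triangle|].
    apply Rle_trans with (K * r ^ n + K * ((1 - r ^ n) / (1 - r)))%R.
    * apply Rplus_le_compat; [now apply qpoch_step_bound|exact IH].
    * right; simpl; field; lra.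
- replace (qbound (Cmod a) r / (1 - r) * Cmod a)%R with (K * (1 / (1 - r)))%R
    by (unfold K; field; lra).
  apply Rmult_le_compat_l; [exact HK|].
  apply Rmult_le_compat_r; [left; apply Rinv_0_lt_compat; lra|].
  generalize (pow_le r n (proj1 Hr)); lra.
Qed.

Lemma qpoch_inf_near_1 (a q : C) :
  (Cmod q < 1)%R ->
  (Cmod (qpoch_inf a q - 1)
     <= qbound (Cmod a) (Cmod q) / (1 - Cmod q) * Cmod a)%R.
Proof.
intros Hq.
apply (tends_le eventually (fun n => qpoch a q n - 1)).
- apply (tends_minus eventually); [now apply qpoch_inf_tends|apply (tends_const eventually)].
- apply filter_forall; intros n; now apply qpoch_near_1.
Qed.

Lemma tends_qpoch_1 {T} (F : (T -> Prop) -> Prop) {FF : Filter F} (q : C)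
  (a : T -> C) (n : T -> nat) :
  (Cmod q < 1)%R -> tends F a 0 -> tends F (fun x => qpoch (a x) q (n x)) 1.
Proof.
intros Hq Ha.
apply (tends_squeeze F) with (g := a) (M := (qbound 1 (Cmod q) / (1 - Cmod q))%R); [|exact Ha].
generalize (Ha 1%R Rlt_0_1); apply filter_imp; intros x Hx.
replace (a x - 0) with (a x) in Hx by ring.
eapply Rle_trans; [now apply qpoch_near_1|].
apply Rmult_le_compat_r; [apply Cmod_ge_0|].
apply Rmult_le_compat_r; [left; apply Rinv_0_lt_compat; lra|].
apply qbound_mono; lra.
Qed.

Lemma tends_qpoch_inf_1 {T} (F : (T -> Prop) -> Prop) {FF : Filter F} (q : C) (a : T -> C) :
  (Cmod q < 1)%R -> tends F a 0 -> tends F (fun x => qpoch_inf (a x) q) 1.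
Proof.
intros Hq Ha.
apply (tends_squeeze F) with (g := a) (M := (qbound 1 (Cmod q) / (1 - Cmod q))%R); [|exact Ha].
generalize (Ha 1%R Rlt_0_1); apply filter_imp; intros x Hx.
replace (a x - 0) with (a x) in Hx by ring.
eapply Rle_trans; [now apply qpoch_inf_near_1|].
apply Rmult_le_compat_r; [apply Cmod_ge_0|].
apply Rmult_le_compat_r; [left; apply Rinv_0_lt_compat; lra|].
apply qbound_mono; lra.
Qed.

Lemma qpoch_add (a q : C) (m n : nat) :
  qpoch a q (m + n) = qpoch a q m * qpoch (a * q ^ m) q n.
Proof.
induction n as [|n IH]; [rewrite Nat.add_0_r; simpl; ring|].
rewrite Nat.add_succ_r; simpl qpoch; rewrite IH, Cpow_add_r; ring.
Qed.

Lemma qpoch_head (a q : C) (n : nat) :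
  qpoch a q (S n) = (1 - a) * qpoch (a * q) q n.
Proof.
change (S n) with (1 + n)%nat; rewrite qpoch_add, Cpow_1_r; simpl; ring.
Qed.

Lemma qpoch_inf_split (a q : C) (m : nat) :
  (Cmod q < 1)%R -> qpoch_inf a q = qpoch a q m * qpoch_inf (a * q ^ m) q.
Proof.
intros Hq; apply qpoch_inf_eq.
assert (H : tends eventually (fun n => qpoch a q (m + n))
              (qpoch a q m * qpoch_inf (a * q ^ m) q)).
{ apply (tends_ext eventually (fun n => qpoch a q m * qpoch (a * q ^ m) q n)).
  - intros n; now rewrite qpoch_add.
  - apply (tends_mult eventually); [apply (tends_const eventually)|now apply qpoch_inf_tends]. }
intros eps Heps; destruct (H eps Heps) as [N HN].
exists (m + N)%nat; intros n Hn.
replace n with (m + (n - m))%nat by lia; apply HN; lia.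
Qed.

Lemma qpoch_inf_head (a q : C) :
  (Cmod q < 1)%R -> qpoch_inf a q = (1 - a) * qpoch_inf (a * q) q.
Proof.
intros Hq; rewrite (qpoch_inf_split a q 1 Hq), Cpow_1_r; simpl; ring.
Qed.

Lemma one_minus_nz (x : C) : (Cmod x < 1)%R -> 1 - x <> 0.
Proof.
intros Hx E; assert (E1 : x = 1) by (replace x with (1 - (1 - x)) by ring; rewrite E; ring).
rewrite E1, Cmod_1 in Hx; lra.
Qed.

Lemma one_plus_nz (x : C) : (Cmod x < 1)%R -> 1 + x <> 0.
Proof.
intros Hx; replace (1 + x) with (1 - - x) by ring.
apply one_minus_nz; now rewrite Cmod_opp.
Qed.

Lemma Cmod_pow_lt_1 (q : C) (n : nat) : (Cmod q < 1)%R -> (Cmod (q ^ S n) < 1)%R.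
Proof.
intros Hq; rewrite Cmod_pow.
apply pow_lt_1_compat; [split; [apply Cmod_ge_0|exact Hq]|lia].
Qed.

Lemma Cmod_pow_le_1 (q : C) (n : nat) : (Cmod q < 1)%R -> (Cmod (q ^ n) <= 1)%R.
Proof.
intros Hq; destruct n as [|n]; [simpl; rewrite Cmod_1; lra|].
left; now apply Cmod_pow_lt_1.
Qed.

Lemma qpoch_nz (a q : C) (n : nat) :
  (forall k, 1 - a * q ^ k <> 0) -> qpoch a q n <> 0.
Proof.
intros H; induction n as [|n IH]; simpl.
- intros E; apply (f_equal fst) in E; simpl in E; lra.
- now apply Cmult_neq_0.
Qed.

(** Far out in the product the remaining factor is close to 1, hence nonzero;
what is left is a finite product of nonzero factors. *)
Lemma qpoch_inf_nz (a q : C) :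
  (Cmod q < 1)%R -> (forall k, 1 - a * q ^ k <> 0) -> qpoch_inf a q <> 0.
Proof.
intros Hq Ha.
assert (H : tends eventually (fun m => qpoch_inf (a * q ^ m) q) 1).
{ apply (tends_qpoch_inf_1 eventually _ _ Hq).
  replace (RtoC 0) with (a * 0) by ring.
  apply (tends_mult eventually); [apply (tends_const eventually)|now apply tends_pow]. }
destruct (H 1%R Rlt_0_1) as [m Hm]; specialize (Hm m (le_n m)).
rewrite (qpoch_inf_split a q m Hq); apply Cmult_neq_0; [now apply qpoch_nz|].
intros E; rewrite E in Hm.
replace (0 - 1) with (-(1)) in Hm by ring; rewrite Cmod_m1 in Hm; lra.
Qed.

Lemma Cmod_mult_pow_lt_1 (a q : C) (k : nat) :
  (Cmod q < 1)%R -> (Cmod a < 1)%R -> (Cmod (a * q ^ k) < 1)%R.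
Proof.
intros Hq Ha; rewrite Cmod_mult.
apply Rle_lt_trans with (Cmod a * 1)%R; [|lra].
apply Rmult_le_compat_l; [apply Cmod_ge_0|now apply Cmod_pow_le_1].
Qed.

Lemma qpoch_inf_nz_small (a q : C) :
  (Cmod q < 1)%R -> (Cmod a < 1)%R -> qpoch_inf a q <> 0.
Proof.
intros Hq Ha; apply qpoch_inf_nz; [exact Hq|].
intros k; now apply one_minus_nz, Cmod_mult_pow_lt_1.
Qed.

Lemma Cmod_sqr_lt_1 (q : C) : (Cmod q < 1)%R -> (Cmod (q ^ 2) < 1)%R.
Proof. apply Cmod_pow_lt_1. Qed.

(** By (1 + x)(1 - x) = 1 - x^2 the first two products give (q^2;q^4)_n and the
last two give (q^4;q^4)_n, and these interleave. *)
Lemma euler_finite (q : C) (n : nat) :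
  qpoch (- q) (q ^ 2) n * qpoch q (q ^ 2) n * qpoch (- q ^ 2) (q ^ 2) n
    * qpoch (q ^ 2) (q ^ 2) n = qpoch (q ^ 2) (q ^ 2) (2 * n).
Proof.
induction n as [|n IH]; [simpl; ring|].
replace (2 * S n)%nat with (S (S (2 * n))) by lia.
simpl qpoch; simpl qpoch in IH; rewrite <- IH.
replace ((q * (q * 1)) ^ S (n + (n + 0))) with (q * q * (q ^ n) ^ 4).
2:{ replace (S (n + (n + 0)))%nat with (1 + 2 * n)%nat by lia.
    rewrite Cpow_add_r, Cpow_1_r.
    replace (q * (q * 1)) with (q ^ 2) by (simpl; ring).
    rewrite <- !Cpow_mult_r; replace (2 * (2 * n))%nat with (n * 4)%nat by lia.
    simpl; ring. }
replace ((q * (q * 1)) ^ (n + (n + 0))) with ((q ^ n) ^ 4).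
2:{ replace (q * (q * 1)) with (q ^ 2) by (simpl; ring).
    rewrite <- !Cpow_mult_r; f_equal; lia. }
replace ((q * (q * 1)) ^ n) with ((q ^ n) ^ 2).
2:{ replace (q * (q * 1)) with (q ^ 2) by (simpl; ring).
    rewrite <- !Cpow_mult_r; f_equal; lia. }
simpl Cpow; ring.
Qed.

(** Let n tend to infinity in the finite identity and cancel (q^2;q^2). *)
Lemma euler_infinite (q : C) :
  (Cmod q < 1)%R ->
  qpoch_inf (- q) (q ^ 2) * qpoch_inf q (q ^ 2) * qpoch_inf (- q ^ 2) (q ^ 2) = 1.
Proof.
intros Hq; assert (HQ := Cmod_sqr_lt_1 q Hq).
assert (Hnz : qpoch_inf (q ^ 2) (q ^ 2) <> 0) by now apply qpoch_inf_nz_small.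
assert (E : qpoch_inf (- q) (q ^ 2) * qpoch_inf q (q ^ 2) * qpoch_inf (- q ^ 2) (q ^ 2)
             * qpoch_inf (q ^ 2) (q ^ 2) = qpoch_inf (q ^ 2) (q ^ 2)).
{ apply (tends_unique eventually (fun n => qpoch (q ^ 2) (q ^ 2) (2 * n))).
  - apply (tends_ext eventually _ _ _ (euler_finite q)).
    repeat apply (tends_mult eventually); now apply qpoch_inf_tends.
  - intros eps Heps; destruct (qpoch_inf_tends (q ^ 2) (q ^ 2) HQ eps Heps) as [N HN].
    exists N; intros n Hn; apply HN; lia. }
set (A := qpoch_inf (- q) (q ^ 2) * _ * _) in *.
replace A with (A * qpoch_inf (q ^ 2) (q ^ 2) * / qpoch_inf (q ^ 2) (q ^ 2)) by (field; exact Hnz).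
rewrite E; field; exact Hnz.
Qed.

(** * Complex derivatives at 1 *)

Notation near_1 := (locally (T := AbsRing_UniformSpace C_AbsRing) (RtoC 1)).

Lemma near_1_ball (d : R) : (0 < d)%R -> near_1 (fun z : C => (Cmod (z - 1) < d)%R).
Proof. intros Hd; exists (mkposreal d Hd); intros z Hz; exact Hz. Qed.

Lemma tends_id : tends near_1 (fun z : C => z) 1.
Proof. intros eps Heps; now apply near_1_ball. Qed.

(** Caratheodory's form of differentiability at 1: f(z) - f(1) is z - 1 times a
function with limit l. The rules for products, inverses and for z -> 1/z are
then limit rules. *)
Definition cderiv (f : C -> C) (l : C) :=
  exists g : C -> C, near_1 (fun z : C => f z - f 1 = (z - 1) * g z) /\ tends near_1 g l.

Lemma cderiv_is_derive (f : C -> C) (l : C) :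
  cderiv f l -> is_derive (K := C_AbsRing) (V := C_NormedModule) f (RtoC 1) l.
Proof.
intros [g [Hg Hl]]; split; [apply is_linear_scal_l|].
intros x Hx eps.
assert (E : RtoC 1 = x).
{ exact (is_filter_lim_locally_unique (V := AbsRing_NormedModule C_AbsRing) (RtoC 1) x Hx). }
subst x.
generalize (filter_and _ _ Hg (Hl eps (cond_pos eps))); apply filter_imp.
intros z [H1 H2].
change (Cmod ((f z - f 1) - (z - 1) * l) <= eps * Cmod (z - 1))%R.
rewrite H1; replace ((z - 1) * g z - (z - 1) * l) with ((g z - l) * (z - 1)) by ring.
rewrite Cmod_mult; apply Rmult_le_compat_r; [apply Cmod_ge_0|now left].
Qed.

Lemma cderiv_ext_loc (f g : C -> C) (l : C) :
  near_1 (fun z => f z = g z) -> f 1 = g 1 -> cderiv f l -> cderiv g l.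
Proof.
intros E E1 [h [Hh Hl]]; exists h; split; [|exact Hl].
generalize (filter_and _ _ E Hh); apply filter_imp; intros z [e H].
now rewrite <- e, <- E1.
Qed.

Lemma cderiv_val (f : C -> C) (l m : C) : l = m -> cderiv f l -> cderiv f m.
Proof. now intros ->. Qed.

Lemma cderiv_cont (f : C -> C) (l : C) : cderiv f l -> tends near_1 f (f 1).
Proof.
intros [g [Hg Hl]].
apply (tends_ext_loc near_1 (fun z => f 1 + (z - 1) * g z)).
- revert Hg; apply filter_imp; intros z Hz; rewrite <- Hz; ring.
- apply (tends_val near_1 _ (f 1 + (1 - 1) * l)); [ring|].
  apply (tends_plus near_1); [apply (tends_const near_1)|].
  apply (tends_mult near_1); [|exact Hl].
  apply (tends_minus near_1); [apply tends_id|apply (tends_const near_1)].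
Qed.

Lemma cderiv_id : cderiv (fun z => z) 1.
Proof.
exists (fun _ => 1); split; [|apply (tends_const near_1)].
apply filter_forall; intros z; ring.
Qed.

Lemma cderiv_const (c : C) : cderiv (fun _ => c) 0.
Proof.
exists (fun _ => 0); split; [|apply (tends_const near_1)].
apply filter_forall; intros z; ring.
Qed.

Lemma cderiv_plus (f g : C -> C) (l m : C) :
  cderiv f l -> cderiv g m -> cderiv (fun z => f z + g z) (l + m).
Proof.
intros [f' [Hf Hl]] [g' [Hg Hm]]; exists (fun z => f' z + g' z); split.
- generalize (filter_and _ _ Hf Hg); apply filter_imp; intros z [H1 H2].
  replace (f z + g z - (f 1 + g 1)) with ((f z - f 1) + (g z - g 1)) by ring.
  rewrite H1, H2; ring.
- now apply (tends_plus near_1).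
Qed.

Lemma cderiv_mult (f g : C -> C) (l m : C) :
  cderiv f l -> cderiv g m -> cderiv (fun z => f z * g z) (l * g 1 + f 1 * m).
Proof.
intros Df Dg; assert (Cg := cderiv_cont _ _ Dg).
destruct Df as [f' [Hf Hl]]; destruct Dg as [g' [Hg Hm]].
exists (fun z => f' z * g z + f 1 * g' z); split.
- generalize (filter_and _ _ Hf Hg); apply filter_imp; intros z [H1 H2].
  replace (f z * g z - f 1 * g 1) with ((f z - f 1) * g z + f 1 * (g z - g 1)) by ring.
  rewrite H1, H2; ring.
- apply (tends_plus near_1); apply (tends_mult near_1); try assumption.
  apply (tends_const near_1).
Qed.

Lemma cderiv_inv (f : C -> C) (l : C) :
  f 1 <> 0 -> cderiv f l -> cderiv (fun z => / f z) (- l / (f 1 * f 1)).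
Proof.
intros Hnz Df; assert (Cf := cderiv_cont _ _ Df).
destruct Df as [f' [Hf Hl]].
exists (fun z => - f' z * / (f z * f 1)); split.
- assert (Hp : (0 < Cmod (f 1))%R) by now apply Cmod_gt_0.
  generalize (filter_and _ _ Hf (Cf _ Hp)); apply filter_imp; intros z [H1 H2].
  assert (Hz : f z <> 0).
  { intros E; rewrite E in H2; replace (0 - f 1) with (- f 1) in H2 by ring.
    rewrite Cmod_opp in H2; lra. }
  replace (/ f z - / f 1) with (- (f z - f 1) * / (f z * f 1)) by (field; now split).
  rewrite H1; ring.
- apply (tends_mult near_1); [now apply (tends_opp near_1)|].
  apply (tends_inv near_1); [now apply Cmult_neq_0|].
  apply (tends_mult near_1); [exact Cf|apply (tends_const near_1)].
Qed.

Lemma C1_nz : RtoC 1 <> 0.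
Proof. intros E; apply (f_equal fst) in E; simpl in E; lra. Qed.

Lemma tends_inv_1 : tends near_1 (fun z => / z) 1.
Proof.
apply (tends_val near_1 _ (/ RtoC 1)); [field; apply C1_nz|].
apply (tends_inv near_1); [apply C1_nz|apply tends_id].
Qed.

Lemma near_1_inv (P : C -> Prop) : near_1 P -> near_1 (fun z => P (/ z)).
Proof.
intros [d Hd]; generalize (tends_inv_1 d (cond_pos d)).
apply filter_imp; intros z Hz; now apply Hd.
Qed.

Lemma tends_near_1_inv (f : C -> C) (l : C) :
  tends near_1 f l -> tends near_1 (fun z => f (/ z)) l.
Proof. intros H eps Heps; exact (near_1_inv _ (H eps Heps)). Qed.

Lemma near_1_bounds (s : R) :
  (1 < s)%R -> near_1 (fun z : C => z <> 0 /\ (Cmod z < s)%R /\ (Cmod (/ z) < s)%R).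
Proof.
intros Hs.
assert (Hd : (0 < s - 1)%R) by lra.
generalize (filter_and _ _ (near_1_ball _ Rlt_0_1)
              (filter_and _ _ (near_1_ball _ Hd) (near_1_inv _ (near_1_ball _ Hd)))).
assert (aux : forall w : C, (Cmod (w - 1) < s - 1)%R -> (Cmod w < s)%R).
{ intros w Hw; replace w with ((w - 1) + 1) by ring.
  eapply Rle_lt_trans; [apply Cmod_triangle|]; rewrite Cmod_1; lra. }
apply filter_imp; intros z [H0 [H1 H2]]; repeat split; [|now apply aux|now apply aux].
intros E; rewrite E in H0; replace (0 - 1) with (-(1)) in H0 by ring.
rewrite Cmod_m1 in H0; lra.
Qed.

Lemma cderiv_comp_inv (f : C -> C) (l : C) :
  cderiv f l -> cderiv (fun z => f (/ z)) (- l).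
Proof.
intros [g [Hg Hl]].
assert (E1 : / RtoC 1 = 1) by (field; apply C1_nz).
exists (fun z => - (g (/ z) * / z)); split.
- generalize (filter_and _ _ (near_1_inv _ Hg) (near_1_bounds 2 ltac:(lra))).
  apply filter_imp; intros z [H [Hz _]]; rewrite E1, H; field; exact Hz.
- apply (tends_opp near_1); replace l with (l * 1) by ring.
  apply (tends_mult near_1); [now apply tends_near_1_inv|apply tends_inv_1].
Qed.

Lemma tends_qpoch_cont {T} (F : (T -> Prop) -> Prop) {FF : Filter F}
  (a : T -> C) (l q : C) (n : nat) :
  tends F a l -> tends F (fun x => qpoch (a x) q n) (qpoch l q n).
Proof.
intros Ha; induction n as [|n IH]; simpl; [apply (tends_const F)|].
apply (tends_mult F); [exact IH|].
apply (tends_minus F); [apply (tends_const F)|].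
apply (tends_mult F); [exact Ha|apply (tends_const F)].
Qed.

(** The product rule for infinitely many factors. Replace the factors
1 + c q^k by 1 + z c q^k one at a time: the k-th replacement changes the
product by (z - 1) c q^k times a hybrid product, whose limit at z = 1 is the
full product without its k-th factor. Dominated convergence gives the limit of
the sum of these changes. *)
Lemma cderiv_qpoch_inf (c q : C) :
  (Cmod q < 1)%R -> (Cmod c < 1)%R ->
  cderiv (fun z => qpoch_inf (- (z * c)) q)
    (qpoch_inf (- c) q * Cseries (fun k => c * q ^ k / (1 + c * q ^ k))).
Proof.
intros Hq Hc.
set (r := Cmod q) in *.
assert (Hr : (0 <= r < 1)%R) by (split; [apply Cmod_ge_0|exact Hq]).
(* tail k is the product at z = 1 of the factors of index at least k. *)
set (tail := fun k => qpoch_inf (- c * q ^ k) q).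
assert (Htail : forall k, tail k = (1 + c * q ^ k) * tail (S k)).
{ intros k; unfold tail; rewrite (qpoch_inf_head (- c * q ^ k) q Hq), Cpow_S.
  f_equal; [ring|f_equal; ring]. }
set (e := fun (z : C) k => c * q ^ k * qpoch (- (z * c)) q k * tail (S k)).
set (B := (qbound 2 r * qbound 1 r)%R).
assert (He : forall z k, (Cmod z < 2)%R -> (Cmod (e z k) <= B * r ^ k)%R).
{ intros z k Hz; unfold e, B; rewrite !Cmod_mult, Cmod_pow; fold r.
  assert (Hp : (0 <= r ^ k)%R) by (apply pow_le; lra).
  assert (H1 : (Cmod (qpoch (- (z * c)) q k) <= qbound 2 r)%R).
  { eapply Rle_trans; [now apply qpoch_bound|]; apply qbound_mono; [lra|].
    rewrite Cmod_opp, Cmod_mult; generalize (Cmod_ge_0 z) (Cmod_ge_0 c); nra. }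
  assert (H2 : (Cmod (tail (S k)) <= qbound 1 r)%R).
  { eapply Rle_trans; [now apply qpoch_inf_bound|]; apply qbound_mono; [lra|].
    left; apply Cmod_mult_pow_lt_1; [exact Hq|now rewrite Cmod_opp]. }
  apply Rle_trans with (1 * r ^ k * qbound 2 r * qbound 1 r)%R; [|right; ring].
  repeat apply Rmult_le_compat; try apply Cmod_ge_0; try lra;
    repeat apply Rmult_le_pos; try apply Cmod_ge_0; lra. }
assert (Hser : forall z, (Cmod z < 2)%R -> Cis_series (e z) (Cseries (e z))).
{ intros z Hz; apply (series_geom_le (e z) B r Hr); intros k; now apply He. }
assert (H12 : (Cmod (RtoC 1) < 2)%R) by (rewrite Cmod_1; lra).
exists (fun z => Cseries (e z)); split.
- generalize (near_1_bounds 2 ltac:(lra)); apply filter_imp; intros z [_ [Hz _]].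
  apply (series_unique (fun k => (z - 1) * e z k)); [|now apply series_scal, Hser].
  (* The hybrid product with the first k factors taken at z. *)
  set (D := fun k => qpoch (- (z * c)) q k * tail k).
  apply (series_ext (fun k => D (S k) - D k)).
  { intros k; unfold D, e; rewrite (Htail k); simpl qpoch; ring. }
  replace (qpoch_inf (- (1 * c)) q) with (D O).
  2:{ unfold D, tail; simpl; replace (- c * 1) with (- (1 * c)) by ring; ring. }
  apply series_telescope.
  replace (qpoch_inf (- (z * c)) q) with (qpoch_inf (- (z * c)) q * 1) by ring.
  apply (tends_mult eventually); [now apply qpoch_inf_tends|].
  apply (tends_qpoch_inf_1 eventually _ _ Hq).
  replace (RtoC 0) with (- c * 0) by ring.
  apply (tends_mult eventually); [apply (tends_const eventually)|now apply tends_pow].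
- assert (HV : qpoch_inf (- c) q <> 0)
    by (apply qpoch_inf_nz_small; [exact Hq|now rewrite Cmod_opp]).
  assert (E : qpoch_inf (- c) q * Cseries (fun k => c * q ^ k / (1 + c * q ^ k))
               = Cseries (e 1)).
  { assert (S1 : Cis_series (fun k => c * q ^ k / (1 + c * q ^ k))
                   (/ qpoch_inf (- c) q * Cseries (e 1))).
    { apply (series_ext (fun k => / qpoch_inf (- c) q * e 1 k)).
      - intros k.
        assert (Hk : 1 + c * q ^ k <> 0) by now apply one_plus_nz, Cmod_mult_pow_lt_1.
        assert (Ek : qpoch_inf (- c) q = qpoch (- c) q k * ((1 + c * q ^ k) * tail (S k))).
        { now rewrite <- Htail; apply qpoch_inf_split. }
        unfold e; replace (1 * c) with c by ring.
        replace (c * q ^ k / (1 + c * q ^ k)) with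
          (/ qpoch_inf (- c) q * (c * q ^ k / (1 + c * q ^ k) * qpoch_inf (- c) q))
          by (field; now split).
        f_equal; rewrite Ek; field; exact Hk.
      - now apply series_scal, Hser. }
    rewrite (Cseries_eq _ _ S1); field; exact HV. }
  rewrite E.
  apply (tannery near_1 e (e 1) (fun k => B * r ^ k)%R).
  + generalize (near_1_bounds 2 ltac:(lra)); apply filter_imp; intros z [_ [Hz _]].
    split; [now apply Hser|intros k; now apply He].
  + intros k; now apply He.
  + now apply ex_series_geom_scal.
  + intros k; unfold e; repeat apply (tends_mult near_1); try apply (tends_const near_1).
    apply (tends_qpoch_cont near_1), (tends_opp near_1).
    apply (tends_mult near_1); [apply tends_id|apply (tends_const near_1)].
  + now apply Hser.
Qed.

(** * The series A and a power series in z *)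

Definition A_term (z q : C) (n : nat) : C :=
  z * q ^ n * qpoch (- (z * q ^ (n + 1))) q n * qpoch_inf (- (z * q ^ (2 * n + 1))) (q ^ 2).

Definition P_odd (z q : C) : C := qpoch_inf (- (z * q)) (q ^ 2).

Lemma Cmod_le_arg (z q : C) (n : nat) (rho : R) :
  (Cmod q < 1)%R -> (Cmod z <= rho)%R -> (Cmod (- (z * q ^ n)) <= rho)%R.
Proof.
intros Hq Hz; rewrite Cmod_opp, Cmod_mult.
apply Rle_trans with (Cmod z * 1)%R; [|lra].
apply Rmult_le_compat_l; [apply Cmod_ge_0|now apply Cmod_pow_le_1].
Qed.

Lemma A_term_bound (q : C) (rho : R) :
  (Cmod q < 1)%R -> exists K : R, (0 <= K)%R /\ forall z n, (Cmod z <= rho)%R ->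
    (Cmod (A_term z q n) <= K * Cmod z * Cmod q ^ n)%R.
Proof.
intros Hq; exists (qbound rho (Cmod q) * qbound rho (Cmod (q ^ 2)))%R; split.
{ apply Rmult_le_pos; left; apply qbound_pos. }
intros z n Hz; unfold A_term; rewrite !Cmod_mult, (Cmod_pow q n).
assert (HQ := Cmod_sqr_lt_1 q Hq).
assert (H1 : (Cmod (qpoch (- (z * q ^ (n + 1))) q n) <= qbound rho (Cmod q))%R).
{ eapply Rle_trans; [now apply qpoch_bound|].
  apply qbound_mono; [exact Hq|now apply Cmod_le_arg]. }
assert (H2 : (Cmod (qpoch_inf (- (z * q ^ (2 * n + 1))) (q ^ 2)) <= qbound rho (Cmod (q ^ 2)))%R).
{ eapply Rle_trans; [now apply qpoch_inf_bound|].
  apply qbound_mono; [exact HQ|now apply Cmod_le_arg]. }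
assert (Hp : (0 <= Cmod z * Cmod q ^ n)%R)
  by (apply Rmult_le_pos; [|apply pow_le]; apply Cmod_ge_0).
rewrite Rmult_assoc.
apply Rle_trans with (Cmod z * Cmod q ^ n * (qbound rho (Cmod q) * qbound rho (Cmod (q ^ 2))))%R;
  [|right; ring].
apply Rmult_le_compat_l; [exact Hp|].
apply Rmult_le_compat; try apply Cmod_ge_0; assumption.
Qed.

Lemma A_series (z q : C) :
  (Cmod q < 1)%R -> Cis_series (A_term z q) (Cseries (A_term z q)).
Proof.
intros Hq; destruct (A_term_bound q (Cmod z) Hq) as [K [_ HK]].
apply (series_geom_le _ (K * Cmod z)%R (Cmod q)); [split; [apply Cmod_ge_0|exact Hq]|].
intros n; apply HK; lra.
Qed.

Lemma A_sum_bound (q : C) (rho : R) :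
  (Cmod q < 1)%R -> exists K : R, forall z, (Cmod z <= rho)%R ->
    (Cmod (Cseries (A_term z q)) <= K * Cmod z)%R.
Proof.
intros Hq; destruct (A_term_bound q rho Hq) as [K [_ HK]].
exists (K / (1 - Cmod q))%R; intros z Hz.
replace (K / (1 - Cmod q) * Cmod z)%R with (K * Cmod z / (1 - Cmod q))%R by (field; lra).
apply series_geom_le; [split; [apply Cmod_ge_0|exact Hq]|].
intros n; now apply HK.
Qed.

Lemma Cpow_double (q : C) (n : nat) : (q ^ 2) ^ n = q ^ (2 * n).
Proof. now rewrite Cpow_mult_r. Qed.

Lemma P_odd_head (z q : C) :
  (Cmod q < 1)%R -> P_odd z q = (1 + z * q) * P_odd (z * q ^ 2) q.
Proof.
intros Hq; unfold P_odd; rewrite (qpoch_inf_head _ _ (Cmod_sqr_lt_1 q Hq)).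
f_equal; [ring|f_equal; ring].
Qed.

(** Write Y_n for the product of 1 + z q^j over j = n+2, ..., 2n+2 and over
j = 2n+3, 2n+5, ... . Then q a_{n+1}(z) - (1 + z) a_n(z q^2) = z (Y_{n+1} - Y_n)
for the terms a_n of A/q, and Y_n tends to 1. *)
Lemma A_functional (z q : C) :
  (Cmod q < 1)%R ->
  q * Cseries (A_term z q)
  = (1 + z) * Cseries (A_term (z * q ^ 2) q) + z - (1 - q) * z * P_odd (z * q ^ 2) q.
Proof.
intros Hq; assert (HQ := Cmod_sqr_lt_1 q Hq).
set (Y := fun n => qpoch (- (z * q ^ (n + 2))) q (n + 1)
                   * qpoch_inf (- (z * q ^ (2 * n + 3))) (q ^ 2)).
set (X := fun n => qpoch (- (z * q ^ (n + 3))) q n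
                   * qpoch_inf (- (z * q ^ (2 * n + 3))) (q ^ 2)).
assert (Ea : forall n, A_term z q (S n) = z * q ^ (n + 1) * Y n).
{ intros n; unfold A_term, Y.
  replace (S n + 1)%nat with (n + 2)%nat by lia.
  replace (2 * S n + 1)%nat with (2 * n + 3)%nat by lia.
  replace (n + 1)%nat with (S n) by lia; ring. }
assert (Eb : forall n, A_term (z * q ^ 2) q n = z * q ^ (n + 2) * X n).
{ intros n; unfold A_term, X.
  replace (z * q ^ 2 * q ^ (n + 1)) with (z * q ^ (n + 3))
    by (replace (n + 3)%nat with (2 + (n + 1))%nat by lia; rewrite (Cpow_add_r q 2); ring).
  replace (z * q ^ 2 * q ^ (2 * n + 1)) with (z * q ^ (2 * n + 3))
    by (replace (2 * n + 3)%nat with (2 + (2 * n + 1))%nat by lia;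
        rewrite (Cpow_add_r q 2); ring).
  rewrite (Cpow_add_r q n 2); ring. }
assert (EY : forall n, Y n = (1 + z * q ^ (n + 2)) * X n).
{ intros n; unfold Y, X; replace (n + 1)%nat with (S n) by lia; rewrite qpoch_head.
  replace (- (z * q ^ (n + 2)) * q) with (- (z * q ^ (n + 3)))
    by (replace (n + 3)%nat with (S (n + 2)) by lia; rewrite Cpow_S; ring).
  ring. }
assert (EY' : forall n, Y (S n) = (1 + z * q ^ (2 * n + 4)) * X n).
{ intros n; unfold Y, X.
  rewrite (qpoch_inf_head (- (z * q ^ (2 * n + 3))) _ HQ).
  replace (S n + 1)%nat with (S (S n)) by lia.
  replace (S n + 2)%nat with (n + 3)%nat by lia.
  replace (2 * S n + 3)%nat with (2 * n + 3 + 2)%nat by lia.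
  simpl qpoch; rewrite (Cpow_add_r q (2 * n + 3) 2).
  replace (2 * n + 4)%nat with (n + 3 + S n)%nat by lia.
  replace (2 * n + 3)%nat with (n + 3 + n)%nat by lia.
  rewrite !(Cpow_add_r q (n + 3)).
  replace (- (z * (q ^ (n + 3) * q ^ n)) * q ^ 2)
    with (- (z * (q ^ (n + 3) * q ^ n * q ^ 2))) by ring.
  rewrite (Cpow_S q n); ring. }
assert (Hpow : forall m k, tends eventually (fun n => - (z * q ^ (S m * n + k))) 0).
{ intros m k.
  apply (tends_val eventually _ (- (z * (0 * q ^ k)))); [ring|].
  apply (tends_opp eventually), (tends_mult eventually); [apply (tends_const eventually)|].
  apply (tends_ext eventually (fun n => (q ^ S m) ^ n * q ^ k)).
  { intros n; now rewrite Cpow_add_r, Cpow_mult_r. }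
  apply (tends_mult eventually); [|apply (tends_const eventually)].
  now apply tends_pow, Cmod_pow_lt_1. }
assert (HY : tends eventually Y 1).
{ apply (tends_val eventually _ (1 * 1)); [ring|]; unfold Y.
  apply (tends_mult eventually).
  - apply (tends_qpoch_1 eventually _ _ (fun n => (n + 1)%nat) Hq).
    apply (tends_ext eventually (fun n => - (z * q ^ (1 * n + 2)))); [|apply Hpow].
    intros n; now rewrite Nat.mul_1_l.
  - apply (tends_qpoch_inf_1 eventually _ _ HQ), Hpow. }
assert (HA := A_series z q Hq).
replace (Cseries (A_term z q))
  with (A_term z q 0 + (Cseries (A_term z q) - A_term z q 0)) in HA by ring.
apply series_cons in HA.
assert (S1 := series_minus _ _ _ _ (series_scal q _ _ HA)
                (series_scal (1 + z) _ _ (A_series (z * q ^ 2) q Hq))).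
assert (S2 := series_scal z _ _ (series_telescope Y 1 HY)).
assert (E : q * (Cseries (A_term z q) - A_term z q 0)
              - (1 + z) * Cseries (A_term (z * q ^ 2) q) = z * (1 - Y 0%nat)).
{ apply (series_unique _ _ _ S1).
  apply (series_ext (fun n => z * (Y (S n) - Y n))); [|exact S2].
  intros n; rewrite Ea, Eb, EY', EY.
  replace (2 * n + 4)%nat with ((n + 2) + (n + 2))%nat by lia.
  rewrite (Cpow_add_r q n 1), (Cpow_add_r q (n + 2) (n + 2)), (Cpow_add_r q n 2); simpl; ring. }
assert (E0 : A_term z q 0 = z * P_odd z q).
{ unfold A_term, P_odd; simpl; replace (z * (q * 1)) with (z * q) by ring; ring. }
assert (EY0 : Y 0%nat = (1 + z * q ^ 2) * P_odd (z * q ^ 2) q).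
{ unfold Y, P_odd; simpl.
  replace (- (z * (q * (q * (q * 1))))) with (- (z * (q * (q * 1)) * q)) by ring.
  ring. }
rewrite E0, EY0, (P_odd_head z q Hq) in E.
set (al := Cseries (A_term z q)) in *; set (be := Cseries (A_term (z * q ^ 2) q)) in *.
set (p := P_odd (z * q ^ 2) q) in *.
replace (q * al) with ((q * (al - z * ((1 + z * q) * p)) - (1 + z) * be)
                       + (q * (z * ((1 + z * q) * p)) + (1 + z) * be)) by ring.
rewrite E; ring.
Qed.

(** 1/(a;q)_n = (a q^n;q)/(a;q), with infinite products on the right. *)
Lemma qpoch_inv_bound (a q : C) :
  (Cmod q < 1)%R -> (Cmod a < 1)%R ->
  exists K : R, (0 < K)%R /\ forall n, (Cmod (/ qpoch a q n) <= K)%R.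
Proof.
intros Hq Ha.
assert (HV := qpoch_inf_nz_small a q Hq Ha).
assert (Hp : (0 < Cmod (qpoch_inf a q))%R) by now apply Cmod_gt_0.
(* |(a q^n;q)| is bounded by the value of qbound at 1 because |a q^n| <= 1. *)
exists (qbound 1 (Cmod q) / Cmod (qpoch_inf a q))%R; split.
{ apply Rdiv_lt_0_compat; [apply qbound_pos|exact Hp]. }
intros n.
assert (Hn : qpoch a q n <> 0)
  by (apply qpoch_nz; intros k; now apply one_minus_nz, Cmod_mult_pow_lt_1).
assert (E : / qpoch a q n = qpoch_inf (a * q ^ n) q * / qpoch_inf a q).
{ rewrite (qpoch_inf_split a q n Hq) in HV |- *.
  field; split; [|exact Hn].
  intros E; apply HV; rewrite E; ring. }
rewrite E, Cmod_mult, (Cmod_inv _ HV).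
apply Rmult_le_compat_r; [left; now apply Rinv_0_lt_compat|].
eapply Rle_trans; [now apply qpoch_inf_bound|].
apply qbound_mono; [exact Hq|left; now apply Cmod_mult_pow_lt_1].
Qed.

(** The power series solution of q M(z) = (1 + z) M(z q^2) + q z. *)
Definition L_term (z q : C) (i : nat) : C :=
  z ^ S i * q ^ (i * i) / qpoch q (q ^ 2) (S i).

Lemma pow_sq_le (r : R) (i : nat) : (0 <= r <= 1)%R -> (r ^ (i * i) <= r ^ i)%R.
Proof.
intros Hr; replace (i * i)%nat with (i + (i * (i - 1)))%nat by nia.
rewrite pow_add; apply Rle_trans with (r ^ i * 1)%R; [|lra].
apply Rmult_le_compat_l; [apply pow_le; lra|].
rewrite <- (pow1 (i * (i - 1))); apply pow_incr; lra.
Qed.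

Lemma L_term_bound (q : C) :
  (Cmod q < 1)%R -> exists K : R, (0 < K)%R /\ forall z i,
    (Cmod (L_term z q i) <= K * Cmod z * (Cmod z * Cmod q) ^ i)%R.
Proof.
intros Hq; assert (HQ := Cmod_sqr_lt_1 q Hq).
destruct (qpoch_inv_bound q (q ^ 2) HQ Hq) as [K [HK0 HK]].
exists K; split; [exact HK0|intros z i].
unfold L_term, Cdiv; rewrite !Cmod_mult, !Cmod_pow, Rpow_mult_distr.
simpl (Cmod z ^ S i)%R.
assert (Hz := Cmod_ge_0 z); assert (Hr := Cmod_ge_0 q).
assert (Hzi : (0 <= Cmod z ^ i)%R) by now apply pow_le.
assert (Hqi := pow_sq_le (Cmod q) i ltac:(lra)).
apply Rle_trans with (Cmod z * Cmod z ^ i * Cmod q ^ i * K)%R; [|right; ring].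
apply Rmult_le_compat; [|apply Cmod_ge_0| |apply HK].
- apply Rmult_le_pos; [now apply Rmult_le_pos|now apply pow_le].
- apply Rmult_le_compat_l; [now apply Rmult_le_pos|exact Hqi].
Qed.

Lemma L_series (z q : C) :
  (Cmod q < 1)%R -> (Cmod z * Cmod q < 1)%R ->
  Cis_series (L_term z q) (Cseries (L_term z q)).
Proof.
intros Hq Hz; destruct (L_term_bound q Hq) as [K [_ HK]].
apply (series_geom_le _ (K * Cmod z)%R (Cmod z * Cmod q)); [|intros n; apply HK].
split; [apply Rmult_le_pos; apply Cmod_ge_0|exact Hz].
Qed.

Lemma L_sum_bound (q : C) (rho : R) :
  (Cmod q < 1)%R -> (rho * Cmod q < 1)%R -> exists K : R, forall z, (Cmod z <= rho)%R ->
    (Cmod (Cseries (L_term z q)) <= K * Cmod z)%R.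
Proof.
intros Hq Hrho; destruct (L_term_bound q Hq) as [K [HK0 HK]].
exists (K / (1 - rho * Cmod q))%R; intros z Hz.
replace (K / (1 - rho * Cmod q) * Cmod z)%R
  with (K * Cmod z / (1 - rho * Cmod q))%R by (field; lra).
assert (Hq0 := Cmod_ge_0 q); assert (Hz0 := Cmod_ge_0 z).
apply series_geom_le; [split; [apply Rmult_le_pos; lra|exact Hrho]|].
intros n; eapply Rle_trans; [apply HK|].
apply Rmult_le_compat_l; [apply Rmult_le_pos; lra|].
apply pow_incr; split; [now apply Rmult_le_pos|now apply Rmult_le_compat_r].
Qed.

Lemma qpoch_q_nz (q : C) (n : nat) : (Cmod q < 1)%R -> qpoch q (q ^ 2) n <> 0.
Proof.
intros Hq; apply qpoch_nz; intros k.
apply one_minus_nz, Cmod_mult_pow_lt_1; [now apply Cmod_sqr_lt_1|exact Hq].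
Qed.

Lemma Cmod_mul_sqr (z q : C) :
  (Cmod q < 1)%R -> (Cmod (z * q ^ 2) <= Cmod z)%R.
Proof.
intros Hq; generalize (Cmod_le_arg z q 2 (Cmod z) Hq (Rle_refl _)).
now rewrite Cmod_opp.
Qed.

Lemma L_functional (z q : C) :
  (Cmod q < 1)%R -> (Cmod z * Cmod q < 1)%R ->
  q * Cseries (L_term z q) = (1 + z) * Cseries (L_term (z * q ^ 2) q) + q * z.
Proof.
intros Hq Hz.
assert (Hz' : (Cmod (z * q ^ 2) * Cmod q < 1)%R).
{ eapply Rle_lt_trans; [|exact Hz].
  apply Rmult_le_compat_r; [apply Cmod_ge_0|now apply Cmod_mul_sqr]. }
assert (S1 := series_minus _ _ _ _ (series_scal q _ _ (L_series z q Hq Hz))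
                (L_series _ q Hq Hz')).
assert (S2 : Cis_series (fun i => q * L_term z q i - L_term (z * q ^ 2) q i)
               (q * z + z * Cseries (L_term (z * q ^ 2) q))).
{ assert (E0 : q * L_term z q 0 - L_term (z * q ^ 2) q 0 = q * z).
  { unfold L_term; simpl; field.
    replace (1 * (1 - q * 1)) with (1 - q) by ring; now apply one_minus_nz. }
  rewrite <- E0.
  apply (series_cons (fun i => q * L_term z q i - L_term (z * q ^ 2) q i)).
  apply (series_ext (fun i => z * L_term (z * q ^ 2) q i));
    [|now apply series_scal, L_series].
  intros i; unfold L_term.
  assert (Hn := qpoch_q_nz q (S i) Hq).
  assert (Hn' := qpoch_q_nz q (S (S i)) Hq).
  change (qpoch q (q ^ 2) (S (S i)))
    with (qpoch q (q ^ 2) (S i) * (1 - q * (q ^ 2) ^ S i)) in *.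
  set (p := qpoch q (q ^ 2) (S i)) in *.
  assert (Hf : 1 - q * (q ^ 2) ^ S i <> 0).
  { intros E; apply Hn'; rewrite E; ring. }
  assert (E2 : (q ^ 2) ^ S i = q ^ 2 * (q ^ i * q ^ i))
    by (rewrite (Cpow_S (q ^ 2) i), Cpow_double, <- (Cpow_add_r q i i);
        replace (2 * i)%nat with (i + i)%nat by lia; reflexivity).
  rewrite (Cpow_S (z * q ^ 2) (S i)), (Cpow_mult_l z (q ^ 2) (S i)).
  rewrite E2 in Hf |- *.
  replace (S i * S i)%nat with (i * i + (i + i) + 1)%nat by lia.
  rewrite !Cpow_add_r, Cpow_1_r, (Cpow_S z (S i)).
  field; now split. }
assert (E := series_unique _ _ _ S1 S2).
replace (q * Cseries (L_term z q)) with
  ((q * Cseries (L_term z q) - Cseries (L_term (z * q ^ 2) q))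
     + Cseries (L_term (z * q ^ 2) q)) by ring.
rewrite E; ring.
Qed.

(** Iterating, q^k D(z) = (-z;q^2)_k D(z q^{2k}) = O(q^{2k}), so that
D(z) = O(q^k) for every k. *)
Lemma functional_unique (D : C -> C) (q : C) (rho K : R) :
  (Cmod q < 1)%R -> q <> 0 ->
  (forall z, (Cmod z <= rho)%R -> (Cmod (D z) <= K * Cmod z)%R) ->
  (forall z, (Cmod z <= rho)%R -> q * D z = (1 + z) * D (z * q ^ 2)) ->
  forall z, (Cmod z <= rho)%R -> D z = 0.
Proof.
intros Hq Hq0 Hb Hf z Hz.
assert (HQ := Cmod_sqr_lt_1 q Hq).
assert (Hzk : forall k, (Cmod (z * (q ^ 2) ^ k) <= Cmod z)%R).
{ intros k; rewrite Cmod_mult; rewrite <- (Rmult_1_r (Cmod z)) at 2.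
  apply Rmult_le_compat_l; [apply Cmod_ge_0|now apply Cmod_pow_le_1]. }
assert (It : forall k, q ^ k * D z = qpoch (- z) (q ^ 2) k * D (z * (q ^ 2) ^ k)).
{ induction k as [|k IH]; [simpl; rewrite Cmult_1_r; ring|].
  rewrite (Cpow_S q k), <- Cmult_assoc, IH.
  replace (z * (q ^ 2) ^ S k) with (z * (q ^ 2) ^ k * q ^ 2) by (rewrite (Cpow_S (q ^ 2) k); ring).
  change (qpoch (- z) (q ^ 2) (S k)) with (qpoch (- z) (q ^ 2) k * (1 - - z * (q ^ 2) ^ k)).
  replace (q * (qpoch (- z) (q ^ 2) k * D (z * (q ^ 2) ^ k)))
    with (qpoch (- z) (q ^ 2) k * (q * D (z * (q ^ 2) ^ k))) by ring.
  rewrite Hf by (eapply Rle_trans; [apply Hzk|exact Hz]); ring. }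
set (M := (qbound (Cmod z) (Cmod (q ^ 2)) * (K * Cmod z))%R).
assert (T : tends eventually (fun _ : nat => D z) 0).
{ apply (tends_squeeze eventually) with (g := fun n => q ^ n) (M := M);
    [|now apply tends_pow].
  apply filter_forall; intros k.
  replace (D z - 0) with (D z) by ring.
  assert (Hp : (0 < Cmod q)%R) by now apply Cmod_gt_0.
  assert (Hpk : (0 < Cmod q ^ k)%R) by now apply pow_lt.
  apply Rmult_le_reg_l with (Cmod q ^ k)%R; [exact Hpk|].
  rewrite <- Cmod_pow, <- Cmod_mult, It, Cmod_mult, (Cmod_pow q k).
  apply Rle_trans with (qbound (Cmod z) (Cmod (q ^ 2)) * (K * Cmod (z * (q ^ 2) ^ k)))%R.
  - apply Rmult_le_compat; try apply Cmod_ge_0.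
    + eapply Rle_trans; [now apply qpoch_bound|]; rewrite Cmod_opp; lra.
    + apply Hb; eapply Rle_trans; [apply Hzk|exact Hz].
  - right; unfold M; rewrite Cmod_mult, Cpow_double, (Cmod_pow q (2 * k)).
    replace (2 * k)%nat with (k + k)%nat by lia; rewrite pow_add; ring. }
exact (tends_unique eventually _ _ _ (tends_const eventually (D z)) T).
Qed.

(** Both sides satisfy q M(z) = (1 + z) M(z q^2) + q z and vanish to first order
at z = 0. *)
Lemma A_plus_product (z q : C) :
  (Cmod q < 1)%R -> q <> 0 -> (Cmod z * Cmod q < 1)%R ->
  q * Cseries (A_term z q) + z * P_odd z q = Cseries (L_term z q).
Proof.
intros Hq Hq0 Hz; set (rho := Cmod z).
destruct (A_sum_bound q rho Hq) as [K1 HK1].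
destruct (L_sum_bound q rho Hq Hz) as [K2 HK2].
set (K3 := qbound rho (Cmod (q ^ 2))).
set (D := fun z => q * Cseries (A_term z q) + z * P_odd z q - Cseries (L_term z q)).
assert (HD : D z = 0).
{ apply (functional_unique D q rho (K1 + K3 + K2)%R Hq Hq0); [| |apply Rle_refl].
  - intros w Hw; unfold D, Cminus.
    eapply Rle_trans; [apply Cmod_triangle|]; rewrite Cmod_opp.
    eapply Rle_trans; [apply Rplus_le_compat_r, Cmod_triangle|]; rewrite !Cmod_mult.
    assert (H1 := HK1 w Hw); assert (H2 := HK2 w Hw).
    assert (H3 : (Cmod (P_odd w q) <= K3)%R).
    { unfold P_odd; eapply Rle_trans; [apply qpoch_inf_bound, Cmod_sqr_lt_1, Hq|].
      apply qbound_mono; [now apply Cmod_sqr_lt_1|].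
      generalize (Cmod_le_arg w q 1 rho Hq Hw); now rewrite Cpow_1_r. }
    assert (H4 : (Cmod q * Cmod (Cseries (A_term w q)) <= 1 * Cmod (Cseries (A_term w q)))%R)
      by (apply Rmult_le_compat_r; [apply Cmod_ge_0|now left]).
    assert (H5 := Rmult_le_compat_l _ _ _ (Cmod_ge_0 w) H3).
    lra.
  - intros w Hw; unfold D.
    assert (Hw' : (Cmod w * Cmod q < 1)%R).
    { eapply Rle_lt_trans; [|exact Hz]; apply Rmult_le_compat_r; [apply Cmod_ge_0|exact Hw]. }
    assert (E1 := A_functional w q Hq); assert (E2 := L_functional w q Hq Hw').
    rewrite (P_odd_head w q Hq).
    set (a := Cseries (A_term w q)) in *; set (l := Cseries (L_term w q)) in *.
    replace (q * (q * a + w * ((1 + w * q) * P_odd (w * q ^ 2) q) - l))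
      with (q * (q * a) + q * w * ((1 + w * q) * P_odd (w * q ^ 2) q) - q * l) by ring.
    rewrite E1, E2; ring. }
replace (Cseries (L_term z q)) with (D z + Cseries (L_term z q)) by (rewrite HD; ring).
unfold D; ring.
Qed.

(** * A bilateral series and its product formula *)

(** For an integer j, (q;q^2)_j with negative j means the quotient of the infinite
product (q;q^2) by the infinite product (q^{2j+1};q^2). The coefficients of z^{i+1} and z^{-i}
given here and next are both q^{(j-1)^2} / (q;q^2)_{j+N}, for j = i + 1 and
for j = -i. In this form no negative power of q occurs. *)
Definition pos_coef (q : C) (N i : nat) : C := q ^ (i * i) / qpoch q (q ^ 2) (S i + N).

Definition neg_coef (q : C) (N i : nat) : C :=
  if (i <=? N)%nat then q ^ (S i * S i) / qpoch q (q ^ 2) (N - i)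
  else (- (1)) ^ (i - N) * q ^ (S N * (2 * i + 1 - N)) * qpoch q (q ^ 2) (i - N).

Lemma qpoch_q_S (q : C) (n : nat) :
  qpoch q (q ^ 2) (S n) = qpoch q (q ^ 2) n * (1 - q ^ (2 * n + 1)).
Proof.
change (qpoch q (q ^ 2) (S n)) with (qpoch q (q ^ 2) n * (1 - q * (q ^ 2) ^ n)).
rewrite Cpow_double, Cpow_add_r, Cpow_1_r; ring.
Qed.

Lemma one_minus_odd_nz (q : C) (n : nat) : (Cmod q < 1)%R -> 1 - q ^ (2 * n + 1) <> 0.
Proof.
intros Hq; apply one_minus_nz; replace (2 * n + 1)%nat with (S (2 * n)) by lia.
now apply Cmod_pow_lt_1.
Qed.

Lemma pos_coef_S (q : C) (N i : nat) :
  (Cmod q < 1)%R ->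
  pos_coef q (S N) i = pos_coef q N i + q ^ (2 * N + 2) * pos_coef q N (S i).
Proof.
intros Hq; unfold pos_coef.
replace (S i + S N)%nat with (S (S i + N)) by lia.
replace (S (S i) + N)%nat with (S (S i + N)) by lia.
rewrite qpoch_q_S.
assert (Hn := qpoch_q_nz q (S i + N) Hq).
assert (Hf := one_minus_odd_nz q (S i + N) Hq).
replace (q ^ (2 * (S i + N) + 1)) with (q ^ (2 * N + 2) * q ^ (2 * i + 1)) in *
  by (rewrite <- Cpow_add_r; f_equal; lia).
replace (q ^ (S i * S i)) with (q ^ (i * i) * q ^ (2 * i + 1))
  by (rewrite <- Cpow_add_r; f_equal; lia).
field; now split.
Qed.

Lemma neg_coef_0 (q : C) (N : nat) :
  (Cmod q < 1)%R ->
  neg_coef q (S N) 0 = neg_coef q N 0 + q ^ (2 * N + 2) * pos_coef q N 0.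
Proof.
intros Hq; unfold neg_coef, pos_coef.
rewrite !Nat.sub_0_r; simpl (0 <=? _)%nat; cbv iota.
change (1 + N)%nat with (S N); simpl (0 * 0)%nat; simpl (1 * 1)%nat.
rewrite qpoch_q_S.
assert (Hn := qpoch_q_nz q N Hq); assert (Hf := one_minus_odd_nz q N Hq).
replace (q ^ (2 * N + 2)) with (q ^ (2 * N + 1) * q)
  by (rewrite <- (Cpow_1_r q) at 2; rewrite <- Cpow_add_r; f_equal; lia).
rewrite Cpow_1_r; simpl (q ^ 0); field; now split.
Qed.

(** The recurrence is (1 - q^{2m+1}) + q^{2m+1} = 1 with m = j + N. As
m = N - i - 1, the three cases are m >= 0, m = -1 and m < -1; in the middle
one the definition changes from quotients to products. *)
Lemma neg_coef_S (q : C) (N i : nat) :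
  (Cmod q < 1)%R ->
  neg_coef q (S N) (S i) = neg_coef q N (S i) + q ^ (2 * N + 2) * neg_coef q N i.
Proof.
intros Hq; unfold neg_coef.
change (S i <=? S N)%nat with (i <=? N)%nat.
destruct (lt_eq_lt_dec i N) as [[H| ->]|H].
- rewrite (proj2 (Nat.leb_le i N)), (proj2 (Nat.leb_le (S i) N)) by lia.
  destruct (Nat.le_exists_sub (S i) N H) as [m [-> _]].
  replace (S (m + S i) - S i)%nat with (S m) by lia.
  replace (m + S i - S i)%nat with m by lia.
  replace (m + S i - i)%nat with (S m) by lia.
  rewrite qpoch_q_S.
  assert (Hn := qpoch_q_nz q m Hq); assert (Hf := one_minus_odd_nz q m Hq).
  replace (q ^ (2 * (m + S i) + 2)) with (q ^ (2 * m + 1) * q ^ (2 * i + 3))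
    by (rewrite <- Cpow_add_r; f_equal; lia).
  replace (q ^ (S (S i) * S (S i))) with (q ^ (S i * S i) * q ^ (2 * i + 3))
    by (rewrite <- Cpow_add_r; f_equal; lia).
  field; now split.
- rewrite Nat.leb_refl, (proj2 (Nat.leb_gt (S N) N)) by lia.
  rewrite !Nat.sub_diag; replace (S N - N)%nat with 1%nat by lia.
  replace (q ^ (S (S N) * S (S N))) with (q ^ (S N * S N) * q ^ (2 * N + 2) * q)
    by (rewrite <- (Cpow_1_r q) at 3; rewrite <- !Cpow_add_r; f_equal; lia).
  replace (q ^ (S N * (2 * S N + 1 - N))) with (q ^ (S N * S N) * q ^ (2 * N + 2))
    by (rewrite <- !Cpow_add_r; f_equal; nia).
  simpl qpoch; rewrite !Cpow_1_r; simpl ((q ^ 2) ^ 0); field; apply C1_nz.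
- rewrite (proj2 (Nat.leb_gt i N)), (proj2 (Nat.leb_gt (S i) N)) by lia.
  destruct (Nat.le_exists_sub (S N) i H) as [m [-> _]].
  replace (S (m + S N) - S N)%nat with (S m) by lia.
  replace (S (m + S N) - N)%nat with (S (S m)) by lia.
  replace (m + S N - N)%nat with (S m) by lia.
  rewrite (qpoch_q_S q (S m)), (Cpow_S (- (1)) (S m)).
  replace (q ^ (S (S N) * (2 * S (m + S N) + 1 - S N)))
    with (q ^ (2 * N + 2) * q ^ (S N * (2 * (m + S N) + 1 - N)) * q ^ (2 * S m + 1))
    by (rewrite <- !Cpow_add_r; f_equal; nia).
  replace (q ^ (S N * (2 * S (m + S N) + 1 - N)))
    with (q ^ (2 * N + 2) * q ^ (S N * (2 * (m + S N) + 1 - N)))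
    by (rewrite <- !Cpow_add_r; f_equal; nia).
  ring.
Qed.

Lemma pow_le_pow (r : R) (m n : nat) : (0 <= r <= 1)%R -> (m <= n)%nat -> (r ^ n <= r ^ m)%R.
Proof.
intros Hr Hmn; replace n with (m + (n - m))%nat by lia.
rewrite pow_add; apply Rle_trans with (r ^ m * 1)%R; [|lra].
apply Rmult_le_compat_l; [apply pow_le; lra|].
rewrite <- (pow1 (n - m)); apply pow_incr; lra.
Qed.

Lemma bilateral_bound (q : C) :
  (Cmod q < 1)%R -> exists K : R, (0 < K)%R /\ forall N i,
    (Cmod (pos_coef q N i) <= K * Cmod q ^ i)%R /\
    (Cmod (neg_coef q N i) <= K * Cmod q ^ i)%R.
Proof.
intros Hq; assert (HQ := Cmod_sqr_lt_1 q Hq).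
destruct (qpoch_inv_bound q (q ^ 2) HQ Hq) as [K [HK0 HK]].
set (K' := qbound (Cmod q) (Cmod (q ^ 2))).
assert (HK' : (0 < K')%R) by apply qbound_pos.
assert (Hr := Cmod_ge_0 q).
exists (K + K')%R; split; [lra|intros N i].
assert (Hri : (0 <= Cmod q ^ i)%R) by now apply pow_le.
assert (aux : forall m (c : C) B, (i <= m)%nat -> (Cmod c <= B)%R -> (B <= K + K')%R ->
   (Cmod q ^ m * Cmod c <= (K + K') * Cmod q ^ i)%R).
{ intros m c B Hm Hc HB; rewrite (Rmult_comm (K + K')).
  apply Rmult_le_compat; [apply pow_le; lra|apply Cmod_ge_0|apply pow_le_pow; lra || lia|lra]. }
split; unfold pos_coef, neg_coef, Cdiv.
- rewrite Cmod_mult, Cmod_pow; apply (aux _ _ K); [nia|apply HK|lra].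
- destruct (Nat.leb_spec i N).
  + rewrite Cmod_mult, Cmod_pow; apply (aux _ _ K); [nia|apply HK|lra].
  + rewrite !Cmod_mult, !Cmod_pow, Cmod_m1, pow1, Rmult_1_l.
    apply (aux _ _ K'); [nia|now apply qpoch_bound|lra].
Qed.

Lemma bilateral_terms_bound (q : C) :
  (Cmod q < 1)%R -> exists K : R, (0 < K)%R /\ forall N i z w,
    (Cmod (pos_coef q N i * z ^ S i) <= K * Cmod z * (Cmod z * Cmod q) ^ i)%R /\
    (Cmod (neg_coef q N i * w ^ i) <= K * (Cmod w * Cmod q) ^ i)%R.
Proof.
intros Hq; destruct (bilateral_bound q Hq) as [K [HK0 HK]].
exists K; split; [exact HK0|intros N i z w]; destruct (HK N i) as [H1 H2].
rewrite !Cmod_mult, !Cmod_pow, !Rpow_mult_distr; split.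
- apply Rle_trans with (K * Cmod q ^ i * Cmod z ^ S i)%R; [|right; simpl; ring].
  apply Rmult_le_compat_r; [apply pow_le, Cmod_ge_0|exact H1].
- apply Rle_trans with (K * Cmod q ^ i * Cmod w ^ i)%R; [|right; ring].
  apply Rmult_le_compat_r; [apply pow_le, Cmod_ge_0|exact H2].
Qed.

Definition bil_sum (q z w : C) (N : nat) : C :=
  Cseries (fun i => pos_coef q N i * z ^ S i) + Cseries (fun i => neg_coef q N i * w ^ i).

Definition theta_bilateral (q z w : C) : C :=
  Cseries (fun i => q ^ (i * i) * z ^ S i) + Cseries (fun i => q ^ (S i * S i) * w ^ i).

Section Bilateral.
Context (q z w : C) (Hq : (Cmod q < 1)%R).
Context (Hz : (Cmod z * Cmod q < 1)%R) (Hw : (Cmod w * Cmod q < 1)%R).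

Lemma ratio_z : (0 <= Cmod z * Cmod q < 1)%R.
Proof. split; [apply Rmult_le_pos; apply Cmod_ge_0|exact Hz]. Qed.
Lemma ratio_w : (0 <= Cmod w * Cmod q < 1)%R.
Proof. split; [apply Rmult_le_pos; apply Cmod_ge_0|exact Hw]. Qed.

Lemma pos_series N : Cis_series (fun i => pos_coef q N i * z ^ S i)
                       (Cseries (fun i => pos_coef q N i * z ^ S i)).
Proof.
destruct (bilateral_terms_bound q Hq) as [K [_ HK]].
apply (series_geom_le _ (K * Cmod z)%R _ ratio_z); intros i; apply (HK N i z w).
Qed.

Lemma neg_series N : Cis_series (fun i => neg_coef q N i * w ^ i)
                       (Cseries (fun i => neg_coef q N i * w ^ i)).
Proof.
destruct (bilateral_terms_bound q Hq) as [K [_ HK]].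
apply (series_geom_le _ K _ ratio_w); intros i; apply (HK N i z w).
Qed.

(** Multiplying by 1 + q^{2N+2}/z adds q^{2N+2} times the coefficient of z^{j+1} to
that of z^j, which raises N by one. *)
Lemma bil_sum_S N :
  z * w = 1 -> bil_sum q z w (S N) = (1 + w * q ^ (2 * N + 2)) * bil_sum q z w N.
Proof.
intros Hzw; unfold bil_sum.
set (c := q ^ (2 * N + 2)).
assert (SP := pos_series N); assert (SN := neg_series N).
set (p := Cseries (fun i => pos_coef q N i * z ^ S i)) in *.
set (n := Cseries (fun i => neg_coef q N i * w ^ i)) in *.
assert (SP1 : Cis_series (fun i => pos_coef q N (S i) * z ^ S (S i)) (p - pos_coef q N 0 * z)).
{ apply (series_cons (fun i => pos_coef q N i * z ^ S i)).
  match goal with |- is_series _ ?x => replace x with p by (simpl; ring) end; exact SP. }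
assert (EP : Cseries (fun i => pos_coef q (S N) i * z ^ S i)
             = p + c * w * (p - pos_coef q N 0 * z)).
{ apply Cseries_eq.
  apply (series_ext (fun i => pos_coef q N i * z ^ S i
           + c * w * (pos_coef q N (S i) * z ^ S (S i)))).
  - intros i; rewrite pos_coef_S by exact Hq; fold c.
    rewrite (Cpow_S z (S i)).
    replace (c * w * (pos_coef q N (S i) * (z * z ^ S i)))
      with (c * (pos_coef q N (S i) * z ^ S i) * (z * w)) by ring.
    rewrite Hzw; ring.
  - apply series_plus; [exact SP|now apply series_scal]. }
assert (SN1 : Cis_series (fun i => neg_coef q N (S i) * w ^ S i) (n - neg_coef q N 0)).
{ apply (series_cons (fun i => neg_coef q N i * w ^ i)).
  match goal with |- is_series _ ?x => replace x with n by (simpl; ring) end; exact SN. }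
assert (EN : Cseries (fun i => neg_coef q (S N) i * w ^ i)
             = neg_coef q (S N) 0 * w ^ 0 + ((n - neg_coef q N 0) + c * w * n)).
{ apply Cseries_eq, (series_cons (fun i => neg_coef q (S N) i * w ^ i)).
  apply (series_ext (fun i => neg_coef q N (S i) * w ^ S i
           + c * w * (neg_coef q N i * w ^ i))).
  - intros i; rewrite neg_coef_S by exact Hq; fold c; rewrite (Cpow_S w i); ring.
  - apply series_plus; [exact SN1|now apply series_scal]. }
rewrite EP, EN, neg_coef_0 by exact Hq; fold c; simpl (w ^ 0).
replace (p + c * w * (p - pos_coef q N 0 * z))
  with (p + c * w * p - c * pos_coef q N 0 * (z * w)) by ring.
rewrite Hzw; ring.
Qed.

Lemma bil_sum_qpoch N :
  z * w = 1 -> bil_sum q z w N = qpoch (- (w * q ^ 2)) (q ^ 2) N * bil_sum q z w 0.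
Proof.
intros Hzw; induction N as [|N IH]; [simpl; ring|].
rewrite bil_sum_S by exact Hzw; rewrite IH.
change (qpoch (- (w * q ^ 2)) (q ^ 2) (S N)) with
  (qpoch (- (w * q ^ 2)) (q ^ 2) N * (1 - - (w * q ^ 2) * (q ^ 2) ^ N)).
rewrite Cpow_double, (Cpow_add_r q (2 * N) 2); ring.
Qed.

(** As N grows the denominators all tend to (q;q^2), and the terms are
dominated uniformly in N by geometric sequences of ratios |zq| and |wq|. *)
Lemma bil_sum_tends :
  tends eventually (bil_sum q z w) (theta_bilateral q z w * / qpoch_inf q (q ^ 2)).
Proof.
assert (HQ := Cmod_sqr_lt_1 q Hq).
assert (HV := qpoch_inf_nz_small q (q ^ 2) HQ Hq).
assert (Lim : tends eventually (fun n => / qpoch q (q ^ 2) n) (/ qpoch_inf q (q ^ 2))).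
{ apply (tends_inv eventually); [exact HV|now apply qpoch_inf_tends]. }
assert (Lim' : forall k, tends eventually (fun n => / qpoch q (q ^ 2) (k + n))
                 (/ qpoch_inf q (q ^ 2))).
{ intros k eps Heps; destruct (Lim eps Heps) as [N0 HN0].
  exists N0; intros n Hn; apply HN0; lia. }
destruct (bilateral_terms_bound q Hq) as [K [_ HK]].
assert (P1 : forall i, tends eventually (fun N => pos_coef q N i * z ^ S i)
               (/ qpoch_inf q (q ^ 2) * (q ^ (i * i) * z ^ S i))).
{ intros i; unfold pos_coef, Cdiv.
  apply (tends_val eventually _ (q ^ (i * i) * / qpoch_inf q (q ^ 2) * z ^ S i)); [ring|].
  repeat apply (tends_mult eventually); try apply (tends_const eventually); apply Lim'. }
assert (P2 : forall i, tends eventually (fun N => neg_coef q N i * w ^ i)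
               (/ qpoch_inf q (q ^ 2) * (q ^ (S i * S i) * w ^ i))).
{ intros i.
  apply (tends_ext_loc eventually
           (fun N => q ^ (S i * S i) * / qpoch q (q ^ 2) (N - i) * w ^ i)).
  { exists i; intros N HN; unfold neg_coef.
    now rewrite (proj2 (Nat.leb_le i N)) by exact HN. }
  apply (tends_val eventually _ (q ^ (S i * S i) * / qpoch_inf q (q ^ 2) * w ^ i)); [ring|].
  repeat apply (tends_mult eventually); try apply (tends_const eventually).
  intros eps Heps; destruct (Lim eps Heps) as [N0 HN0].
  exists (N0 + i)%nat; intros n Hn; apply HN0; lia. }
assert (B1 : forall i, (Cmod (/ qpoch_inf q (q ^ 2) * (q ^ (i * i) * z ^ S i))
                        <= K * Cmod z * (Cmod z * Cmod q) ^ i)%R).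
{ intros i; apply (tends_le eventually _ _ _ (P1 i)), filter_forall.
  intros N; apply (HK N i z w). }
assert (B2 : forall i, (Cmod (/ qpoch_inf q (q ^ 2) * (q ^ (S i * S i) * w ^ i))
                        <= K * (Cmod w * Cmod q) ^ i)%R).
{ intros i; apply (tends_le eventually _ _ _ (P2 i)), filter_forall.
  intros N; apply (HK N i z w). }
assert (resc : forall (f : nat -> C) M r, (0 <= r < 1)%R ->
   (forall i, (Cmod (/ qpoch_inf q (q ^ 2) * f i) <= M * r ^ i)%R) ->
   Cis_series (fun i => / qpoch_inf q (q ^ 2) * f i) (Cseries f * / qpoch_inf q (q ^ 2))).
{ intros f M r Hr Hf.
  destruct (series_geom_le _ _ _ Hr Hf) as [H _].
  assert (H' := series_scal (qpoch_inf q (q ^ 2)) _ _ H).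
  apply (series_ext _ f) in H'; [|intros i; field; exact HV].
  rewrite (Cseries_eq _ _ H').
  match goal with |- is_series _ ?x => replace x with
    (Cseries (fun i => / qpoch_inf q (q ^ 2) * f i)) by (field; exact HV) end.
  exact H. }
unfold theta_bilateral; rewrite Cmult_plus_distr_r; unfold bil_sum.
apply (tends_plus eventually).
- eapply (tannery eventually); [| exact B1 | | exact P1 | exact (resc (fun i => q ^ (i * i) * z ^ S i) _ _ ratio_z B1)].
  + apply filter_forall; intros N; split; [apply pos_series|intros i; apply (HK N i z w)].
  + apply ex_series_geom_scal, ratio_z.
- eapply (tannery eventually); [| exact B2 | | exact P2 | exact (resc (fun i => q ^ (S i * S i) * w ^ i) _ _ ratio_w B2)].
  + apply filter_forall; intros N; split; [apply neg_series|intros i; apply (HK N i z w)].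
  + apply ex_series_geom_scal, ratio_w.
Qed.

(** With N = 0 on the left, this evaluates the sum of z^j q^{(j-1)^2}/(q;q^2)_j
over all integers j as a theta function divided by
(q;q^2) (-q^2/z;q^2). *)
Lemma bilateral_product :
  z * w = 1 ->
  qpoch_inf (- (w * q ^ 2)) (q ^ 2) * bil_sum q z w 0 = theta_bilateral q z w * / qpoch_inf q (q ^ 2).
Proof.
intros Hzw; assert (HQ := Cmod_sqr_lt_1 q Hq).
refine (tends_unique eventually (bil_sum q z w) _ _ _ bil_sum_tends).
apply (tends_ext eventually (fun N => qpoch (- (w * q ^ 2)) (q ^ 2) N * bil_sum q z w 0)).
- intros N; now rewrite (bil_sum_qpoch N).
- apply (tends_mult eventually); [now apply qpoch_inf_tends|apply (tends_const eventually)].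
Qed.
End Bilateral.

(** * The derivative at z = 1 *)

(** The factor r^{n^2} beats every exponential: M r^n <= 1/2 for large n. *)
Lemma superexponential (M r : R) :
  (0 <= M)%R -> (0 <= r < 1)%R ->
  exists K : R, forall n, (M ^ n * r ^ (n * n) <= K * (1 / 2) ^ n)%R.
Proof.
intros HM Hr.
assert (He : (0 < / (2 * (M + 1)))%R) by (apply Rinv_0_lt_compat; lra).
assert (Hr' : (Rabs r < 1)%R) by (rewrite Rabs_pos_eq; lra).
destruct (pow_lt_1_zero r Hr' _ He) as [N HN].
assert (HK : (1 <= (2 * M + 1) ^ N)%R) by (apply pow_R1_Rle; lra).
(* For n < N the crude bound M^n = (2M)^n (1/2)^n suffices. *)
exists ((2 * M + 1) ^ N)%R; intros n.
assert (Hh : (0 <= (1 / 2) ^ n)%R) by (apply pow_le; lra).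
assert (Hrn : (0 <= r ^ n)%R) by (apply pow_le; lra).
destruct (Nat.le_gt_cases N n) as [H|H].
- rewrite pow_mult, <- Rpow_mult_distr.
  apply Rle_trans with (1 * (1 / 2) ^ n)%R; [|now apply Rmult_le_compat_r].
  rewrite Rmult_1_l; apply pow_incr; split; [now apply Rmult_le_pos|].
  specialize (HN n H); rewrite Rabs_pos_eq in HN by exact Hrn.
  apply Rle_trans with (M * / (2 * (M + 1)))%R.
  + apply Rmult_le_compat_l; [exact HM|now left].
  + apply Rmult_le_reg_r with (2 * (M + 1))%R; [lra|].
    rewrite Rmult_assoc, Rinv_l; lra.
- apply Rle_trans with (M ^ n * 1)%R.
  + apply Rmult_le_compat_l; [now apply pow_le|].
    rewrite <- (pow1 (n * n)); apply pow_incr; lra.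
  + replace (M ^ n * 1)%R with ((2 * M) ^ n * (1 / 2) ^ n)%R
      by (rewrite <- Rpow_mult_distr, Rmult_1_r; f_equal; field).
    apply Rmult_le_compat_r; [exact Hh|].
    apply Rle_trans with ((2 * M + 1) ^ n)%R; [apply pow_incr; lra|].
    apply Rle_pow; [lra|lia].
Qed.

Lemma pow_minus_1_bound (z : C) (n : nat) :
  (Cmod z <= 2)%R -> (Cmod (z ^ n - 1) <= 3 ^ n * Cmod (z - 1))%R.
Proof.
intros Hz; induction n as [|n IH].
- simpl; replace (1 - 1) with (RtoC 0) by ring; rewrite Cmod_0.
  generalize (Cmod_ge_0 (z - 1)); lra.
- rewrite Cpow_S; replace (z * z ^ n - 1) with (z * (z ^ n - 1) + (z - 1)) by ring.
  eapply Rle_trans; [apply Cmod_triangle|]; rewrite Cmod_mult.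
  assert (H0 := Cmod_ge_0 (z - 1)); assert (H1 := Cmod_ge_0 (z ^ n - 1)).
  assert (Hp : (1 <= 3 ^ n)%R) by (apply pow_R1_Rle; lra).
  simpl (3 ^ S n)%R; assert (Hz0 := Cmod_ge_0 z).
  assert (H2 : (Cmod z * Cmod (z ^ n - 1) <= 2 * (3 ^ n * Cmod (z - 1)))%R)
    by (apply Rmult_le_compat; assumption).
  nra.
Qed.

(** With 1 + theta_sym q z the sum of z^n q^{n^2} over all integers n; the form
makes the symmetry in z and 1/z visible. *)
Definition theta_sym (q z : C) : C :=
  Cseries (fun k => q ^ (S k * S k) * (z ^ S k + (/ z) ^ S k)).

(** The second bound rests on z^n + z^{-n} - 2 = z^{-n} (z^n - 1)^2, which is
quadratic in z - 1. *)
Lemma theta_sym_bound (q : C) :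
  (Cmod q < 1)%R -> exists K : R, forall (z : C) k,
    z <> 0 -> (Cmod z < 2)%R -> (Cmod (/ z) < 2)%R ->
    (Cmod (q ^ (S k * S k) * (z ^ S k + (/ z) ^ S k)) <= K * (1 / 2) ^ k)%R /\
    (Cmod (q ^ (S k * S k) * (z ^ S k + (/ z) ^ S k - 2))
       <= K * Cmod (z - 1) * Cmod (z - 1) * (1 / 2) ^ k)%R.
Proof.
intros Hq.
assert (Hr : (0 <= Cmod q < 1)%R) by (split; [apply Cmod_ge_0|exact Hq]).
(* 18 = 2 * 3 * 3: one factor 2^n from z^{-n} and two factors 3^n from (z^n - 1)^2. *)
destruct (superexponential 18 (Cmod q) ltac:(lra) Hr) as [K HK].
exists K; intros z k Hz0 Hz Hw; specialize (HK (S k)).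
set (w := / z) in *; set (n := S k) in *.
set (R0 := (Cmod q ^ (n * n))%R) in *.
assert (HR0 : (0 <= R0)%R) by (apply pow_le; lra).
assert (Hzw : z ^ n * w ^ n = 1).
{ rewrite <- Cpow_mult_l; unfold w; rewrite Cinv_r by exact Hz0; apply Cpow_1_l. }
assert (P18 : (18 ^ n = 2 ^ n * (3 ^ n * 3 ^ n))%R)
  by (rewrite <- !Rpow_mult_distr; f_equal; ring).
assert (P2 : (1 <= 2 ^ n)%R) by (apply pow_R1_Rle; lra).
assert (P3 : (1 <= 3 ^ n)%R) by (apply pow_R1_Rle; lra).
assert (PK : (0 <= K * (1 / 2) ^ n)%R).
{ eapply Rle_trans; [|exact HK]; apply Rmult_le_pos; [apply pow_le; lra|exact HR0]. }
assert (Hhalf : (K * (1 / 2) ^ n <= K * (1 / 2) ^ k)%R) by (unfold n in *; simpl in *; lra).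
assert (Zn : (Cmod (z ^ n) <= 2 ^ n)%R)
  by (rewrite Cmod_pow; apply pow_incr; split; [apply Cmod_ge_0|now left]).
assert (Wn : (Cmod (w ^ n) <= 2 ^ n)%R)
  by (rewrite Cmod_pow; apply pow_incr; split; [apply Cmod_ge_0|now left]).
rewrite !Cmod_mult, Cmod_pow; fold R0; split.
- apply Rle_trans with (18 ^ n * R0)%R; [|lra].
  rewrite Rmult_comm; apply Rmult_le_compat_r; [exact HR0|].
  eapply Rle_trans; [apply Cmod_triangle|]; rewrite P18.
  apply Rle_trans with (2 ^ n * 2)%R; [lra|].
  apply Rmult_le_compat_l; [lra|].
  assert (P3' : (3 <= 3 ^ n)%R)
    by (unfold n; simpl; generalize (pow_R1_Rle 3 k ltac:(lra)); lra).
  nra.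
- replace (z ^ n + w ^ n - 2) with (w ^ n * ((z ^ n - 1) * (z ^ n - 1))).
  2:{ replace (w ^ n * ((z ^ n - 1) * (z ^ n - 1)))
        with ((z ^ n * w ^ n) * z ^ n - 2 * (z ^ n * w ^ n) + w ^ n) by ring.
      rewrite Hzw; ring. }
  rewrite !Cmod_mult.
  assert (Hd := pow_minus_1_bound z n ltac:(lra)).
  set (d := Cmod (z - 1)) in *; assert (Hd0 : (0 <= d)%R) by apply Cmod_ge_0.
  set (e := Cmod (z ^ n - 1)) in *; assert (He0 : (0 <= e)%R) by apply Cmod_ge_0.
  apply Rle_trans with (R0 * (2 ^ n * ((3 ^ n * d) * (3 ^ n * d))))%R.
  + apply Rmult_le_compat_l; [exact HR0|].
    apply Rmult_le_compat; [apply Cmod_ge_0|now apply Rmult_le_pos|exact Wn|].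
    now apply Rmult_le_compat.
  + replace (R0 * (2 ^ n * (3 ^ n * d * (3 ^ n * d))))%R
      with (18 ^ n * R0 * (d * d))%R by (rewrite P18; ring).
    replace (K * d * d * (1 / 2) ^ k)%R with (K * (1 / 2) ^ k * (d * d))%R by ring.
    apply Rmult_le_compat_r; [now apply Rmult_le_pos|lra].
Qed.

Lemma half_range : (0 <= 1 / 2 < 1)%R.
Proof. lra. Qed.

Lemma theta_sym_series (q z : C) :
  (Cmod q < 1)%R -> z <> 0 -> (Cmod z < 2)%R -> (Cmod (/ z) < 2)%R ->
  Cis_series (fun k => q ^ (S k * S k) * (z ^ S k + (/ z) ^ S k)) (theta_sym q z).
Proof.
intros Hq H0 H1 H2; destruct (theta_sym_bound q Hq) as [K HK].
apply (series_geom_le _ K (1 / 2) half_range).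
intros k; now apply (HK z k).
Qed.

Lemma inv_C1 : / RtoC 1 = 1.
Proof. field; apply C1_nz. Qed.

Lemma theta_sym_1 (q : C) :
  (Cmod q < 1)%R ->
  Cis_series (fun k => q ^ (S k * S k)) (Cseries (fun k => q ^ (S k * S k))) /\
  theta_sym q 1 = 2 * Cseries (fun k => q ^ (S k * S k)).
Proof.
intros Hq.
assert (H1 : (Cmod (RtoC 1) < 2)%R) by (rewrite Cmod_1; lra).
assert (H := theta_sym_series q 1 Hq C1_nz H1).
rewrite inv_C1 in H; specialize (H H1).
assert (H' : Cis_series (fun k => q ^ (S k * S k)) (/ 2 * theta_sym q 1)).
{ apply (series_ext (fun k => / 2 * (q ^ (S k * S k) * (1 ^ S k + 1 ^ S k)))).
  - intros k; rewrite !Cpow_1_l; field.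
  - now apply series_scal. }
rewrite (Cseries_eq _ _ H'); split; [exact H'|field].
Qed.

(** The theta function is symmetric under z -> 1/z, hence stationary at 1. *)
Lemma cderiv_theta_sym (q : C) : (Cmod q < 1)%R -> cderiv (theta_sym q) 0.
Proof.
intros Hq; destruct (theta_sym_bound q Hq) as [K HK].
exists (fun z => (theta_sym q z - theta_sym q 1) / (z - 1)); split.
- apply filter_forall; intros z.
  (* At z = 1 both sides vanish, whatever the value of the quotient. *)
  destruct (Ceq_dec z 1) as [-> |Hz]; [ring|field].
  intros E; apply Hz; replace z with (z - 1 + 1) by ring; rewrite E; ring.
- apply (tends_squeeze near_1) with (g := fun z => z - 1) (M := (K / (1 - 1 / 2))%R).
  + generalize (near_1_bounds 2 ltac:(lra)); apply filter_imp; intros z [H0 [H1 H2]].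
    replace ((theta_sym q z - theta_sym q 1) / (z - 1) - 0)
      with ((theta_sym q z - theta_sym q 1) * / (z - 1)) by (unfold Cdiv; ring).
    assert (B : (Cmod (theta_sym q z - theta_sym q 1)
                 <= K * Cmod (z - 1) * Cmod (z - 1) * / (1 - 1 / 2))%R).
    { assert (S1 := theta_sym_series q z Hq H0 H1 H2).
      destruct (theta_sym_1 q Hq) as [S2 E2].
      assert (S3 := series_minus _ _ _ _ S1 (series_scal 2 _ _ S2)).
      rewrite <- E2 in S3.
      refine (series_norm _ _ _ _ _ S3
                (is_series_geom_scal (K * Cmod (z - 1) * Cmod (z - 1)) _ half_range)).
      intros k; destruct (HK z k H0 H1 H2) as [_ Hk].
      eapply Rle_trans; [|exact Hk]; right; f_equal; ring. }
    destruct (Ceq_dec z 1) as [-> |Hz].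
    { replace (1 - 1) with (RtoC 0) in * by ring.
      rewrite Cmod_0 in *; rewrite Cmod_mult.
      assert (E : Cmod (theta_sym q 1 - theta_sym q 1) = 0%R)
        by (replace (theta_sym q 1 - theta_sym q 1) with (RtoC 0) by ring; apply Cmod_0).
      rewrite E; lra. }
    assert (Hz1 : z - 1 <> 0).
    { intros E; apply Hz; replace z with (z - 1 + 1) by ring; rewrite E; ring. }
    assert (Hd : (0 < Cmod (z - 1))%R) by now apply Cmod_gt_0.
    rewrite Cmod_mult, (Cmod_inv _ Hz1).
    apply Rle_trans with (K * Cmod (z - 1) * Cmod (z - 1) * / (1 - 1 / 2) * / Cmod (z - 1))%R.
    * apply Rmult_le_compat_r; [left; now apply Rinv_0_lt_compat|exact B].
    * right; field; lra.
  + apply (tends_val near_1 _ (1 - 1)); [ring|].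
    apply (tends_minus near_1); [apply tends_id|apply (tends_const near_1)].
Qed.

(** Shifting the index turns z^j q^{(j-1)^2} into z times z^n q^{n^2}. *)
Lemma theta_bilateral_symmetric (q z : C) :
  (Cmod q < 1)%R -> z <> 0 -> (Cmod z < 2)%R -> (Cmod (/ z) < 2)%R ->
  (Cmod z * Cmod q < 1)%R -> (Cmod (/ z) * Cmod q < 1)%R ->
  theta_bilateral q z (/ z) = z * (1 + theta_sym q z).
Proof.
intros Hq H0 H1 H2 Hz Hw.
set (w := / z) in *.
assert (Hzw : z * w = 1) by (unfold w; field; exact H0).
assert (Hr := Cmod_ge_0 q).
assert (SW : Cis_series (fun k => q ^ (S k * S k) * w ^ k)
               (Cseries (fun k => q ^ (S k * S k) * w ^ k))).
{ apply (series_geom_le _ 1 (Cmod w * Cmod q)).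
  - split; [apply Rmult_le_pos; apply Cmod_ge_0|exact Hw].
  - intros k; rewrite Cmod_mult, !Cmod_pow, Rpow_mult_distr, Rmult_1_l, Rmult_comm.
    apply Rmult_le_compat_l; [apply pow_le, Cmod_ge_0|].
    apply pow_le_pow; [lra|nia]. }
assert (SZ : Cis_series (fun k => q ^ (k * k) * z ^ S k)
               (Cseries (fun k => q ^ (k * k) * z ^ S k))).
{ apply (series_geom_le _ (Cmod z) (Cmod z * Cmod q)).
  - split; [apply Rmult_le_pos; apply Cmod_ge_0|exact Hz].
  - intros k; rewrite Cmod_mult, !Cmod_pow, Rpow_mult_distr.
    apply Rle_trans with (Cmod q ^ k * Cmod z ^ S k)%R; [|right; simpl; ring].
    apply Rmult_le_compat_r; [apply pow_le, Cmod_ge_0|].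
    apply pow_le_pow; [lra|nia]. }
assert (ST := theta_sym_series q z Hq H0 H1 H2); fold w in ST.
unfold theta_bilateral.
set (a := Cseries (fun k => q ^ (k * k) * z ^ S k)) in *.
set (b := Cseries (fun k => q ^ (S k * S k) * w ^ k)) in *.
assert (SZ1 : Cis_series (fun k => q ^ (S k * S k) * z ^ S (S k)) (a - z)).
{ apply (series_cons (fun k => q ^ (k * k) * z ^ S k)).
  match goal with |- is_series _ ?x => replace x with a by (simpl; ring) end; exact SZ. }
assert (E' : a - z + b = z * theta_sym q z).
{ apply (series_unique _ _ _ (series_plus _ _ _ _ SZ1 SW)).
  apply (series_ext (fun k => z * (q ^ (S k * S k) * (z ^ S k + w ^ S k))));
    [|now apply series_scal].
  intros k; rewrite (Cpow_S z (S k)), (Cpow_S w k).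
  replace (z * (q ^ (S k * S k) * (z ^ S k + w * w ^ k)))
    with (q ^ (S k * S k) * (z * z ^ S k) + q ^ (S k * S k) * w ^ k * (z * w)) by ring.
  rewrite Hzw; ring. }
replace (a + b) with (a - z + b + z) by ring; rewrite E'; ring.
Qed.

Lemma A_phi_eq (z q : C) : A_phi z q = q * Cseries (A_term z q).
Proof. reflexivity. Qed.

(** The power series that A + z (-zq;q^2) equals is the part with positive powers of
z of the bilateral sum, and B(-1/z) - 1 is the part with the other powers. *)
Lemma L_plus_B (z q : C) :
  (Cmod q < 1)%R -> z <> 0 -> (Cmod z * Cmod q < 1)%R -> (Cmod (/ z) * Cmod q < 1)%R ->
  Cseries (L_term z q) + B_phi (- / z) q = 1 + bil_sum q z (/ z) 0.
Proof.
intros Hq H0 Hz Hw; unfold bil_sum, B_phi.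
replace (Cseries (L_term z q)) with (Cseries (fun i => pos_coef q 0 i * z ^ S i)).
2:{ symmetry; apply Cseries_eq.
    apply (series_ext (fun i => pos_coef q 0 i * z ^ S i)).
    - intros i; unfold pos_coef, L_term; rewrite Nat.add_0_r; unfold Cdiv; ring.
    - now apply (pos_series q z (/ z)). }
rewrite (Cseries_eq (fun n => (- / z) ^ n * q ^ (2 * n + 1) * qpoch q (q ^ 2) n)
           (Cseries (fun i => neg_coef q 0 i * (/ z) ^ i))); [ring|].
apply (series_ext (fun i => neg_coef q 0 i * (/ z) ^ i));
  [|now apply (neg_series q z (/ z))].
intros i; unfold neg_coef.
replace ((- / z) ^ i) with ((- (1)) ^ i * (/ z) ^ i)
  by (rewrite <- Cpow_mult_l; f_equal; ring).
destruct i as [|i].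
- simpl; field; exact C1_nz.
- rewrite (proj2 (Nat.leb_gt (S i) 0)) by lia.
  replace (1 * (2 * S i + 1 - 0))%nat with (2 * S i + 1)%nat by lia.
  rewrite Nat.sub_0_r; ring.
Qed.

(** A(z) is a power series minus z (-zq;q^2), and that power series completes
B(-1/z) to the bilateral sum. *)
Lemma closed_form (z q : C) :
  (Cmod q < 1)%R -> q <> 0 -> z <> 0 -> (Cmod z < 2)%R -> (Cmod (/ z) < 2)%R ->
  (Cmod z * Cmod q < 1)%R -> (Cmod (/ z) * Cmod q < 1)%R ->
  qpoch_inf (- (/ z * q ^ 2)) (q ^ 2) <> 0 ->
  A_phi z q + B_phi (- / z) q =
  1 + z * (1 + theta_sym q z) * / qpoch_inf q (q ^ 2)
        * / qpoch_inf (- (/ z * q ^ 2)) (q ^ 2)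
    + - (1) * (z * qpoch_inf (- (z * q)) (q ^ 2)).
Proof.
intros Hq Hq0 H0 H1 H2 Hz Hw Hnz.
rewrite A_phi_eq.
assert (EA := A_plus_product z q Hq Hq0 Hz); unfold P_odd in EA.
assert (EB := L_plus_B z q Hq H0 Hz Hw).
assert (EC := bilateral_product q z (/ z) Hq Hz Hw (Cinv_r z H0)).
rewrite (theta_bilateral_symmetric q z Hq H0 H1 H2 Hz Hw) in EC.
rewrite <- EC.
replace (qpoch_inf (- (/ z * q ^ 2)) (q ^ 2) * bil_sum q z (/ z) 0
         * / qpoch_inf (- (/ z * q ^ 2)) (q ^ 2)) with (bil_sum q z (/ z) 0)
  by (field; exact Hnz).
rewrite <- EB, <- EA; ring.
Qed.

Lemma near_1_radius (r : R) :
  (0 <= r < 1)%R -> near_1 (fun z : C => (Cmod z * r < 1)%R /\ (Cmod (/ z) * r < 1)%R).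
Proof.
intros Hr.
assert (Hs : (1 < 2 / (1 + r))%R).
{ apply Rmult_lt_reg_r with (1 + r)%R; [lra|].
  unfold Rdiv; rewrite Rmult_assoc, Rinv_l; lra. }
assert (Hsr : (2 / (1 + r) * r < 1)%R).
{ apply Rmult_lt_reg_r with (1 + r)%R; [lra|].
  replace (2 / (1 + r) * r * (1 + r))%R with (2 * r)%R by (field; lra); lra. }
generalize (near_1_bounds _ Hs); apply filter_imp; intros z [_ [H1 H2]].
assert (aux : forall x, (x < 2 / (1 + r))%R -> (x * r < 1)%R).
{ intros x Hx; eapply Rle_lt_trans; [|exact Hsr].
  apply Rmult_le_compat_r; lra. }
split; now apply aux.
Qed.

Lemma F2_eq (q : C) :
  F2 q = qpoch_inf (- q) (q ^ 2)
         * Cseries (fun k => q * (q ^ 2) ^ k / (1 + q * (q ^ 2) ^ k)).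
Proof.
unfold F2; f_equal; f_equal.
apply FunctionalExtensionality.functional_extensionality; intros k.
now rewrite Cpow_double, Cpow_add_r, Cpow_1_r, (Cmult_comm q).
Qed.

Lemma F3_eq (q : C) :
  F3 q = qpoch_inf (- q) (q ^ 2)
         * Cseries (fun k => q ^ 2 * (q ^ 2) ^ k / (1 + q ^ 2 * (q ^ 2) ^ k)).
Proof.
unfold F3; f_equal; f_equal.
apply FunctionalExtensionality.functional_extensionality; intros k.
replace (2 * S k)%nat with (2 + 2 * k)%nat by lia.
now rewrite Cpow_double, Cpow_add_r.
Qed.

Lemma Cseries_0 (a : nat -> C) : (forall n, a n = 0) -> Cseries a = 0.
Proof.
intros H; destruct (series_geom_le a 0 0 ltac:(lra)) as [_ H0].
{ intros n; rewrite H, Cmod_0; lra. }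
apply Cmod_eq_0; generalize (Cmod_ge_0 (Cseries a)); lra.
Qed.

Lemma Cpow_0_S (n : nat) : RtoC 0 ^ S n = 0.
Proof. rewrite Cpow_S; ring. Qed.

(** Differentiate the closed form. Euler's identity turns
1/((q;q^2) (-q^2;q^2)) into (-q;q^2); the theta function contributes only
through its value, the factor 1/(-q^2/z;q^2) gives F3, (-zq;q^2) gives F2,
and the two factors z give the remaining part of F1. The case q = 0 is separate because the uniqueness argument divides
by q. *)
Theorem derivative_at_1 (q : C) :
  (Cmod q < 1)%R -> cderiv (fun z : C => A_phi z q + B_phi (- / z) q) (F1 q - F2 q).
Proof.
intros Hq.
destruct (Ceq_dec q 0) as [-> |Hq0].
{ assert (E1 : forall z, A_phi z 0 + B_phi (- / z) 0 = 1).
  { intros z; unfold B_phi; rewrite A_phi_eq.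
    rewrite (Cseries_0 (fun n => (- / z) ^ n * 0 ^ (2 * n + 1) * qpoch 0 (0 ^ 2) n)); [ring|].
    intros n; replace (2 * n + 1)%nat with (S (2 * n)) by lia.
    rewrite Cpow_0_S; ring. }
  assert (E2 : F1 0 - F2 0 = 0).
  { unfold F1, F2, F3.
    rewrite (Cseries_0 (fun k => RtoC 0 ^ (2 * k + 1) / (1 + RtoC 0 ^ (2 * k + 1)))),
      (Cseries_0 (fun k => RtoC 0 ^ (2 * S k) / (1 + RtoC 0 ^ (2 * S k)))),
      (Cseries_0 (fun k => RtoC 0 ^ (S k * S k))).
    - ring.
    - intros k; exact (Cpow_0_S _).
    - intros k; replace (2 * S k)%nat with (S (2 * k + 1)) by lia.
      rewrite Cpow_0_S; unfold Cdiv; ring.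
    - intros k; replace (2 * k + 1)%nat with (S (2 * k)) by lia.
      rewrite Cpow_0_S; unfold Cdiv; ring. }
  rewrite E2; apply (cderiv_ext_loc (fun _ => 1)); [|now rewrite E1|apply cderiv_const].
  apply filter_forall; intros z; now rewrite E1. }
assert (HQ := Cmod_sqr_lt_1 q Hq).
set (V := qpoch_inf q (q ^ 2)).
set (V2 := fun w => qpoch_inf (- (w * q ^ 2)) (q ^ 2)).
set (P := fun z => qpoch_inf (- (z * q)) (q ^ 2)).
assert (DP := cderiv_qpoch_inf q (q ^ 2) HQ Hq); fold P in DP.
assert (DV := cderiv_qpoch_inf (q ^ 2) (q ^ 2) HQ HQ); fold V2 in DV.
assert (CV := tends_near_1_inv _ _ (cderiv_cont _ _ DV)).
assert (DVi := cderiv_comp_inv _ _ DV).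
set (S3 := Cseries (fun k => q ^ 2 * (q ^ 2) ^ k / (1 + q ^ 2 * (q ^ 2) ^ k))) in *.
set (S2 := Cseries (fun k => q * (q ^ 2) ^ k / (1 + q * (q ^ 2) ^ k))) in *.
assert (HV : V <> 0) by now apply qpoch_inf_nz_small.
assert (EV2 : V2 1 = qpoch_inf (- q ^ 2) (q ^ 2))
  by (unfold V2; f_equal; ring).
assert (HV2 : V2 1 <> 0)
  by (rewrite EV2; apply qpoch_inf_nz_small; [exact HQ|now rewrite Cmod_opp]).
assert (EP : P 1 = qpoch_inf (- q) (q ^ 2)) by (unfold P; f_equal; ring).
assert (EE : P 1 = / V * / V2 1).
{ assert (E := euler_infinite q Hq); rewrite <- EP, <- EV2 in E; fold V in E.
  replace (P 1) with (P 1 * V * V2 1 * (/ V * / V2 1)) by (field; now split).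
  rewrite E; ring. }
assert (Hp : (0 < Cmod (V2 1))%R) by now apply Cmod_gt_0.
assert (Hr : (0 <= Cmod q < 1)%R) by (split; [apply Cmod_ge_0|exact Hq]).
assert (H12 : (1 < 2)%R) by lra.
assert (N : near_1 (fun z => 1 + z * (1 + theta_sym q z) * / V * / V2 (/ z) + - (1) * (z * P z)
                     = A_phi z q + B_phi (- / z) q)).
{ generalize (filter_and _ _ (CV _ Hp) (filter_and _ _ (near_1_bounds 2 H12)
     (near_1_radius (Cmod q) Hr))).
  apply filter_imp; intros z [Hv [[H0 [H1 H2]] [Hz Hw]]].
  symmetry; apply closed_form; try assumption.
  intros E; unfold V2 in Hv at 1; rewrite E in Hv.
  replace (0 - V2 1) with (- V2 1) in Hv by ring; rewrite Cmod_opp in Hv; lra. }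
apply (cderiv_ext_loc _ _ _ N).
{ now apply locally_singleton in N. }
assert (DI : cderiv (fun z => / V2 (/ z)) (S3 * / V2 1)).
{ apply (cderiv_val _ (- - (qpoch_inf (- q ^ 2) (q ^ 2) * S3) / (V2 (/ 1) * V2 (/ 1)))).
  - rewrite inv_C1, <- EV2; field; exact HV2.
  - apply (cderiv_inv (fun z => V2 (/ z))); [now rewrite inv_C1|exact DVi]. }
assert (DT : cderiv (fun z => 1 + theta_sym q z) 0).
{ apply (cderiv_val _ (0 + 0)); [ring|].
  apply cderiv_plus; [apply cderiv_const|now apply cderiv_theta_sym]. }
eapply cderiv_val;
  [|apply cderiv_plus;
    [apply cderiv_plus; [apply cderiv_const|
       apply cderiv_mult; [|exact DI];
       apply cderiv_mult; [|apply (cderiv_const (/ V))];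
       apply cderiv_mult; [apply cderiv_id|exact DT]]
    |apply cderiv_mult; [apply (cderiv_const (- (1)))|
       apply cderiv_mult; [apply cderiv_id|exact DP]]]].
destruct (theta_sym_1 q Hq) as [_ Eth]; rewrite Eth.
unfold F1; rewrite F2_eq, F3_eq; fold S2 S3; rewrite <- EP, inv_C1.
set (t := Cseries (fun k => q ^ (S k * S k))).
rewrite EE; field; now split.
Qed.

(** * Power series in q with integer coefficients *)

Lemma series_finite (f : nat -> C) (n : nat) :
  (forall k, (n < k)%nat -> f k = 0) -> Cis_series f (sum_n (G := C_AbelianMonoid) f n).
Proof.
intros H; apply series_tends.
apply (tends_ext_loc eventually (fun _ => sum_n (G := C_AbelianMonoid) f n));
  [|apply (tends_const eventually)].
exists n; intros m Hm; induction Hm as [|m Hm IH]; [reflexivity|].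
rewrite sum_C_S, H, Cplus_0_r by lia; exact IH.
Qed.

(** Interchange of summations for u k n supported on k <= n: the N-th partial sum
of the exchanged series is the sum over k of the truncations of the rows
at N, so dominated convergence applies. *)
Lemma triangular_exchange (u : nat -> nat -> C) (g : nat -> C) (L : C) (M rho : R) :
  (0 <= rho < 1)%R ->
  (forall k n, (n < k)%nat -> u k n = 0) ->
  (forall k n, (Cmod (u k n) <= M * rho ^ n)%R) ->
  (forall k, Cis_series (u k) (g k)) -> Cis_series g L ->
  Cis_series (fun n => sum_n (G := C_AbelianMonoid) (fun k => u k n) n) L.
Proof.
intros Hrho Hz HM Hg HL.
(* With rho = s^2 and k <= n, rho^n <= s^k s^n separates the variables. *)
set (s := sqrt rho).
assert (Hs0 : (0 <= s)%R) by apply sqrt_pos.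
assert (Hss : (s * s = rho)%R) by (apply sqrt_sqrt; lra).
assert (Hs1 : (s < 1)%R) by nra.
assert (HM0 : (0 <= M)%R).
{ generalize (HM O O) (Cmod_ge_0 (u O O)); simpl; lra. }
assert (Hb : forall k n, (Cmod (u k n) <= M * s ^ k * s ^ n)%R).
{ intros k n; destruct (Nat.lt_ge_cases n k) as [H|H].
  - rewrite (Hz k n H), Cmod_0.
    repeat apply Rmult_le_pos; try apply pow_le; assumption.
  - eapply Rle_trans; [apply HM|].
    rewrite <- Hss, Rpow_mult_distr, Rmult_assoc.
    apply Rmult_le_compat_l; [exact HM0|].
    apply Rmult_le_compat_r; [now apply pow_le|].
    apply pow_le_pow; [lra|exact H]. }
set (T := fun N k => sum_n (G := C_AbelianMonoid) (u k) N).
assert (HT : forall N k, (Cmod (T N k) <= M / (1 - s) * s ^ k)%R).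
{ intros N k; eapply Rle_trans; [apply sum_le; intros n; apply Hb|].
  replace (M / (1 - s) * s ^ k)%R with (M * s ^ k * / (1 - s))%R by (field; lra).
  apply (sum_le_series (fun n => M * s ^ k * s ^ n)%R).
  - intros n; repeat apply Rmult_le_pos; try apply pow_le; assumption.
  - apply is_series_geom_scal; lra. }
apply series_tends.
apply (tannery eventually T g (fun k => M / (1 - s) * s ^ k)%R).
- apply filter_forall; intros N; split; [|intros k; apply HT].
  induction N as [|N IH].
  + apply (series_ext (fun k => u k O)); [intros k; unfold T; now rewrite sum_O|].
    rewrite sum_O; apply series_finite; intros k Hk; now apply Hz.
  + rewrite sum_C_S; apply (series_ext (fun k => T N k + u k (S N))).
    * intros k; unfold T; now rewrite sum_C_S.
    * apply series_plus; [exact IH|].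
      apply (series_finite (fun k => u k (S N))); intros k Hk; now apply Hz.
- intros k.
  apply (tends_le eventually (fun N => T N k)); [now apply series_tends|].
  apply filter_forall; intros N; apply HT.
- apply ex_series_geom_scal; lra.
- intros k; now apply series_tends.
- exact HL.
Qed.

Fixpoint zsum (f : nat -> Z) (n : nat) : Z :=
  match n with O => 0%Z | S m => (zsum f m + f m)%Z end.

Lemma zsum_sum_n (f : nat -> Z) (c : C) (n : nat) :
  sum_n (G := C_AbelianMonoid) (fun k => RtoC (IZR (f k)) * c) n
  = RtoC (IZR (zsum f (S n))) * c.
Proof.
induction n as [|n IH]; [now rewrite sum_O|].
rewrite sum_C_S, IH; change (zsum f (S (S n))) with (zsum f (S n) + f (S n))%Z.
rewrite plus_IZR, RtoC_plus; symmetry; apply Cmult_plus_distr_r.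
Qed.

Definition has_coefs (a : nat -> Z) (G : C -> C) : Prop :=
  forall q, (Cmod q < 1)%R -> Cis_series (fun n => RtoC (IZR (a n)) * q ^ n) (G q).

(** The coefficients of q^m times a series. *)
Definition delay (m : nat) (a : nat -> Z) (n : nat) : Z :=
  if (n <? m)%nat then 0%Z else a (n - m)%nat.

Definition delta (m n : nat) : Z := if (n =? m)%nat then 1%Z else 0%Z.

Lemma has_coefs_ext (a b : nat -> Z) (G H : C -> C) :
  (forall n, a n = b n) -> (forall q, (Cmod q < 1)%R -> G q = H q) ->
  has_coefs a G -> has_coefs b H.
Proof.
intros E1 E2 Ha q Hq; rewrite <- (E2 q Hq).
apply (series_ext (fun n => RtoC (IZR (a n)) * q ^ n)); [intros n; now rewrite E1|now apply Ha].
Qed.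

Lemma has_coefs_plus (a b : nat -> Z) (G H : C -> C) :
  has_coefs a G -> has_coefs b H -> has_coefs (fun n => a n + b n)%Z (fun q => G q + H q).
Proof.
intros Ha Hb q Hq.
apply (series_ext (fun n => RtoC (IZR (a n)) * q ^ n + RtoC (IZR (b n)) * q ^ n)).
- intros n; rewrite plus_IZR, RtoC_plus; ring.
- now apply series_plus; [apply Ha|apply Hb].
Qed.

Lemma has_coefs_scal (c : Z) (a : nat -> Z) (G : C -> C) :
  has_coefs a G -> has_coefs (fun n => c * a n)%Z (fun q => RtoC (IZR c) * G q).
Proof.
intros Ha q Hq.
apply (series_ext (fun n => RtoC (IZR c) * (RtoC (IZR (a n)) * q ^ n))).
- intros n; rewrite mult_IZR, RtoC_mult; ring.
- now apply series_scal, Ha.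
Qed.

Lemma series_delay (m : nat) (f : nat -> C) (l : C) :
  Cis_series f l ->
  Cis_series (fun n => if (n <? m)%nat then RtoC 0 else f (n - m)%nat) l.
Proof.
intros H; induction m as [|m IH].
- apply (series_ext f); [intros n; now rewrite Nat.sub_0_r|exact H].
- replace l with (0 + l) by ring.
  apply (series_cons (fun n => if (n <? S m)%nat then RtoC 0 else f (n - S m)%nat)).
  exact IH.
Qed.

Lemma has_coefs_delay (m : nat) (a : nat -> Z) (G : C -> C) :
  has_coefs a G -> has_coefs (delay m a) (fun q => q ^ m * G q).
Proof.
intros Ha q Hq.
apply (series_ext (fun n => if (n <? m)%nat then RtoC 0
         else (fun n => q ^ m * (RtoC (IZR (a n)) * q ^ n)) (n - m)%nat)).
- intros n; unfold delay; destruct (Nat.ltb_spec n m); [ring|].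
  replace (q ^ n) with (q ^ m * q ^ (n - m)) by (rewrite <- Cpow_add_r; f_equal; lia).
  ring.
- apply (series_delay m (fun n => q ^ m * (RtoC (IZR (a n)) * q ^ n))).
  now apply series_scal, Ha.
Qed.

Lemma has_coefs_delta (m : nat) : has_coefs (delta m) (fun q => q ^ m).
Proof.
apply (has_coefs_ext (delay m (delta 0)) _ (fun q => q ^ m * 1)).
- intros n; unfold delay, delta.
  destruct (Nat.ltb_spec n m); destruct (Nat.eqb_spec n m); try lia; try reflexivity;
    destruct (Nat.eqb_spec (n - m) 0); lia || reflexivity.
- intros q _; ring.
- apply has_coefs_delay; intros q Hq.
  assert (H := series_finite (fun n => RtoC (IZR (delta 0 n)) * q ^ n) 0).
  rewrite sum_O in H; simpl in H; rewrite Cmult_1_r in H.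
  apply H; intros k Hk; unfold delta; destruct (Nat.eqb_spec k 0); [lia|]; ring.
Qed.

Lemma eventually_bounded (f : nat -> R) (B : R) :
  eventually (fun n => (f n <= B)%R) -> exists M : R, forall n, (f n <= M)%R.
Proof.
intros [N HN].
assert (H : exists M, forall n, (n < N)%nat -> (f n <= M)%R).
{ clear HN; induction N as [|N [M HM]]; [exists 0%R; lia|].
  exists (Rmax M (f N)); intros n Hn.
  destruct (Nat.eq_dec n N) as [->|Hne]; [apply Rmax_r|].
  eapply Rle_trans; [apply HM; lia|apply Rmax_l]. }
destruct H as [M HM]; exists (Rmax M B); intros n.
destruct (Nat.lt_ge_cases n N) as [Hn|Hn].
- eapply Rle_trans; [now apply HM|apply Rmax_l].
- eapply Rle_trans; [now apply HN|apply Rmax_r].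
Qed.

Lemma has_coefs_bound (a : nat -> Z) (G : C -> C) (s : R) :
  has_coefs a G -> (0 <= s < 1)%R ->
  exists M : R, forall n, (Rabs (IZR (a n)) * s ^ n <= M)%R.
Proof.
intros Ha Hs.
assert (Hs' : (Cmod (RtoC s) < 1)%R) by (rewrite Cmod_R, Rabs_pos_eq; lra).
assert (H := proj1 (series_tends _ _) (Ha _ Hs')).
assert (H' := tends_minus eventually _ _ _ _ (tends_incr _ _ H) H).
destruct (eventually_bounded (fun n => Rabs (IZR (a (S n))) * s ^ S n)%R 1) as [M HM].
{ generalize (H' 1%R Rlt_0_1); apply filter_imp; intros n Hn.
  rewrite sum_C_S in Hn.
  match type of Hn with (Cmod ?x < 1)%R =>
    replace x with (RtoC (IZR (a (S n))) * RtoC s ^ S n) in Hn by ring end.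
  rewrite Cmod_mult, Cmod_pow, !Cmod_R, (Rabs_pos_eq s) in Hn by lra; lra. }
exists (Rmax M (Rabs (IZR (a O)))); intros [|n].
- simpl; rewrite Rmult_1_r; apply Rmax_r.
- eapply Rle_trans; [apply HM|apply Rmax_l].
Qed.

Lemma radius_between (r : R) :
  (0 <= r < 1)%R -> exists s, (0 < s < 1)%R /\ (0 <= r / s < 1)%R.
Proof.
intros Hr; exists ((1 + r) / 2)%R; split; [lra|split].
- apply Rmult_le_pos; [lra|left; apply Rinv_0_lt_compat; lra].
- apply Rmult_lt_reg_r with ((1 + r) / 2)%R; [lra|].
  unfold Rdiv at 1; rewrite Rmult_assoc, Rinv_l; lra.
Qed.

Lemma coef_term_bound (a : Z) (q : C) (s M : R) (n : nat) :
  (0 < s)%R -> (Rabs (IZR a) * s ^ n <= M)%R ->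
  (Cmod (RtoC (IZR a) * q ^ n) <= M * (Cmod q / s) ^ n)%R.
Proof.
intros Hs H; rewrite Cmod_mult, Cmod_pow, Cmod_R.
assert (Hp : (0 < s ^ n)%R) by now apply pow_lt.
unfold Rdiv; rewrite Rpow_mult_distr, pow_inv.
assert (Hq : (0 <= Cmod q ^ n)%R) by apply pow_le, Cmod_ge_0.
apply Rmult_le_reg_r with (s ^ n)%R; [exact Hp|].
replace (M * (Cmod q ^ n * / s ^ n) * s ^ n)%R with (M * Cmod q ^ n)%R by (field; lra).
replace (Rabs (IZR a) * Cmod q ^ n * s ^ n)%R
  with (Rabs (IZR a) * s ^ n * Cmod q ^ n)%R by ring.
now apply Rmult_le_compat_r.
Qed.

(** A sum of power series in which the k-th one starts at q^k or later: every
coefficient of the sum is a finite sum. The bound, uniform in k, makes the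
double series absolutely convergent. *)
Lemma has_coefs_series (a : nat -> nat -> Z) (H : nat -> C -> C) (G : C -> C) :
  (forall k n, (n < k)%nat -> a k n = 0%Z) ->
  (forall s : R, (0 < s < 1)%R -> exists M : R,
     forall k n, (Rabs (IZR (a k n)) * s ^ n <= M)%R) ->
  (forall k, has_coefs (a k) (H k)) ->
  (forall q, (Cmod q < 1)%R -> Cis_series (fun k => H k q) (G q)) ->
  has_coefs (fun n => zsum (fun k => a k n) (S n)) G.
Proof.
intros Hz HM HH HG q Hq.
destruct (radius_between (Cmod q)) as [s [Hs Hrs]]; [split; [apply Cmod_ge_0|exact Hq]|].
destruct (HM s Hs) as [M HM'].
apply (series_ext (fun n => sum_n (G := C_AbelianMonoid)
                              (fun k => RtoC (IZR (a k n)) * q ^ n) n)).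
{ intros n; apply (zsum_sum_n (fun k => a k n)). }
apply (triangular_exchange (fun k n => RtoC (IZR (a k n)) * q ^ n) (fun k => H k q)
         (G q) M (Cmod q / s) Hrs).
- intros k n Hkn; rewrite (Hz k n Hkn); ring.
- intros k n; apply coef_term_bound; [lra|apply HM'].
- intros k; now apply HH.
- now apply HG.
Qed.

(** The Cauchy product, as a sum over k of a_k q^k times the second series. *)
Lemma has_coefs_mult (a b : nat -> Z) (G H : C -> C) :
  has_coefs a G -> has_coefs b H ->
  has_coefs (fun n => zsum (fun k => a k * delay k b n)%Z (S n)) (fun q => G q * H q).
Proof.
intros Ha Hb.
apply (has_coefs_series (fun k n => (a k * delay k b n)%Z)
         (fun k q => RtoC (IZR (a k)) * (q ^ k * H q))).
- intros k n Hkn; unfold delay; rewrite (proj2 (Nat.ltb_lt n k) Hkn); ring.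
- intros s Hs.
  destruct (has_coefs_bound a G s Ha) as [A HA]; [lra|].
  destruct (has_coefs_bound b H s Hb) as [B HB]; [lra|].
  exists (A * B)%R; intros k n; unfold delay.
  assert (HA0 : (0 <= A)%R)
    by (generalize (HA O) (Rabs_pos (IZR (a O))); simpl; lra).
  assert (HB0 : (0 <= B)%R)
    by (generalize (HB O) (Rabs_pos (IZR (b O))); simpl; lra).
  destruct (Nat.ltb_spec n k).
  + rewrite Z.mul_0_r, Rabs_R0, Rmult_0_l; now apply Rmult_le_pos.
  + replace (s ^ n)%R with (s ^ k * s ^ (n - k))%R by (rewrite <- pow_add; f_equal; lia).
    rewrite mult_IZR, Rabs_mult.
    replace (Rabs (IZR (a k)) * Rabs (IZR (b (n - k)%nat)) * (s ^ k * s ^ (n - k)))%R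
      with (Rabs (IZR (a k)) * s ^ k * (Rabs (IZR (b (n - k)%nat)) * s ^ (n - k)))%R by ring.
    apply Rmult_le_compat; [| |apply HA|apply HB];
      apply Rmult_le_pos; try apply Rabs_pos; apply pow_le; lra.
- intros k; apply has_coefs_scal, has_coefs_delay, Hb.
- intros q Hq.
  apply (series_ext (fun k => H q * (RtoC (IZR (a k)) * q ^ k))); [intros k; ring|].
  rewrite Cmult_comm; now apply series_scal, Ha.
Qed.

Definition psum (a : nat -> Z) (n : nat) : Z := zsum a (S n).

Lemma zsum_ext (f g : nat -> Z) (n : nat) :
  (forall k, (k < n)%nat -> f k = g k) -> zsum f n = zsum g n.
Proof.
intros H; induction n as [|n IH]; [reflexivity|]; simpl.
rewrite IH, H; [reflexivity|lia|]; intros k Hk; apply H; lia.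
Qed.

Lemma has_coefs_geom : has_coefs (fun _ => 1%Z) (fun q => / (1 - q)).
Proof.
intros q Hq.
assert (Hr : (0 <= Cmod q < 1)%R) by (split; [apply Cmod_ge_0|exact Hq]).
destruct (series_geom_le (fun n => q ^ n) 1 (Cmod q) Hr) as [H _].
{ intros n; rewrite Cmod_pow; lra. }
apply (series_ext (fun n => q ^ n)); [intros n; ring|].
assert (H1 : Cis_series (fun n => q ^ n) (q ^ 0 + q * Cseries (fun n => q ^ n))).
{ apply (series_cons (fun n => q ^ n)); now apply series_scal. }
assert (E := series_unique _ _ _ H H1).
set (x := Cseries (fun n => q ^ n)) in *; simpl in E.
replace (/ (1 - q)) with x; [exact H|].
assert (Hn := one_minus_nz q Hq).
replace x with ((x - q * x) * / (1 - q)) by (field; exact Hn).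
rewrite E at 1; field; exact Hn.
Qed.

Lemma has_coefs_psum (a : nat -> Z) (G : C -> C) :
  has_coefs a G -> has_coefs (psum a) (fun q => G q / (1 - q)).
Proof.
intros Ha.
refine (has_coefs_ext _ _ _ _ _ _ (has_coefs_mult _ _ _ _ Ha has_coefs_geom));
  [|reflexivity].
intros n; apply zsum_ext; intros k Hk; unfold delay.
rewrite (proj2 (Nat.ltb_ge n k)) by lia; ring.
Qed.

Definition nonneg_coefs (G : C -> C) : Prop :=
  exists a : nat -> Z, (forall n, (0 <= a n)%Z) /\ has_coefs a G.

Lemma zsum_nonneg (f : nat -> Z) (n : nat) :
  (forall k, (k < n)%nat -> (0 <= f k)%Z) -> (0 <= zsum f n)%Z.
Proof.
intros H; induction n as [|n IH]; simpl; [lia|].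
apply Z.add_nonneg_nonneg; [apply IH; intros k Hk|]; apply H; lia.
Qed.

Lemma delay_nonneg (m : nat) (a : nat -> Z) (n : nat) :
  (forall n, (0 <= a n)%Z) -> (0 <= delay m a n)%Z.
Proof. intros H; unfold delay; destruct (n <? m)%nat; [lia|apply H]. Qed.

Lemma nonneg_ext (G H : C -> C) :
  (forall q, (Cmod q < 1)%R -> G q = H q) -> nonneg_coefs G -> nonneg_coefs H.
Proof.
intros E [a [Ha0 Ha]]; exists a; split; [exact Ha0|].
now apply (has_coefs_ext a _ G).
Qed.

Lemma nonneg_plus (G H : C -> C) :
  nonneg_coefs G -> nonneg_coefs H -> nonneg_coefs (fun q => G q + H q).
Proof.
intros [a [Ha0 Ha]] [b [Hb0 Hb]]; exists (fun n => a n + b n)%Z; split.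
- intros n; now apply Z.add_nonneg_nonneg.
- now apply has_coefs_plus.
Qed.

Lemma nonneg_mult (G H : C -> C) :
  nonneg_coefs G -> nonneg_coefs H -> nonneg_coefs (fun q => G q * H q).
Proof.
intros [a [Ha0 Ha]] [b [Hb0 Hb]]; eexists; split; [|exact (has_coefs_mult _ _ _ _ Ha Hb)].
intros n; apply zsum_nonneg; intros k _.
apply Z.mul_nonneg_nonneg; [apply Ha0|now apply delay_nonneg].
Qed.

Lemma nonneg_monomial (m : nat) : nonneg_coefs (fun q => q ^ m).
Proof.
exists (delta m); split; [|apply has_coefs_delta].
intros n; unfold delta; destruct (n =? m)%nat; lia.
Qed.

Lemma pow_n_Cpow (q : C) (n : nat) : pow_n (K := C_AbsRing) q n = q ^ n.
Proof. induction n as [|n IH]; [reflexivity|]; rewrite Cpow_S, <- IH; reflexivity. Qed.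

Lemma nonneg_coef_nonneg (G : C -> C) : nonneg_coefs G -> coef_nonneg G.
Proof.
intros [a [Ha0 Ha]]; exists (fun n => IZR (a n)); split.
- intros n; now apply IZR_le.
- intros q Hq; unfold is_pseries.
  apply (series_ext (fun n => RtoC (IZR (a n)) * q ^ n)); [|now apply Ha].
  intros n; rewrite Cmult_comm, <- pow_n_Cpow; reflexivity.
Qed.

(** * Arithmetic of the Lambert coefficients *)

Local Open Scope Z_scope.

Lemma zsum_le (f g : nat -> Z) (n : nat) :
  (forall k, (k < n)%nat -> f k <= g k) -> zsum f n <= zsum g n.
Proof.
intros H; induction n as [|n IH]; simpl; [lia|].
apply Z.add_le_mono; [apply IH; intros k Hk|]; apply H; lia.
Qed.

Lemma zsum_plus (f g : nat -> Z) (n : nat) :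
  zsum (fun k => f k + g k) n = zsum f n + zsum g n.
Proof. induction n as [|n IH]; simpl; [reflexivity|lia]. Qed.

Lemma zsum_scal (c : Z) (f : nat -> Z) (n : nat) :
  zsum (fun k => c * f k) n = c * zsum f n.
Proof. induction n as [|n IH]; simpl; lia. Qed.

Lemma zsum_extend (f : nat -> Z) (m n : nat) :
  (m <= n)%nat -> (forall k, (m <= k)%nat -> f k = 0) -> zsum f n = zsum f m.
Proof.
intros Hmn H; induction Hmn as [|n Hmn IH]; [reflexivity|].
simpl; rewrite IH, H; lia.
Qed.

Lemma zsum_swap (f : nat -> nat -> Z) (m n : nat) :
  zsum (fun i => zsum (f i) n) m = zsum (fun j => zsum (fun i => f i j) m) n.
Proof.
induction m as [|m IH]; simpl.
- induction n as [|n IHn]; simpl; lia.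
- now rewrite IH, <- zsum_plus.
Qed.

Lemma zsum_delta (m n : nat) : (m < n)%nat -> zsum (delta m) n = 1.
Proof.
intros H; rewrite (zsum_extend (delta m) (S m) n) by
  (lia || (intros k Hk; unfold delta; now rewrite (proj2 (Nat.eqb_neq k m)) by lia)).
simpl; replace (zsum (delta m) m) with 0.
- unfold delta; now rewrite Nat.eqb_refl.
- rewrite (zsum_ext _ (fun _ => 0 * 0)); [now rewrite zsum_scal|].
  intros k Hk; unfold delta; now rewrite (proj2 (Nat.eqb_neq k m)) by lia.
Qed.

Lemma zsum_indicator (m n : nat) :
  (m <= n)%nat -> zsum (fun k => Z.b2z (k <? m)%nat) n = Z.of_nat m.
Proof.
intros H; rewrite (zsum_extend _ m n H).
- clear H n; assert (E : forall p, (p <= m)%nat ->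
    zsum (fun k => Z.b2z (k <? m)%nat) p = Z.of_nat p).
  { induction p as [|p IH]; intros Hp; [reflexivity|]; simpl zsum.
    rewrite IH, (proj2 (Nat.ltb_lt p m)) by lia; simpl Z.b2z; lia. }
  now apply E.
- intros k Hk; now rewrite (proj2 (Nat.ltb_ge k m)).
Qed.

Lemma psum_plus (a b : nat -> Z) (n : nat) :
  psum (fun k => a k + b k) n = psum a n + psum b n.
Proof. apply zsum_plus. Qed.

Lemma psum_scal (c : Z) (a : nat -> Z) (n : nat) :
  psum (fun k => c * a k) n = c * psum a n.
Proof. apply zsum_scal. Qed.

Lemma psum_triangular (a : nat -> nat -> Z) (N : nat) :
  (forall k n, (n < k)%nat -> a k n = 0) ->
  psum (fun n => zsum (fun k => a k n) (S n)) N = zsum (fun k => psum (a k) N) (S N).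
Proof.
intros H; unfold psum; rewrite (zsum_swap a (S N) (S N)).
apply zsum_ext; intros n Hn; symmetry; apply zsum_extend; [lia|].
intros k Hk; apply H; lia.
Qed.

(** The N-th partial sum of the coefficients of q^m/(1 + q^m): the coefficients
1, -1, 1, ... sit at m, 2m, 3m, ... . *)
Definition odd_quotient (m n : nat) : Z := Z.b2z (Nat.odd (n / m)).

(** The coefficients of q^m/(1 + q^m), defined as differences because the
inequalities below concern their partial sums. *)
Definition lambert_coef (m n : nat) : Z := odd_quotient m n - odd_quotient m (n - 1).

Lemma odd_quotient_range (m n : nat) : 0 <= odd_quotient m n <= 1.
Proof. unfold odd_quotient; destruct (Nat.odd (n / m)); simpl; lia. Qed.

Lemma odd_quotient_small (m n : nat) : (n < m)%nat -> odd_quotient m n = 0.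
Proof. intros H; unfold odd_quotient; now rewrite Nat.div_small. Qed.

Lemma odd_quotient_1 (m n : nat) : (m <= n < 2 * m)%nat -> odd_quotient m n = 1.
Proof.
intros H; unfold odd_quotient; replace (n / m)%nat with 1%nat; [reflexivity|].
apply (Nat.div_unique n m 1 (n - m)); lia.
Qed.

Lemma lambert_coef_small (m n : nat) : (n < m)%nat -> lambert_coef m n = 0.
Proof. intros H; unfold lambert_coef; rewrite !odd_quotient_small; lia. Qed.

Lemma psum_lambert_coef (m N : nat) : (0 < m)%nat -> psum (lambert_coef m) N = odd_quotient m N.
Proof.
intros Hm; unfold psum; induction N as [|N IH].
- unfold lambert_coef; simpl; rewrite odd_quotient_small; lia.
- change (zsum (lambert_coef m) (S (S N))) with (zsum (lambert_coef m) (S N) + lambert_coef m (S N)).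
  rewrite IH; unfold lambert_coef; replace (S N - 1)%nat with N by lia; lia.
Qed.

Lemma lambert_coef_cases (m n : nat) :
  (0 < m)%nat ->
  lambert_coef m n = 0 \/
  exists c : nat, ((n = m * c)%nat /\ (1 <= c)%nat) /\ lambert_coef m n = if Nat.odd c then 1 else -1.
Proof.
intros Hm; destruct n as [|n]; [left; now apply lambert_coef_small|].
unfold lambert_coef; replace (S n - 1)%nat with n by lia.
assert (E := Nat.div_mod n m ltac:(lia)).
assert (B := Nat.mod_upper_bound n m ltac:(lia)).
set (a := (n / m)%nat) in *; set (b := (n mod m)%nat) in *.
destruct (Nat.eq_dec (S b) m) as [Hb|Hb].
- right; exists (S a).
  assert (Hn : (S n = m * S a)%nat) by lia.
  split; [lia|]; unfold odd_quotient; fold a.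
  rewrite Hn, Nat.mul_comm, Nat.div_mul by lia.
  rewrite Nat.odd_succ, <- Nat.negb_odd; now destruct (Nat.odd a).
- left; unfold odd_quotient; fold a.
  replace (S n / m)%nat with a; [lia|].
  apply (Nat.div_unique _ _ _ (S b)); lia.
Qed.

Lemma lambert_coef_range (m n : nat) : (0 < m)%nat -> -1 <= lambert_coef m n <= 1.
Proof.
intros Hm; destruct (lambert_coef_cases m n Hm) as [-> |[c [_ ->]]]; [lia|].
destruct (Nat.odd c); lia.
Qed.

Lemma odd_quotient_add (m n : nat) : (0 < m)%nat -> odd_quotient m (n + m) = 1 - odd_quotient m n.
Proof.
intros Hm; unfold odd_quotient.
replace (n + m)%nat with (n + 1 * m)%nat by lia.
rewrite Nat.div_add by lia; rewrite Nat.add_1_r, Nat.odd_succ, <- Nat.negb_odd.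
now destruct (Nat.odd (n / m)).
Qed.

(** The coefficient form of (1 + q^m) * (q^m/(1 + q^m)) = q^m. *)
Lemma lambert_coef_recurrence (m n : nat) :
  (0 < m)%nat -> lambert_coef m n + delay m (lambert_coef m) n = delta m n.
Proof.
intros Hm; unfold delay, delta.
destruct (Nat.ltb_spec n m).
- rewrite lambert_coef_small by assumption; destruct (Nat.eqb_spec n m); lia.
- replace n with ((n - m) + m)%nat at 1 by lia; set (k := (n - m)%nat).
  destruct (Nat.eqb_spec n m) as [E|E]; unfold lambert_coef; rewrite (odd_quotient_add m k Hm).
  + replace k with 0%nat by lia; simpl (0 + m - 1)%nat; rewrite !odd_quotient_small; lia.
  + replace (k + m - 1)%nat with ((k - 1) + m)%nat by lia; rewrite (odd_quotient_add m _ Hm); lia.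
Qed.

Definition s_odd_coef (n : nat) : Z := zsum (fun k => lambert_coef (2 * k + 1) n) (S n).
Definition s_even_coef (n : nat) : Z := zsum (fun k => lambert_coef (2 * S k) n) (S n).
Definition square_coef (n : nat) : Z := zsum (fun k => delta (S k * S k) n) (S n).
(** The coefficients of X = S_even - S_odd + 2 (q + q^4 + q^9 + ...). *)
Definition x_coef (n : nat) : Z := s_even_coef n + -1 * s_odd_coef n + 2 * square_coef n.

Lemma lambert_coef_small_odd k n : (n < k)%nat -> lambert_coef (2 * k + 1) n = 0.
Proof. intros H; apply lambert_coef_small; lia. Qed.
Lemma lambert_coef_small_even k n : (n < k)%nat -> lambert_coef (2 * S k) n = 0.
Proof. intros H; apply lambert_coef_small; lia. Qed.
Lemma delta_small_sq k n : (n < k)%nat -> delta (S k * S k) n = 0.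
Proof. intros H; unfold delta; destruct (Nat.eqb_spec n (S k * S k)); [nia|reflexivity]. Qed.

Lemma psum_s_even N : psum s_even_coef N = zsum (fun k => odd_quotient (2 * S k) N) (S N).
Proof.
unfold s_even_coef; rewrite (psum_triangular (fun k n => lambert_coef (2 * S k) n)) by apply lambert_coef_small_even.
apply zsum_ext; intros k _; apply psum_lambert_coef; lia.
Qed.

Lemma psum_s_odd N : psum s_odd_coef N = zsum (fun k => odd_quotient (2 * k + 1) N) (S N).
Proof.
unfold s_odd_coef; rewrite (psum_triangular (fun k n => lambert_coef (2 * k + 1) n)) by apply lambert_coef_small_odd.
apply zsum_ext; intros k _; apply psum_lambert_coef; lia.
Qed.

Lemma psum_delta m N : psum (delta m) N = Z.b2z (m <=? N)%nat.
Proof.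
unfold psum; destruct (Nat.leb_spec m N); [apply zsum_delta; lia|].
rewrite (zsum_ext _ (fun _ => 0 * 0)); [now rewrite zsum_scal|].
intros k Hk; unfold delta; now rewrite (proj2 (Nat.eqb_neq k m)) by lia.
Qed.

Lemma psum_square_coef N : psum square_coef N = zsum (fun k => Z.b2z (S k * S k <=? N)%nat) (S N).
Proof.
unfold square_coef; rewrite (psum_triangular (fun k n => delta (S k * S k) n)) by apply delta_small_sq.
apply zsum_ext; intros k _; apply psum_delta.
Qed.

Definition sign (n : nat) : Z := if Nat.even n then 1 else -1.

Lemma sign_add (i j : nat) : sign (i + j) = sign i * sign j.
Proof. unfold sign; rewrite Nat.even_add; now destruct (Nat.even i), (Nat.even j). Qed.

Lemma sign_S (i : nat) : sign (S i) = - sign i.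
Proof. unfold sign; rewrite Nat.even_succ, <- Nat.negb_even; now destruct (Nat.even i). Qed.

(** Only the parity of the number of terms matters, as the first term has
sign (a + a) = 1. *)
Lemma alternating_sum (a K n : nat) :
  zsum (fun j => if ((a <=? j) && (j <? K))%nat%bool then sign (a + j) else 0) n
  = Z.b2z (Nat.odd (Nat.min n K - a)).
Proof.
induction n as [|n IH]; [reflexivity|]; simpl zsum; rewrite IH.
destruct (Nat.leb_spec a n) as [Ha|Ha]; destruct (Nat.ltb_spec n K) as [HK|HK]; simpl andb; cbv iota.
- rewrite !Nat.min_l by lia; replace (S n - a)%nat with (S (n - a)) by lia.
  replace (a + n)%nat with (2 * a + (n - a))%nat by lia.
  unfold sign; rewrite Nat.even_add, Nat.even_mul; simpl (Nat.even 2).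
  rewrite Nat.odd_succ, <- Nat.negb_even.
  now destruct (Nat.even (n - a)).
- rewrite !Nat.min_r by lia; lia.
- replace (Nat.min n K - a)%nat with 0%nat by lia.
  replace (Nat.min (S n) K - a)%nat with 0%nat by lia; reflexivity.
- replace (Nat.min n K - a)%nat with 0%nat by lia.
  replace (Nat.min (S n) K - a)%nat with 0%nat by lia; reflexivity.
Qed.

(** Splitting a square into its diagonal and two mirror-image triangles. *)
Lemma symmetric_sum (h : nat -> nat -> Z) (n : nat) :
  (forall i j, h i j = h j i) ->
  zsum (fun i => zsum (h i) n) n
  = zsum (fun i => h i i) n + 2 * zsum (fun i => zsum (fun j => if (i <? j)%nat then h i j else 0) n) n.
Proof.
intros Hs.
assert (E : zsum (fun i => zsum (h i) n) n
  = zsum (fun i => h i i) n + zsum (fun i => zsum (fun j => if (i <? j)%nat then h i j else 0) n) n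
    + zsum (fun i => zsum (fun j => if (j <? i)%nat then h i j else 0) n) n).
{ rewrite <- !zsum_plus; apply zsum_ext; intros i Hi.
  rewrite <- Z.add_assoc, <- zsum_plus, Z.add_comm.
  assert (Ed : h i i = zsum (fun j => h i i * delta i j) n)
    by (rewrite zsum_scal, zsum_delta by lia; lia).
  rewrite Ed, <- zsum_plus; apply zsum_ext; intros j Hj; unfold delta.
  destruct (Nat.eqb_spec j i) as [-> |Hn]; [rewrite Nat.ltb_irrefl; lia|].
  destruct (Nat.ltb_spec i j); destruct (Nat.ltb_spec j i); lia. }
rewrite E.
rewrite (zsum_swap (fun i j => if (j <? i)%nat then h i j else 0)).
rewrite (zsum_ext (fun j => zsum (fun i => if (j <? i)%nat then h i j else 0) n)
                  (fun i => zsum (fun j => if (i <? j)%nat then h i j else 0) n)); [lia|].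
intros i _; apply zsum_ext; intros j _; now rewrite Hs.
Qed.

Lemma interleave (f : nat -> Z) (n : nat) :
  zsum (fun k => f (2 * k + 1)%nat + f (2 * k)%nat) n = zsum f (2 * n).
Proof.
induction n as [|n IH]; [reflexivity|].
replace (2 * S n)%nat with (S (S (2 * n))) by lia.
transitivity (zsum (fun k => f (2 * k + 1)%nat + f (2 * k)%nat) n
              + (f (2 * n + 1)%nat + f (2 * n)%nat)); [reflexivity|].
rewrite IH; change (zsum f (S (S (2 * n)))) with (zsum f (2 * n) + f (2 * n)%nat + f (S (2 * n))).
rewrite Nat.add_1_r; lia.
Qed.

Lemma mul_le_div (i j N : nat) : (S i * S j <=? N)%nat = (j <? N / S i)%nat.
Proof.
apply Bool.eq_iff_eq_true; rewrite Nat.leb_le, Nat.ltb_lt; split; intros H.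
- apply Nat.div_le_lower_bound; lia.
- apply Nat.le_trans with (S i * (N / S i))%nat; [|apply Nat.Div0.mul_div_le].
  apply Nat.mul_le_mono_l; lia.
Qed.

(** Dirichlet's hyperbola symmetry. The partial sum of the coefficients of
S_even - S_odd is the sum of (-1)^{m+k-1} over all pairs with m k <= N. The
diagonal m = k contributes -1 for every square up to N, which the theta part
more than compensates; for fixed m, the pairs with k > m form an alternating
sum that starts with 1, so it is 0 or 1. *)
Lemma psum_x_coef_nonneg (N : nat) : 0 <= psum x_coef N.
Proof.
unfold x_coef; rewrite !psum_plus, !psum_scal, psum_s_even, psum_s_odd, psum_square_coef.
(* The square of side 2N + 2 holds all pairs with product at most N, and its rows are the odd and even moduli in turn. *)
set (D := (2 * S N)%nat).
set (h := fun i j => if (S i * S j <=? N)%nat then - (sign i * sign j) else 0).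
assert (Hrow : forall i, zsum (h i) D = - sign i * odd_quotient (S i) N).
{ intros i.
  rewrite (zsum_ext _ (fun j => - sign i *
     (if ((0 <=? j) && (j <? N / S i))%nat%bool then sign (0 + j) else 0))).
  - rewrite zsum_scal, alternating_sum; unfold odd_quotient; do 3 f_equal.
    assert (N / S i <= N)%nat by (apply Nat.Div0.div_le_upper_bound; nia).
    rewrite Nat.min_r by (unfold D; lia); lia.
  - intros j _; unfold h; rewrite mul_le_div; change (0 + j)%nat with j; change (0 <=? j)%nat with true.
    rewrite Bool.andb_true_l.
    destruct (j <? N / S i)%nat; lia. }
assert (E1 : zsum (fun k => odd_quotient (2 * S k) N) (S N) + -1 * zsum (fun k => odd_quotient (2 * k + 1) N) (S N)
             = zsum (fun i => zsum (h i) D) D).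
{ rewrite <- zsum_scal, <- zsum_plus; unfold D at 2.
  rewrite <- (interleave (fun i => zsum (h i) D)); apply zsum_ext; intros k _.
  rewrite !Hrow, sign_add.
  assert (E2 : sign (2 * k) = 1) by (unfold sign; now rewrite Nat.even_mul).
  rewrite E2; change (sign 1) with (-1).
  replace (S (2 * k + 1)) with (2 * S k)%nat by lia.
  replace (S (2 * k)) with (2 * k + 1)%nat by lia; lia. }
rewrite E1, symmetric_sum.
2:{ intros i j; unfold h; rewrite (Nat.mul_comm (S j)); destruct (S i * S j <=? N)%nat; lia. }
assert (E3 : zsum (fun i => h i i) D = -1 * zsum (fun k => Z.b2z (S k * S k <=? N)%nat) (S N)).
{ rewrite <- (zsum_extend (fun k => Z.b2z (S k * S k <=? N)%nat) (S N) D).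
  - rewrite <- zsum_scal; apply zsum_ext; intros i _; unfold h.
    assert (Es : sign i * sign i = 1) by (unfold sign; now destruct (Nat.even i)).
    destruct (S i * S i <=? N)%nat; simpl Z.b2z; lia.
  - unfold D; lia.
  - intros k Hk; now rewrite (proj2 (Nat.leb_gt (S k * S k) N)) by nia. }
rewrite E3.
assert (E4 : 0 <= zsum (fun i => zsum (fun j => if (i <? j)%nat then h i j else 0) D) D).
{ apply zsum_nonneg; intros i _.
  rewrite (zsum_ext _ (fun j => if ((S i <=? j) && (j <? N / S i))%nat%bool
                                then sign (S i + j) else 0)).
  - rewrite alternating_sum; destruct (Nat.odd _); simpl; lia.
  - intros j _; unfold h; rewrite mul_le_div, sign_add, sign_S.
    change (i <? j)%nat with (S i <=? j)%nat.
    destruct (S i <=? j)%nat, (j <? N / S i)%nat; simpl andb; ring. }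
assert (E5 : 0 <= zsum (fun k => Z.b2z (S k * S k <=? N)%nat) (S N)).
{ apply zsum_nonneg; intros k _; destruct (S k * S k <=? N)%nat; simpl; lia. }
lia.
Qed.

Lemma s_even_coef_odd (M : nat) : s_even_coef (2 * M + 1) = 0.
Proof.
unfold s_even_coef; rewrite (zsum_ext _ (fun _ => 0 * 0)); [now rewrite zsum_scal|].
intros k _; destruct (lambert_coef_cases (2 * S k) (2 * M + 1) ltac:(lia)) as [-> |[c [[H _] _]]]; lia.
Qed.

Lemma s_odd_coef_even (M : nat) : s_odd_coef (2 * M) <= 0.
Proof.
unfold s_odd_coef; apply Z.le_trans with (zsum (fun _ => 0 * 0) (S (2 * M)));
  [|rewrite zsum_scal; lia].
apply zsum_le; intros k _.
destruct (lambert_coef_cases (2 * k + 1) (2 * M) ltac:(lia)) as [-> |[c [[H _] ->]]]; [lia|].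
destruct (Nat.odd c) eqn:E; [|lia].
apply Nat.odd_spec in E; destruct E as [d ->]; lia.
Qed.

(** At most one contribution from each odd m up to 2M + 1. *)
Lemma s_odd_coef_odd (M : nat) : s_odd_coef (2 * M + 1) <= Z.of_nat M + 1.
Proof.
replace (Z.of_nat M + 1) with (Z.of_nat (S M)) by lia.
rewrite <- (zsum_indicator (S M) (S (2 * M + 1))) by lia.
apply zsum_le; intros k _; destruct (Nat.ltb_spec k (S M)); simpl.
- apply lambert_coef_range; lia.
- rewrite lambert_coef_small; lia.
Qed.

Lemma square_coef_nonneg (n : nat) : 0 <= square_coef n.
Proof. apply zsum_nonneg; intros k _; unfold delta; destruct (n =? _)%nat; lia. Qed.

(** Among the terms of index m = 2(k+1) dividing 2M, the one with m = 2M is 1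
and a term -1 needs an even quotient, hence m <= M; there are at most M/2
such even m. *)
Lemma s_even_coef_even (M : nat) : (1 <= M)%nat -> 2 <= 2 * s_even_coef (2 * M) + Z.of_nat M.
Proof.
intros HM.
assert (H : zsum (fun k => delta (M - 1) k + -1 * Z.b2z (k <? M / 2)%nat) (S (2 * M))
            <= s_even_coef (2 * M)).
{ apply zsum_le; intros k _.
  (* The comparison term is 1 at the divisor 2M itself, -1 for the even divisors up to M. *)
  assert (Hd : (2 * (M / 2) <= M < 2 * (M / 2) + 2)%nat)
    by (generalize (Nat.div_mod M 2 ltac:(lia)) (Nat.mod_upper_bound M 2 ltac:(lia)); lia).
  unfold delta; destruct (Nat.eqb_spec k (M - 1)) as [-> |Hk].
  - replace (2 * S (M - 1))%nat with (2 * M)%nat by lia.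
    unfold lambert_coef; rewrite odd_quotient_1, odd_quotient_small by lia.
    destruct (M - 1 <? M / 2)%nat; simpl; lia.
  - destruct (lambert_coef_cases (2 * S k) (2 * M) ltac:(lia)) as [-> |[c [[Hc _] Hl]]].
    + destruct (k <? M / 2)%nat; simpl; lia.
    + destruct (Nat.ltb_spec k (M / 2)); simpl Z.b2z.
      * generalize (lambert_coef_range (2 * S k) (2 * M) ltac:(lia)); lia.
      * rewrite Hl; destruct c as [|[|c]]; simpl; nia. }
rewrite zsum_plus, zsum_scal, zsum_delta, zsum_indicator in H.
- assert (Hd : (2 * (M / 2) <= M)%nat) by (apply Nat.Div0.mul_div_le); lia.
- apply Nat.Div0.div_le_upper_bound; lia.
- lia.
Qed.

(** The even m with N/2 < m <= N have quotient 1, and they are N/2 - N/4 in number.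
The statement is this bound with the roundings made uniform. *)
Lemma psum_s_even_lower (N : nat) : Z.of_nat N <= 4 * psum s_even_coef N + 1.
Proof.
assert (H : zsum (fun k => Z.b2z (k <? N / 2)%nat + -1 * Z.b2z (k <? N / 4)%nat) (S N)
            <= psum s_even_coef N).
{ rewrite psum_s_even; apply zsum_le; intros k _.
  assert (H2 : (2 * (N / 2) <= N < 2 * (N / 2) + 2)%nat)
    by (generalize (Nat.div_mod N 2 ltac:(lia)) (Nat.mod_upper_bound N 2 ltac:(lia)); lia).
  assert (H4 : (4 * (N / 4) <= N < 4 * (N / 4) + 4)%nat)
    by (generalize (Nat.div_mod N 4 ltac:(lia)) (Nat.mod_upper_bound N 4 ltac:(lia)); lia).
  assert (Hr := odd_quotient_range (2 * S k) N).
  destruct (Nat.ltb_spec k (N / 4)); destruct (Nat.ltb_spec k (N / 2)); simpl Z.b2z; try lia.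
  rewrite odd_quotient_1; lia. }
rewrite zsum_plus, zsum_scal, !zsum_indicator in H
  by (apply Nat.Div0.div_le_upper_bound; lia).
assert (H2 : (N < 2 * (N / 2) + 2)%nat)
  by (generalize (Nat.div_mod N 2 ltac:(lia)) (Nat.mod_upper_bound N 2 ltac:(lia)); lia).
assert (H4 : (4 * (N / 4) <= N)%nat) by apply Nat.Div0.mul_div_le.
lia.
Qed.

(** The coefficients of (1 + q) S_even + (q^3 + q^8) S_even/(1 - q), the part of F3
that is left when the remainder of (1 - q) (-q;q^2) is dropped. *)
Definition f3_coef (n : nat) : Z :=
  s_even_coef n + delay 1 s_even_coef n + delay 3 (psum s_even_coef) n + delay 8 (psum s_even_coef) n.

(** The coefficients of (1 + q) X + (2q + 2q^4) times the series of f3_coef. *)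
Definition t_coef (n : nat) : Z :=
  x_coef n + delay 1 x_coef n + 2 * (delay 1 f3_coef n + delay 4 f3_coef n).

Lemma psum_s_even_nonneg (n : nat) : 0 <= psum s_even_coef n.
Proof. generalize (psum_s_even_lower n); lia. Qed.

Lemma psum_step (a : nat -> Z) (n : nat) : psum a (S n) = psum a n + a (S n).
Proof. reflexivity. Qed.

Lemma psum_s_even_odd (M : nat) : psum s_even_coef (2 * M + 1) = psum s_even_coef (2 * M).
Proof.
replace (2 * M + 1)%nat with (S (2 * M)) by lia; rewrite psum_step.
replace (S (2 * M)) with (2 * M + 1)%nat by lia; rewrite s_even_coef_odd; lia.
Qed.

Lemma psum_s_even_even (M : nat) :
  psum s_even_coef (2 * S M) = psum s_even_coef (2 * M) + s_even_coef (2 * S M).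
Proof.
replace (2 * S M)%nat with (S (2 * M + 1)) at 1 by lia.
rewrite psum_step, psum_s_even_odd; do 2 f_equal; lia.
Qed.

Lemma f3_coef_odd (M : nat) : psum s_even_coef (2 * M) <= f3_coef (2 * M + 1).
Proof.
unfold f3_coef; rewrite s_even_coef_odd.
generalize (delay_nonneg 8 (psum s_even_coef) (2 * M + 1) psum_s_even_nonneg).
set (y := delay 8 _ _); intros Hy; unfold delay.
replace (2 * M + 1 <? 1)%nat with false by (symmetry; apply Nat.ltb_ge; lia).
replace (2 * M + 1 - 1)%nat with (2 * M)%nat by lia.
destruct M as [|M].
- change (2 * 0 + 1 <? 3)%nat with true; change (psum s_even_coef (2 * 0)) with (s_even_coef (2 * 0)); cbv iota; lia.
- replace (2 * S M + 1 <? 3)%nat with false by (symmetry; apply Nat.ltb_ge; lia).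
  replace (2 * S M + 1 - 3)%nat with (2 * M)%nat by lia.
  rewrite psum_s_even_even; lia.
Qed.

Lemma f3_coef_even (M : nat) :
  (1 <= M)%nat -> f3_coef (2 * S M) = s_even_coef (2 * S M) + psum s_even_coef (2 * M - 1) + delay 8 (psum s_even_coef) (2 * S M).
Proof.
intros HM; unfold f3_coef.
set (y := delay 8 _ _); unfold delay.
replace (2 * S M <? 1)%nat with false by (symmetry; apply Nat.ltb_ge; lia).
replace (2 * S M <? 3)%nat with false by (symmetry; apply Nat.ltb_ge; lia).
replace (2 * S M - 1)%nat with (2 * M + 1)%nat by lia.
replace (2 * S M - 3)%nat with (2 * M - 1)%nat by lia.
rewrite s_even_coef_odd; lia.
Qed.

(** A coefficient of S_even at 2M is no less than about -M/2, and the partial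
sums before it, which grow at least like M/2, make up for it. *)
Lemma f3_coef_nonneg (n : nat) : 0 <= f3_coef n.
Proof.
destruct (Nat.Even_or_Odd n) as [[M ->]|[M ->]].
- destruct M as [|[|M]]; [vm_compute; congruence|vm_compute; congruence|].
  rewrite f3_coef_even by lia.
  generalize (delay_nonneg 8 (psum s_even_coef) (2 * S (S M)) psum_s_even_nonneg).
  generalize (s_even_coef_even (S (S M)) ltac:(lia)) (psum_s_even_lower (2 * S M - 1)); lia.
- eapply Z.le_trans; [apply psum_s_even_nonneg|apply f3_coef_odd].
Qed.

(** At an even exponent 2M the loss is at most M, from the odd divisors of
2M - 1, and two partial sums of S_even gain M. At an odd exponent 2M + 1 the
gains outweigh the losses from exponent 24 on; the coefficients at the
exponents below 24 are computed. *)
Lemma t_coef_nonneg (n : nat) : 0 <= t_coef n.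
Proof.
assert (small : forall k, (k < 24)%nat -> 0 <= t_coef k).
{ assert (E : List.forallb (fun k => 0 <=? t_coef k) (List.seq 0 24) = true)
    by (vm_compute; reflexivity).
  intros k Hk; apply Z.leb_le.
  apply (proj1 (List.forallb_forall _ _) E), List.in_seq; lia. }
destruct (Nat.lt_ge_cases n 24) as [Hn|Hn]; [now apply small|clear small].
unfold t_coef, delay.
replace (n <? 1)%nat with false by (symmetry; apply Nat.ltb_ge; lia).
replace (n <? 4)%nat with false by (symmetry; apply Nat.ltb_ge; lia).
destruct (Nat.Even_or_Odd n) as [[M ->]|[M ->]].
- destruct M as [|M]; [lia|].
  replace (2 * S M - 1)%nat with (2 * M + 1)%nat by lia.
  assert (H1 := f3_coef_odd M); assert (H2 := f3_coef_nonneg (2 * S M - 4)).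
  assert (H3 := psum_s_even_even M).
  assert (H4 := s_odd_coef_even (S M)); assert (H5 := s_odd_coef_odd M); assert (H6 := s_even_coef_odd M).
  assert (H7 := square_coef_nonneg (2 * S M)); assert (H8 := square_coef_nonneg (2 * M + 1)).
  assert (H9 := psum_s_even_lower (2 * S M)); assert (H10 := psum_s_even_lower (2 * M)).
  unfold x_coef; destruct (Nat.Even_or_Odd M) as [[a Ha]|[a Ha]]; lia.
- destruct M as [|[|M]]; [lia|lia|].
  replace (2 * S (S M) + 1 - 1)%nat with (2 * S (S M))%nat by lia.
  replace (2 * S (S M) + 1 - 4)%nat with (2 * M + 1)%nat by lia.
  assert (H1 := f3_coef_odd M); assert (H2 := f3_coef_even (S M) ltac:(lia)).
  unfold delay in H2.
  replace (2 * S (S M) <? 8)%nat with false in H2 by (symmetry; apply Nat.ltb_ge; lia).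
  assert (H3 := s_even_coef_even (S (S M)) ltac:(lia)).
  assert (H4 := s_odd_coef_even (S (S M))); assert (H5 := s_odd_coef_odd (S (S M))).
  assert (H6 := s_even_coef_odd (S (S M))).
  assert (H7 := square_coef_nonneg (2 * S (S M))); assert (H8 := square_coef_nonneg (2 * S (S M) + 1)).
  assert (H9 := psum_s_even_lower (2 * M)); assert (H10 := psum_s_even_lower (2 * S M - 1)).
  assert (H11 := psum_s_even_lower (2 * S (S M) - 8)).
  unfold x_coef; destruct (Nat.Even_or_Odd M) as [[a Ha]|[a Ha]]; lia.
Qed.

Local Close Scope Z_scope.

(** * Non-negativity of F1 - F2 *)

Lemma has_coefs_unique_value (a : nat -> Z) (G H : C -> C) (q : C) :
  has_coefs a G -> has_coefs a H -> (Cmod q < 1)%R -> G q = H q.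
Proof. intros Ha Hb Hq; exact (series_unique _ _ _ (Ha q Hq) (Hb q Hq)). Qed.

Lemma lambert_coef_has_coefs (m : nat) :
  (0 < m)%nat -> has_coefs (lambert_coef m) (fun q => q ^ m / (1 + q ^ m)).
Proof.
intros Hm; set (H := fun q => Cseries (fun n => RtoC (IZR (lambert_coef m n)) * q ^ n)).
assert (HH : has_coefs (lambert_coef m) H).
{ intros q Hq; apply (series_geom_le _ 1 (Cmod q)).
  - split; [apply Cmod_ge_0|exact Hq].
  - intros n; rewrite Cmod_mult, Cmod_pow, Cmod_R.
    apply Rmult_le_compat_r; [apply pow_le, Cmod_ge_0|].
    rewrite <- abs_IZR; apply IZR_le; generalize (lambert_coef_range m n Hm); lia. }
apply (has_coefs_ext (lambert_coef m) _ H); [reflexivity| |exact HH].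
intros q Hq.
assert (E : H q + q ^ m * H q = q ^ m).
{ apply (has_coefs_unique_value (delta m) (fun q => H q + q ^ m * H q) (fun q => q ^ m));
    [|apply has_coefs_delta|exact Hq].
  refine (has_coefs_ext _ _ _ _ _ _
            (has_coefs_plus _ _ _ _ HH (has_coefs_delay m _ _ HH))).
  - intros n; now apply lambert_coef_recurrence.
  - reflexivity. }
assert (Hn : 1 + q ^ m <> 0).
{ destruct m as [|m]; [lia|]; now apply one_plus_nz, Cmod_pow_lt_1. }
rewrite <- E at 1; field; exact Hn.
Qed.

Section Increasing_exponents.
Context (e : nat -> nat) (He : forall k, (k < e k)%nat).

Lemma Cmod_pow_exponent (q : C) (k : nat) :
  (Cmod q < 1)%R -> (Cmod (q ^ e k) <= Cmod q ^ k)%R.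
Proof.
intros Hq; rewrite Cmod_pow; apply pow_le_pow; [split; [apply Cmod_ge_0|lra]|].
generalize (He k); lia.
Qed.

Lemma power_series_exponents (q : C) :
  (Cmod q < 1)%R -> Cis_series (fun k => q ^ e k) (Cseries (fun k => q ^ e k)).
Proof.
intros Hq; apply (series_geom_le _ 1 (Cmod q)); [split; [apply Cmod_ge_0|exact Hq]|].
intros k; rewrite Rmult_1_l; now apply Cmod_pow_exponent.
Qed.

Lemma lambert_series_exponents (q : C) :
  (Cmod q < 1)%R ->
  Cis_series (fun k => q ^ e k / (1 + q ^ e k)) (Cseries (fun k => q ^ e k / (1 + q ^ e k))).
Proof.
intros Hq; apply (series_geom_le _ (/ (1 - Cmod q))%R (Cmod q));
  [split; [apply Cmod_ge_0|exact Hq]|].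
intros k.
assert (Hk : (Cmod (q ^ e k) <= Cmod q)%R).
{ rewrite Cmod_pow; rewrite <- (pow_1 (Cmod q)) at 2.
  apply pow_le_pow; [split; [apply Cmod_ge_0|lra]|]; generalize (He k); lia. }
assert (Hn : 1 + q ^ e k <> 0) by (apply one_plus_nz; lra).
rewrite Cmod_div, Rmult_comm by exact Hn.
apply Rmult_le_compat; [apply Cmod_ge_0| |now apply Cmod_pow_exponent|].
- left; apply Rinv_0_lt_compat; now apply Cmod_gt_0.
- apply Rinv_le_contravar; [lra|].
  generalize (Cmod_triangle (1 + q ^ e k) (- q ^ e k)).
  replace (1 + q ^ e k + - q ^ e k) with (RtoC 1) by ring.
  rewrite Cmod_1, Cmod_opp; lra.
Qed.

Lemma has_coefs_powers :
  has_coefs (fun n => zsum (fun k => delta (e k) n) (S n))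
            (fun q => Cseries (fun k => q ^ e k)).
Proof.
apply (has_coefs_series (fun k n => delta (e k) n) (fun k q => q ^ e k)).
- intros k n Hn; unfold delta; generalize (He k); intros Hk.
  destruct (Nat.eqb_spec n (e k)); lia.
- intros s Hs; exists 1%R; intros k n.
  assert (H1 : (0 <= s ^ n <= 1)%R)
    by (split; [apply pow_le; lra|rewrite <- (pow1 n); apply pow_incr; lra]).
  unfold delta; destruct (n =? e k)%nat; rewrite Rabs_pos_eq; lra.
- intros k; apply has_coefs_delta.
- exact power_series_exponents.
Qed.

(** The Lambert series over the moduli e 0, e 1, ..., where e k > k makes the
double sum triangular. *)
Lemma has_coefs_lambert :
  has_coefs (fun n => zsum (fun k => lambert_coef (e k) n) (S n))
            (fun q => Cseries (fun k => q ^ e k / (1 + q ^ e k))).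
Proof.
apply (has_coefs_series (fun k n => lambert_coef (e k) n) (fun k q => q ^ e k / (1 + q ^ e k))).
- intros k n Hn; apply lambert_coef_small; generalize (He k); lia.
- intros s Hs; exists 1%R; intros k n.
  assert (H1 : (0 <= s ^ n <= 1)%R)
    by (split; [apply pow_le; lra|rewrite <- (pow1 n); apply pow_incr; lra]).
  assert (H2 : (Rabs (IZR (lambert_coef (e k) n)) <= 1)%R).
  { rewrite <- abs_IZR; apply IZR_le.
    generalize (lambert_coef_range (e k) n); generalize (He k); lia. }
  assert (H3 := Rabs_pos (IZR (lambert_coef (e k) n))); nra.
- intros k; apply lambert_coef_has_coefs; generalize (He k); lia.
- exact lambert_series_exponents.
Qed.
End Increasing_exponents.

Definition S_odd (q : C) : C := Cseries (fun k => q ^ (2 * k + 1) / (1 + q ^ (2 * k + 1))).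
Definition S_even (q : C) : C := Cseries (fun k => q ^ (2 * S k) / (1 + q ^ (2 * S k))).
Definition squares (q : C) : C := Cseries (fun k => q ^ (S k * S k)).
Definition squares_from_9 (q : C) : C := Cseries (fun k => q ^ (S (S (S k)) * S (S (S k)))).
(** The generating function of the partitions into distinct odd parts. *)
Definition P_at_1 (q : C) : C := qpoch_inf (- q) (q ^ 2).

Lemma squares_split (q : C) : (Cmod q < 1)%R -> squares q = q + (q ^ 4 + squares_from_9 q).
Proof.
intros Hq; unfold squares; apply Cseries_eq.
replace (q + (q ^ 4 + squares_from_9 q)) with (q ^ (1 * 1) + (q ^ (2 * 2) + squares_from_9 q)) by (simpl; ring).
apply (series_cons (fun k => q ^ (S k * S k))).
apply (series_cons (fun k => q ^ (S (S k) * S (S k)))).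
apply (power_series_exponents (fun k => S (S (S k)) * S (S (S k)))%nat); [nia|exact Hq].
Qed.

Lemma S_odd_coefs : has_coefs s_odd_coef S_odd.
Proof. apply (has_coefs_lambert (fun k => 2 * k + 1)%nat); lia. Qed.
Lemma S_even_coefs : has_coefs s_even_coef S_even.
Proof. apply (has_coefs_lambert (fun k => 2 * S k)%nat); lia. Qed.
Lemma squares_coefs : has_coefs square_coef squares.
Proof. apply (has_coefs_powers (fun k => S k * S k)%nat); nia. Qed.

Lemma squares_from_9_nonneg : nonneg_coefs squares_from_9.
Proof.
eexists; split; [|apply (has_coefs_powers (fun k => S (S (S k)) * S (S (S k)))%nat); nia].
intros n; apply zsum_nonneg; intros k _; unfold delta; destruct (n =? _)%nat; lia.
Qed.

(** The coefficients of the finite product (1 + q^3)(1 + q^5)...(1 + q^{2k+1}). *)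
Fixpoint ucoef (k : nat) : nat -> Z :=
  match k with
  | O => delta 0
  | S j => fun n => (ucoef j n + delay (2 * j + 3) (ucoef j) n)%Z
  end.

Lemma qpoch_q3_S (q : C) (k : nat) :
  qpoch (- q ^ 3) (q ^ 2) (S k)
  = qpoch (- q ^ 3) (q ^ 2) k + q ^ (2 * k + 3) * qpoch (- q ^ 3) (q ^ 2) k.
Proof.
change (qpoch (- q ^ 3) (q ^ 2) (S k))
  with (qpoch (- q ^ 3) (q ^ 2) k * (1 - - q ^ 3 * (q ^ 2) ^ k)).
rewrite Cpow_double, (Cpow_add_r q (2 * k) 3); ring.
Qed.

Lemma ucoef_has_coefs (k : nat) : has_coefs (ucoef k) (fun q => qpoch (- q ^ 3) (q ^ 2) k).
Proof.
induction k as [|k IH]; [exact (has_coefs_delta 0)|].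
refine (has_coefs_ext _ _ _ _ _ _
          (has_coefs_plus _ _ _ _ IH (has_coefs_delay (2 * k + 3) _ _ IH))).
- reflexivity.
- intros q _; now rewrite qpoch_q3_S.
Qed.

Lemma ucoef_nonneg (k n : nat) : (0 <= ucoef k n)%Z.
Proof.
revert n; induction k as [|k IH]; intros n; simpl.
- unfold delta; destruct (n =? 0)%nat; lia.
- apply Z.add_nonneg_nonneg; [apply IH|now apply delay_nonneg].
Qed.

Lemma delay_bound (m : nat) (a : nat -> Z) (s B : R) :
  (0 <= s)%R -> (0 <= B)%R -> (forall n, (Rabs (IZR (a n)) * s ^ n <= B)%R) ->
  forall n, (Rabs (IZR (delay m a n)) * s ^ n <= s ^ m * B)%R.
Proof.
intros Hs HB Ha n; unfold delay; destruct (Nat.ltb_spec n m).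
- rewrite Rabs_R0, Rmult_0_l; apply Rmult_le_pos; [now apply pow_le|exact HB].
- replace (s ^ n)%R with (s ^ m * s ^ (n - m))%R by (rewrite <- pow_add; f_equal; lia).
  replace (Rabs (IZR (a (n - m)%nat)) * (s ^ m * s ^ (n - m)))%R
    with (s ^ m * (Rabs (IZR (a (n - m)%nat)) * s ^ (n - m)))%R by ring.
  apply Rmult_le_compat_l; [now apply pow_le|apply Ha].
Qed.

(** The coefficients are non-negative, so each term at q = s is at most the value of
the product at s. *)
Lemma ucoef_bound (s : R) (k n : nat) :
  (0 < s < 1)%R ->
  (Rabs (IZR (ucoef k n)) * s ^ n <= Cmod (qpoch (- RtoC s ^ 3) (RtoC s ^ 2) k))%R.
Proof.
intros Hs; revert n; induction k as [|k IH]; intros n.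
- simpl qpoch; rewrite Cmod_1; simpl; unfold delta.
  assert (H1 : (0 <= s ^ n <= 1)%R)
    by (split; [apply pow_le; lra|rewrite <- (pow1 n); apply pow_incr; lra]).
  destruct (n =? 0)%nat; rewrite Rabs_pos_eq; lra.
- set (B := Cmod (qpoch (- RtoC s ^ 3) (RtoC s ^ 2) k)) in *.
  assert (HB : (0 <= B)%R) by apply Cmod_ge_0.
  rewrite qpoch_q3_S.
  replace (qpoch (- RtoC s ^ 3) (RtoC s ^ 2) k
             + RtoC s ^ (2 * k + 3) * qpoch (- RtoC s ^ 3) (RtoC s ^ 2) k)
    with (RtoC (1 + s ^ (2 * k + 3)) * qpoch (- RtoC s ^ 3) (RtoC s ^ 2) k)
    by (rewrite RtoC_plus, RtoC_pow; ring).
  assert (Hp : (0 <= s ^ (2 * k + 3))%R) by (apply pow_le; lra).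
  rewrite Cmod_mult, Cmod_R, (Rabs_pos_eq (1 + s ^ (2 * k + 3))) by lra; fold B.
  change (ucoef (S k) n) with (ucoef k n + delay (2 * k + 3) (ucoef k) n)%Z.
  rewrite plus_IZR.
  assert (Hn : (0 <= s ^ n)%R) by (apply pow_le; lra).
  eapply Rle_trans; [apply Rmult_le_compat_r; [exact Hn|apply Rabs_triang]|].
  rewrite Rmult_plus_distr_r, Rmult_plus_distr_r, Rmult_1_l.
  apply Rplus_le_compat; [apply IH|].
  apply delay_bound; [lra|exact HB|exact IH].
Qed.

(** The part of (1 - q^2) ((-q^3;q^2) - 1) beyond q^3 + q^8. *)
Definition P_remainder (q : C) : C :=
  Cseries (fun k => q ^ (4 * k + 12) * qpoch (- q ^ 3) (q ^ 2) (S k)).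

Lemma Cmod_q3 (q : C) : (Cmod q < 1)%R -> (Cmod (- q ^ 3) <= 1)%R.
Proof. intros Hq; rewrite Cmod_opp; now apply Cmod_pow_le_1. Qed.

Lemma U_bound (q : C) (k : nat) :
  (Cmod q < 1)%R -> (Cmod (qpoch (- q ^ 3) (q ^ 2) k) <= qbound 1 (Cmod (q ^ 2)))%R.
Proof.
intros Hq; eapply Rle_trans; [now apply qpoch_bound, Cmod_sqr_lt_1|].
apply qbound_mono; [now apply Cmod_sqr_lt_1|now apply Cmod_q3].
Qed.

Lemma U_series (q : C) (e i : nat -> nat) :
  (Cmod q < 1)%R -> (forall k, (k <= e k)%nat) ->
  Cis_series (fun k => q ^ e k * qpoch (- q ^ 3) (q ^ 2) (i k))
    (Cseries (fun k => q ^ e k * qpoch (- q ^ 3) (q ^ 2) (i k))).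
Proof.
intros Hq He.
apply (series_geom_le _ (qbound 1 (Cmod (q ^ 2))) (Cmod q));
  [split; [apply Cmod_ge_0|exact Hq]|].
intros k; rewrite Cmod_mult, Rmult_comm.
apply Rmult_le_compat; try apply Cmod_ge_0; [now apply U_bound|].
rewrite Cmod_pow; apply pow_le_pow; [split; [apply Cmod_ge_0|lra]|apply He].
Qed.

Lemma P_remainder_nonneg : nonneg_coefs P_remainder.
Proof.
eexists; split.
2:{ apply (has_coefs_series (fun k => delay (4 * k + 12) (ucoef (S k)))
             (fun k q => q ^ (4 * k + 12) * qpoch (- q ^ 3) (q ^ 2) (S k))).
    - intros k n Hn; unfold delay; now rewrite (proj2 (Nat.ltb_lt n (4 * k + 12))) by lia.
    - intros s Hs; exists (1 * qbound 1 (Cmod (RtoC s ^ 2)))%R; intros k n.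
      assert (Hs' : (Cmod (RtoC s) < 1)%R) by (rewrite Cmod_R, Rabs_pos_eq; lra).
      eapply Rle_trans.
      + apply (delay_bound _ _ s (Cmod (qpoch (- RtoC s ^ 3) (RtoC s ^ 2) (S k))));
          [lra|apply Cmod_ge_0|intros j; now apply ucoef_bound].
      + apply Rmult_le_compat; [apply pow_le; lra|apply Cmod_ge_0| |now apply U_bound].
        rewrite <- (pow1 (4 * k + 12)); apply pow_incr; lra.
    - intros k; apply has_coefs_delay, ucoef_has_coefs.
    - intros q Hq.
      apply (U_series q (fun k => 4 * k + 12)%nat S Hq); lia. }
intros n; apply zsum_nonneg; intros k _; apply delay_nonneg; intros j; apply ucoef_nonneg.
Qed.

(** The coefficients of (-q;q^2) never decrease, except from q to q^2. Indeed (1 - q)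
meets the factor 1 + q: (1 - q)(-q;q^2) = (1 - q^2) W with W = (-q^3;q^2), and for
partitions into distinct odd parts >= 3, adding 2 to the largest part is
injective. In formulas, sort W - 1 by the largest part 2k+3 and take the
difference of consecutive terms. *)
Lemma product_times_1_minus_q (q : C) :
  (Cmod q < 1)%R -> (1 - q) * P_at_1 q = 1 - q ^ 2 + q ^ 3 + q ^ 8 + P_remainder q.
Proof.
intros Hq; assert (HQ := Cmod_sqr_lt_1 q Hq).
set (U := qpoch (- q ^ 3) (q ^ 2)).
set (W := qpoch_inf (- q ^ 3) (q ^ 2)).
assert (EP : P_at_1 q = (1 + q) * W).
{ unfold P_at_1, W; rewrite (qpoch_inf_head (- q) _ HQ).
  f_equal; [ring|f_equal; simpl; ring]. }
set (v := fun k => q ^ (2 * k + 3) * U k).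
assert (SV : Cis_series v (W - 1)).
{ apply (series_ext (fun k => U (S k) - U k)).
  - intros k; unfold v, U; rewrite qpoch_q3_S; ring.
  - exact (series_telescope U W (qpoch_inf_tends _ _ HQ)). }
assert (E0 : v O = q ^ 3) by (unfold v, U; simpl; ring).
assert (E1 : v 1%nat = q ^ 5 * (1 + q ^ 3)) by (unfold v, U; simpl; ring).
assert (SV1 : Cis_series (fun k => v (S k)) (W - 1 - q ^ 3)).
{ apply series_cons; rewrite E0.
  match goal with |- is_series _ ?x => replace x with (W - 1) by ring end; exact SV. }
assert (SV2 : Cis_series (fun k => v (S (S k))) (W - 1 - q ^ 3 - q ^ 5 * (1 + q ^ 3))).
{ apply (series_cons (fun k => v (S k))); rewrite E1.
  match goal with |- is_series _ ?x => replace x with (W - 1 - q ^ 3) by ring end; exact SV1. }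
assert (ER : P_remainder q = W - 1 - q ^ 3 - q ^ 5 * (1 + q ^ 3) - q ^ 2 * (W - 1 - q ^ 3)).
{ unfold P_remainder; apply Cseries_eq.
  apply (series_ext (fun k => v (S (S k)) - q ^ 2 * v (S k))).
  - intros k; unfold v, U; rewrite (qpoch_q3_S q (S k)).
    replace (q ^ (2 * S (S k) + 3)) with (q ^ 2 * q ^ (2 * S k + 3))
      by (rewrite <- Cpow_add_r; f_equal; lia).
    replace (q ^ (4 * k + 12)) with (q ^ 2 * q ^ (2 * S k + 3) * q ^ (2 * S k + 3))
      by (rewrite <- !Cpow_add_r; f_equal; lia).
    ring.
  - now apply series_minus; [|apply series_scal]. }
rewrite EP, ER; ring.
Qed.

Definition X_fun (q : C) : C := S_even q + RtoC (-1) * S_odd q + RtoC 2 * squares q.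

Definition F3_main (q : C) : C :=
  S_even q + q ^ 1 * S_even q + q ^ 3 * (S_even q / (1 - q)) + q ^ 8 * (S_even q / (1 - q)).

Lemma X_fun_coefs : has_coefs x_coef X_fun.
Proof.
refine (has_coefs_plus _ _ _ _ (has_coefs_plus _ _ _ _ S_even_coefs _) _).
- exact (has_coefs_scal (-1) _ _ S_odd_coefs).
- exact (has_coefs_scal 2 _ _ squares_coefs).
Qed.

Lemma F3_main_coefs : has_coefs f3_coef F3_main.
Proof.
assert (HC := has_coefs_psum _ _ S_even_coefs).
exact (has_coefs_plus _ _ _ _
  (has_coefs_plus _ _ _ _
    (has_coefs_plus _ _ _ _ S_even_coefs (has_coefs_delay 1 _ _ S_even_coefs))
    (has_coefs_delay 3 _ _ HC)) (has_coefs_delay 8 _ _ HC)).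
Qed.

Lemma T_fun_coefs :
  has_coefs t_coef (fun q => X_fun q + q ^ 1 * X_fun q + RtoC 2 * (q ^ 1 * F3_main q + q ^ 4 * F3_main q)).
Proof.
exact (has_coefs_plus _ _ _ _
  (has_coefs_plus _ _ _ _ X_fun_coefs (has_coefs_delay 1 _ _ X_fun_coefs))
  (has_coefs_scal 2 _ _ (has_coefs_plus _ _ _ _
     (has_coefs_delay 1 _ _ F3_main_coefs) (has_coefs_delay 4 _ _ F3_main_coefs)))).
Qed.

(** Replace (-q;q^2) by (1 - q^2 + q^3 + q^8 + P_remainder)/(1 - q) in
F1 - F2 = (-q;q^2) X + 2 (q + q^4 + q^9 + ...) F3. The result is a sum of
products of series with non-negative coefficients, once the terms with
negative signs are grouped into the series of t_coef and f3_coef. *)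
Lemma F1_minus_F2_nonneg : nonneg_coefs (fun q => F1 q - F2 q).
Proof.
assert (NG : nonneg_coefs (fun q => X_fun q / (1 - q)))
  by (exists (psum x_coef); split; [apply psum_x_coef_nonneg|apply has_coefs_psum, X_fun_coefs]).
assert (NC : nonneg_coefs (fun q => S_even q / (1 - q)))
  by (exists (psum s_even_coef); split; [apply psum_s_even_nonneg|apply has_coefs_psum, S_even_coefs]).
assert (NF : nonneg_coefs F3_main) by (exists f3_coef; split; [apply f3_coef_nonneg|apply F3_main_coefs]).
assert (NT : nonneg_coefs (fun q => X_fun q + q ^ 1 * X_fun q
                                    + RtoC 2 * (q ^ 1 * F3_main q + q ^ 4 * F3_main q)))
  by (exists t_coef; split; [apply t_coef_nonneg|apply T_fun_coefs]).
assert (NR := P_remainder_nonneg).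
assert (N2 : nonneg_coefs (fun _ => RtoC 2)).
{ apply (nonneg_ext (fun q => q ^ 0 + q ^ 0)); [intros q _; simpl; rewrite <- RtoC_plus; f_equal; lra|].
  apply nonneg_plus; apply nonneg_monomial. }
assert (NF3 : nonneg_coefs (fun q => F3_main q + P_remainder q * (S_even q / (1 - q))))
  by (apply nonneg_plus; [|apply nonneg_mult]; assumption).
apply (nonneg_ext (fun q =>
   (X_fun q + q ^ 1 * X_fun q + RtoC 2 * (q ^ 1 * F3_main q + q ^ 4 * F3_main q))
   + (q ^ 3 + (q ^ 8 + P_remainder q)) * (X_fun q / (1 - q))
   + RtoC 2 * ((q ^ 1 + q ^ 4) * (P_remainder q * (S_even q / (1 - q)))
               + squares_from_9 q * (F3_main q + P_remainder q * (S_even q / (1 - q)))))).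
- intros q Hq.
  assert (Hn := one_minus_nz q Hq).
  assert (EP := product_times_1_minus_q q Hq).
  assert (ET := squares_split q Hq).
  assert (EF3 : F3 q = P_at_1 q * S_even q) by reflexivity.
  assert (EF2 : F2 q = P_at_1 q * S_odd q) by reflexivity.
  assert (EF1 : F1 q = F3 q * (1 + 2 * squares q) + 2 * P_at_1 q * squares q) by reflexivity.
  rewrite EF1, EF2, EF3.
  replace (P_at_1 q) with ((1 - q ^ 2 + q ^ 3 + q ^ 8 + P_remainder q) / (1 - q))
    by (rewrite <- EP; field; exact Hn).
  unfold F3_main, X_fun; rewrite ET; field; exact Hn.
- assert (M := nonneg_monomial).
  apply nonneg_plus; [apply nonneg_plus; [exact NT|]|].
  + apply nonneg_mult; [|exact NG].
    apply nonneg_plus; [apply M|apply nonneg_plus; [apply M|exact NR]].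
  + apply nonneg_mult; [exact N2|apply nonneg_plus].
    * apply nonneg_mult; [apply nonneg_plus; apply M|now apply nonneg_mult].
    * now apply nonneg_mult; [apply squares_from_9_nonneg|].
Qed.

Theorem theorem5p1 :
  (forall q : C, (Cmod q < 1)%R ->
     is_derive (K := C_AbsRing) (V := C_NormedModule)
       (fun z : C => A_phi z q + B_phi (- / z) q) (RtoC 1) (F1 q - F2 q))
  /\ coef_nonneg (fun q : C =>
       C_derive (fun z : C => A_phi z q + B_phi (- / z) q) (RtoC 1)).
Proof.
assert (D : forall q : C, (Cmod q < 1)%R ->
     is_derive (K := C_AbsRing) (V := C_NormedModule)
       (fun z : C => A_phi z q + B_phi (- / z) q) (RtoC 1) (F1 q - F2 q)).
{ intros q Hq; now apply cderiv_is_derive, derivative_at_1. }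
split; [exact D|].
apply nonneg_coef_nonneg, (nonneg_ext (fun q => F1 q - F2 q)); [|apply F1_minus_F2_nonneg].
intros q Hq; symmetry; now apply is_C_derive_unique, D.
Qed.
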